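(* Let $n$ and $k$ be integers satisfying $n \ge 4k \ge 0$. Then $$\mathrm{ex}\left(n,(k+1)K_4\right) = \Xi(n,k) + O(n),$$ where the implied constant in $O(n)$ is absolute and $$\Xi(n,k) := \begin{cases} \frac{n^2}{3} + \frac{kn}{3} - \frac{k^2}{6}, & \text{if } k \in \left[0, \frac{2n}{13}\right],\\ \frac{n^2}{3} + 2k^2, & \text{if } k \in \left[\frac{2n}{13}, \frac{n}{6}\right],\\ \frac{n^2}{4} + kn - k^2, & \text{if } k \in \left[\frac{n}{6}, \frac{(4-\sqrt{2})n}{14}\right],\\ 3kn - \frac{9k^2}{2}, & \text{if } k \in \left[\frac{(4-\sqrt{2})n}{14}, \frac{(11+\sqrt{7})n}{57}\right],\\ n^2 - 8kn + 24k^2, & \text{if } k \in \left[\frac{(11+\sqrt{7})n}{57}, \frac{n}{4}\right].\end{cases}$$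
   Context: All graphs are finite and simple. For a graph $G$, $\nu(K_4,G)$ denotes the maximum number of pairwise vertex-disjoint copies of $K_4$ in $G$. $\mathrm{ex}(n,(k+1)K_4)$ denotes the maximum number of edges in an $n$-vertex graph $G$ with $\nu(K_4,G) < k+1$. *)

(* Defs.v *)
From mathcomp Require Import all_boot all_order all_algebra.
From mathcomp Require Import reals.
From mathcomp Require Import ring lra.
Set Implicit Arguments.
Unset Strict Implicit.
Unset Printing Implicit Defensive.
Import Order.TTheory GRing.Theory Num.Theory.

(* A graph on the vertex type V is given by its edge set E : {set {set V}}. *)
Definition is_simple_graph (V : finType) (E : {set {set V}}) : bool :=
  [forall e in E, #|e| == 2].

(* A copy of K_4 is determined by its vertex set. *)
Definition is_K4 (V : finType) (E : {set {set V}}) (A : {set V}) : bool :=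
  (#|A| == 4) &&
  [forall x in A, forall y in A, (x != y) ==> ([set x; y] \in E)].

Definition is_K4_packing (V : finType) (E P : {set {set V}}) : bool :=
  [forall A in P, is_K4 E A] && trivIset P.

Definition nu_K4 (V : finType) (E : {set {set V}}) : nat :=
  \max_(P : {set {set V}} | is_K4_packing E P) #|P|.

(* ex_K4 n m is ex(n, m K_4). *)
Definition ex_K4 (n m : nat) : nat :=
  \max_(E : {set {set 'I_n}} | is_simple_graph E && (nu_K4 E < m)) #|E|.

Local Open Scope ring_scope.

(* On the boundary between two consecutive intervals the two formulas agree
   (see XiE), so testing only the right endpoints loses nothing. *)
Definition Xi (R : realType) (n k : R) : R :=
  if k <= 2 * n / 13 then n ^+ 2 / 3 + k * n / 3 - k ^+ 2 / 6
  else if k <= n / 6 then n ^+ 2 / 3 + 2 * k ^+ 2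
  else if k <= (4 - Num.sqrt 2) * n / 14 then n ^+ 2 / 4 + k * n - k ^+ 2
  else if k <= (11 + Num.sqrt 7) * n / 57 then 3 * k * n - 9 * k ^+ 2 / 2
  else n ^+ 2 - 8 * k * n + 24 * k ^+ 2.

Lemma XiE (R : realType) (n k : R) : 0 <= n ->
  [/\ k <= 2 * n / 13 -> Xi n k = n ^+ 2 / 3 + k * n / 3 - k ^+ 2 / 6,
      2 * n / 13 <= k <= n / 6 -> Xi n k = n ^+ 2 / 3 + 2 * k ^+ 2,
      n / 6 <= k <= (4 - Num.sqrt 2) * n / 14 ->
        Xi n k = n ^+ 2 / 4 + k * n - k ^+ 2,
      (4 - Num.sqrt 2) * n / 14 <= k <= (11 + Num.sqrt 7) * n / 57 ->
        Xi n k = 3 * k * n - 9 * k ^+ 2 / 2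
    & (11 + Num.sqrt 7) * n / 57 <= k ->
        Xi n k = n ^+ 2 - 8 * k * n + 24 * k ^+ 2].
Proof.
move=> n0; rewrite /Xi.
set s := Num.sqrt 2; set t := Num.sqrt 7.
have s2 : s ^+ 2 = 2 by rewrite sqr_sqrtr ?ler0n.
have t2 : t ^+ 2 = 7 by rewrite sqr_sqrtr ?ler0n.
have s0 : 0 <= s by apply: sqrtr_ge0.
have t0 : 0 <= t by apply: sqrtr_ge0.
have sl : s < 3 / 2 by nra.
have tl : 5 / 2 < t by nra.
have h1 : 2 * n / 13 <= n / 6 by lra.
have h2 : n / 6 <= (4 - s) * n / 14 by nra.
have h3 : (4 - s) * n / 14 <= (11 + t) * n / 57 by nra.
have e1 : k = 2 * n / 13 ->
  n ^+ 2 / 3 + k * n / 3 - k ^+ 2 / 6 = n ^+ 2 / 3 + 2 * k ^+ 2.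
  by move=> ->; field.
have e2 : k = n / 6 ->
  n ^+ 2 / 3 + 2 * k ^+ 2 = n ^+ 2 / 4 + k * n - k ^+ 2.
  by move=> ->; field.
have e3 : k = (4 - s) * n / 14 ->
  n ^+ 2 / 4 + k * n - k ^+ 2 = 3 * k * n - 9 * k ^+ 2 / 2.
  move=> ->; apply/eqP; rewrite -subr_eq0; apply/eqP.
  transitivity ((s ^+ 2 - 2) * n ^+ 2 / 56); first by field.
  by rewrite s2 subrr !mul0r.
have e4 : k = (11 + t) * n / 57 ->
  3 * k * n - 9 * k ^+ 2 / 2 = n ^+ 2 - 8 * k * n + 24 * k ^+ 2.
  move=> ->; apply/eqP; rewrite -subr_eq0; apply/eqP.
  transitivity ((7 - t ^+ 2) * n ^+ 2 / 114); first by field.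
  by rewrite t2 subrr !mul0r.
split.
- by move=> ->.
- move=> /andP[a b]; case: leP => [c|_]; last by rewrite b.
  by apply: e1; apply: le_anti; rewrite a c.
- move=> /andP[a b]; case: leP => [c|_].
    by rewrite e1 ?e2 //; apply: le_anti; apply/andP; split; lra.
  case: leP => [c|_]; last by rewrite b.
  by apply: e2; apply: le_anti; rewrite a c.
- move=> /andP[a b]; case: leP => [c|_].
    by rewrite e1 ?e2 ?e3 //; apply: le_anti; apply/andP; split; lra.
  case: leP => [c|_].
    by rewrite e2 ?e3 //; apply: le_anti; apply/andP; split; lra.
  case: leP => [c|_]; last by rewrite b.
  by apply: e3; apply: le_anti; rewrite a c.
- move=> a; case: leP => [c|_].
    by rewrite e1 ?e2 ?e3 ?e4 //; apply: le_anti; apply/andP; split; lra.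
  case: leP => [c|_].
    by rewrite e2 ?e3 ?e4 //; apply: le_anti; apply/andP; split; lra.
  case: leP => [c|_].
    by rewrite e3 ?e4 //; apply: le_anti; apply/andP; split; lra.
  case: leP => [c|_] //.
  by apply: e4; apply: le_anti; rewrite a c.
Qed.

(* Main.v *)
Require Import Defs.
From mathcomp Require Import all_boot all_order all_algebra.
From mathcomp Require Import reals.
From mathcomp Require Import zify ring lra.
Import Order.TTheory GRing.Theory Num.Theory.
(** Fix a graph whose largest family of disjoint K4's (a tiling, whose members
    are the tiles) has [k] members, let [n = 4k + m], and call the [m] vertices
    left uncovered the rest; the rest contains no K4.  In the coordinates
    [(k, m)] the five formulas for [Xi] become the quadratic forms [Xi1] to
    [Xi5] below, and the thresholds become [m = 5k/2], [m = 2k],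
    [m = sqrt 2 * k] and [m = (3 - sqrt 7) k / 2].

    Lower bound.  Each form is, up to O(n), the number of edges of a blow-up of
    a small graph: a clique joined to some independent sets that are joined to
    each other.  If every K4 has at least [j] vertices in a fixed set of at most
    [jk] vertices, then there are at most [k] disjoint K4's ([nu_hitting]); this
    settles all five shapes.

    Upper bound.  By induction on the number of vertices, a counterexample may
    be assumed minimal.  Removing a set [S] then loses more edges than the
    formula does ([removal]), so a vertex, a K4, or a set whose removal destroys
    a tile, has few non-neighbours.  On the other hand the non-neighbours
    of a set can be counted tile by tile, and two disjoint cliques in the rest
    that are almost joined to one tile would turn that tile into two disjoint
    K4's ([no_gain]), which is impossible.  These two facts collide, in three
    different ways according to the ratio [m / k].

    - Small rest ([5m <= 7k]).  Take a K4 through a vertex [w] with as many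
      non-neighbours as possible and tile while avoiding the other three
      vertices of that K4.  Every remaining vertex of the rest has more
      non-neighbours than [w], so it lies in no K4.  Zykov's symmetrization,
      applied on both sides, then bounds the number of edges
      ([k4_avoiding_bound]).
    - Large rest ([9m >= 13k]).  Any tiling leaves at most three disjoint
      triangles in its rest ([triangles_le3]).  But vertices have so few
      non-neighbours that the rest has a large matching, and edges of the
      matching can be traded against tiles, each trade putting a new
      triangle into the rest ([production_step]); four trades are absurd.
    - Middle range.  Let [e] be an edge of a K4 with as few non-neighbours as
      possible.  In the rest of a tiling avoiding [e], no edge disjoint from [e]
      lies in a K4 ([rest_edges_free]), and this persists for
      the vertices that can be exchanged with the rest ([core_edges_free]).
      Counting edges, again with symmetrization, leaves a quadratic inequality
      ([core_bound], [loose_excess]).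

    The forms and their slopes are compared by elementary real arithmetic.  When
    [k] is bounded, Turan's theorem for the rest suffices. *)

Set Implicit Arguments.
Unset Strict Implicit.
Unset Printing Implicit Defensive.
Local Open Scope nat_scope.

(** * Pairs of vertices, cliques and disjoint families *)
Lemma subset_between (T : finType) (A B : {set T}) p :
  A \subset B -> #|A| <= p <= #|B| -> exists P : {set T},
  [/\ A \subset P, P \subset B & #|P| = p].
Proof.
move=> sAB /andP[]; elim: p => [|p IH] lA lB.
  by exists A; split=> //; apply/eqP; rewrite -leqn0.
have [eA|nA] := eqVneq #|A| p.+1; first by exists A.
have [||P [sAP sPB cP]] := IH; [by rewrite -ltnS ltn_neqAle nA|exact: ltnW|].
have /subsetPn[x xB xP] : ~~ (B \subset P).
  by apply/negP=> /subset_leq_card; rewrite cP leqNgt lB.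
exists (x |: P); split.
- by rewrite (subset_trans sAP) // subsetUr.
- by rewrite subUset sub1set xB.
- by rewrite cardsU1 xP cP.
Qed.

Lemma subset_of_card (T : finType) (A : {set T}) p : p <= #|A| -> exists2 B : {set T}, B \subset A & #|B| = p.
Proof.
move=> le; have [|B [_ sB cB]] := subset_between (p := p) (sub0set A).
  by rewrite cards0.
by exists B.
Qed.

Lemma disjoint_notin (T : finType) (A B : {set T}) x : [disjoint A & B] -> x \in A -> x \notin B.
Proof. by move=> d xA; rewrite (disjointFr d xA). Qed.

Lemma disjointI (T : finType) (A B : {set T}) : (forall x, x \in A -> x \notin B) -> [disjoint A & B].
Proof.
move=> h; rewrite -setI_eq0; apply/eqP/setP => x; rewrite !inE.
by apply/negP => /andP[/h /negP].
Qed.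

Lemma sum_ge_const (I : finType) (P : {set I}) (F : I -> nat) c :
  (forall i, i \in P -> c <= F i) -> c * #|P| <= \sum_(i in P) F i.
Proof. by move=> h; rewrite mulnC -sum_nat_const; apply: leq_sum. Qed.

Lemma sum_lt_exists (I : finType) (P : {set I}) (F : I -> nat) c :
  \sum_(i in P) F i < c * #|P| -> exists2 i, i \in P & F i < c.
Proof.
move=> lt; apply/exists_inP; case: (boolP [exists i in P, F i < c]) => //.
rewrite negb_exists_in => /forall_inP H; move: lt; rewrite ltnNge => /negP[].
by apply: sum_ge_const => i /H; rewrite -leqNgt.
Qed.

Lemma sum_meet_trivIset (T : finType) (M : {set {set T}}) (H : {set T}) : trivIset M ->
  \sum_(f in M) #|f :&: H| <= #|H|.
Proof.
move=> tM; have e (f : {set T}) : #|f :&: H| = \sum_(x in f) (x \in H).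
  rewrite -sum1_card big_mkcond [RHS]big_mkcond; apply: eq_bigr => x _.
  by rewrite inE; case: (x \in f); case: (x \in H).
under eq_bigr do rewrite e.
rewrite -(big_trivIset _ tM) /= -sum1_card.
rewrite big_mkcond [X in _ <= X]big_mkcond; apply: leq_sum => x _.
by case: (x \in H); case: ifP.
Qed.

Section Graph.
Variables (T : finType) (g : rel T).
Hypotheses (gS : symmetric g) (gI : irreflexive g).
Implicit Types (A B C K Q R S U f : {set T}) (P M : {set {set T}}) (u v w x y : T).

Definition nbr v := [set u | g v u].

(** Ordered pairs are counted, so [edges A A] is twice the number of edges
    spanned by [A], while [nonedges A A] includes the diagonal: a vertex is one
    of its own non-neighbours.  With this convention both counts are additive
    in each argument and add up to [#|A| * #|B|]. *)
Definition edges A B := \sum_(a in A) \sum_(b in B) (g a b : nat).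
Definition nonedges A B := \sum_(a in A) \sum_(b in B) (~~ g a b : nat).

Definition clique A := [forall x in A, forall y in A, (x != y) ==> g x y].
Definition k4 A := (#|A| == 4) && clique A.
(** Triangles ([j = 3]), matchings ([j = 2]) and families of K4's are handled
    alike. *)
Definition kfam j U P :=
  [forall f in P, [&& #|f| == j, clique f & f \subset U]] && trivIset P.
Definition packing := kfam 4.
Definition nu U := \max_(P | packing U P) #|P|.
Definition common_nbrs S Q := [set q in Q | S \subset nbr q].

Lemma cliqueP A : reflect {in A &, forall x y, x != y -> g x y} (clique A).
Proof.
apply: (iffP forall_inP) => [h x y xA yA|h x xA].
  by have /forall_inP/(_ y yA)/implyP := h x xA.
by apply/forall_inP=> y yA; apply/implyP; apply: h.
Qed.

Lemma edges_sym A B : edges A B = edges B A.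
Proof.
by rewrite /edges exchange_big; apply: eq_bigr => b _; apply: eq_bigr => a _;
   rewrite gS.
Qed.

Lemma nonedges_sym A B : nonedges A B = nonedges B A.
Proof.
by rewrite /nonedges exchange_big; apply: eq_bigr => b _; apply: eq_bigr => a _;
   rewrite gS.
Qed.

Lemma nonedgesUl A B C : [disjoint A & B] -> nonedges (A :|: B) C = nonedges A C + nonedges B C.
Proof.
by move=> dAB; rewrite /nonedges -bigU //; apply: eq_bigl => x; rewrite !inE.
Qed.

Lemma nonedgesUr A B C : [disjoint B & C] -> nonedges A (B :|: C) = nonedges A B + nonedges A C.
Proof. by move=> d; rewrite nonedges_sym nonedgesUl // !(nonedges_sym A). Qed.

Lemma edgesUl A B C : [disjoint A & B] -> edges (A :|: B) C = edges A C + edges B C.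
Proof.
by move=> dAB; rewrite /edges -bigU //; apply: eq_bigl => x; rewrite !inE.
Qed.

Lemma edgesUr A B C : [disjoint B & C] -> edges A (B :|: C) = edges A B + edges A C.
Proof. by move=> d; rewrite edges_sym edgesUl // !(edges_sym A). Qed.

Lemma edges_nonedges A B : edges A B + nonedges A B = #|A| * #|B|.
Proof.
rewrite /edges /nonedges -big_split /= -sum_nat_const; apply: eq_bigr => a _.
by rewrite -big_split /= -sum1_card; apply: eq_bigr => b _; case: g.
Qed.

Lemma edges1 v A : edges [set v] A = #|A :&: nbr v|.
Proof.
rewrite /edges big_set1 -sum1_card big_mkcond [RHS]big_mkcond.
by apply: eq_bigr => b _; rewrite !inE; case: (b \in A); case: (g v b).
Qed.

Lemma nonedges1 v A : nonedges [set v] A = #|A :\: nbr v|.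
Proof.
rewrite /nonedges big_set1 -sum1_card big_mkcond [RHS]big_mkcond.
by apply: eq_bigr => b _; rewrite !inE; case: (b \in A); case: (g v b).
Qed.

Lemma nonedges_sum1 A B : nonedges A B = \sum_(a in A) nonedges [set a] B.
Proof. by rewrite /nonedges; apply: eq_bigr => a _; rewrite big_set1. Qed.

Lemma edges_sum1 A B : edges A B = \sum_(a in A) edges [set a] B.
Proof. by rewrite /edges; apply: eq_bigr => a _; rewrite big_set1. Qed.

Lemma nonedgesSr A B C : B \subset C -> nonedges A B <= nonedges A C.
Proof.
move=> sBC; rewrite /nonedges; apply: leq_sum => a _.
rewrite [X in _ <= X](bigID (mem B)) /=; apply: leq_trans (leq_addr _ _).
rewrite [X in _ <= X](eq_bigl (mem B)) // => i /=.
by case iB: (i \in B); rewrite ?andbF // (subsetP sBC).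
Qed.

Lemma nonedgesSl A B C : A \subset B -> nonedges A C <= nonedges B C.
Proof. by move=> s; rewrite !(nonedges_sym _ C) nonedgesSr. Qed.

Lemma nonedges_cover A P : trivIset P -> nonedges A (cover P) = \sum_(Q in P) nonedges A Q.
Proof.
move=> tP; rewrite /nonedges exchange_big /= -exchange_big /=.
rewrite (eq_bigr (fun a => \sum_(Q in P) \sum_(b in Q) (~~ g a b : nat))).
  by rewrite exchange_big.
by move=> a _; rewrite big_trivIset.
Qed.

Lemma nonedges0P A B : reflect {in A & B, forall a b, g a b} (nonedges A B == 0).
Proof.
rewrite /nonedges sum_nat_eq0; apply: (iffP forall_inP) => h a.
  move=> b aA bB; have := h a aA.
  by rewrite sum_nat_eq0 => /forall_inP/(_ b bB); case: g.
by move=> aA; rewrite sum_nat_eq0; apply/forall_inP => b bB; rewrite h.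
Qed.

Lemma edges0P A B : reflect {in A & B, forall a b, ~~ g a b} (edges A B == 0).
Proof.
rewrite /edges sum_nat_eq0; apply: (iffP forall_inP) => h a.
  move=> b aA bB; have := h a aA.
  by rewrite sum_nat_eq0 => /forall_inP/(_ b bB); case: g.
by move=> aA; rewrite sum_nat_eq0; apply/forall_inP => b bB; rewrite (negPf (h _ _ aA bB)).
Qed.

Lemma common_nbrs_sub S Q : common_nbrs S Q \subset Q.
Proof. by apply/subsetP => q; rewrite inE => /andP[]. Qed.

Lemma common_nbrsP S Q q : reflect (q \in Q /\ {in S, forall s, g s q}) (q \in common_nbrs S Q).
Proof.
rewrite inE; apply: (iffP andP) => [[qQ /subsetP h]|[qQ h]]; split=> //.
  by move=> s /h; rewrite inE gS.
by apply/subsetP => s /h; rewrite inE gS.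
Qed.

(** Each vertex of [Q] that is not joined to all of [S] contributes a pair. *)
Lemma nonedges_common_nbrs S Q : #|Q :\: common_nbrs S Q| <= nonedges S Q.
Proof.
rewrite nonedges_sym -sum1_card nonedges_sum1.
rewrite [X in _ <= X](bigID (mem (common_nbrs S Q))) /=.
apply: leq_trans (leq_addl _ _).
rewrite [X in _ <= X](eq_bigl (mem (Q :\: common_nbrs S Q))); last first.
  by move=> i; rewrite [RHS]in_setD andbC.
apply: leq_sum => q; rewrite inE => /andP[qn qQ].
rewrite lt0n; apply/negP => /nonedges0P h; case/negP: qn; apply/common_nbrsP; split=> // s sS.
by rewrite gS; apply: h; rewrite ?inE.
Qed.

Lemma card_common_nbrs S Q : #|Q| <= #|common_nbrs S Q| + nonedges S Q.
Proof.
rewrite -(cardsID (common_nbrs S Q) Q) leq_add ?nonedges_common_nbrs //.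
by apply: subset_leq_card; rewrite subsetIr.
Qed.

Lemma nonedges_self A : #|A| <= nonedges A A.
Proof.
rewrite nonedges_sum1 -sum1_card; apply: leq_sum => a aA; rewrite nonedges1.
by apply/card_gt0P; exists a; rewrite !inE gI.
Qed.

Lemma cliqueS A B : A \subset B -> clique B -> clique A.
Proof.
by move=> /subsetP s /cliqueP h; apply/cliqueP => x y /s xB /s yB; apply: h.
Qed.

Lemma cliqueU A B : clique A -> clique B -> {in A & B, forall a b, g a b} ->
  clique (A :|: B).
Proof.
move=> /cliqueP hA /cliqueP hB hAB; apply/cliqueP => x y.
rewrite !inE => /orP[xA|xB] /orP[yA|yB] ne.
- exact: hA.
- exact: hAB.
- by rewrite gS hAB.
- exact: hB.
Qed.

Lemma clique1 x : clique [set x].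
Proof. by apply/cliqueP => a b; rewrite !inE => /eqP-> /eqP->; rewrite eqxx. Qed.

Lemma joined_disjoint A B : {in A & B, forall a b, g a b} -> [disjoint A & B].
Proof.
move=> h; rewrite -setI_eq0; apply/eqP/setP => x; rewrite !inE.
by apply/negP => /andP[xA xB]; have := h _ _ xA xB; rewrite gI.
Qed.

Lemma k4U A B : clique A -> clique B -> {in A & B, forall a b, g a b} ->
  #|A| + #|B| = 4 -> k4 (A :|: B).
Proof.
move=> cA cB j c; rewrite /k4 cliqueU // andbT cardsU.
have := joined_disjoint j; rewrite -setI_eq0 => /eqP->.
by rewrite cards0 subn0 c.
Qed.

Lemma k4_card K : k4 K -> #|K| = 4. Proof. by case/andP=> /eqP. Qed.
Lemma k4_clique K : k4 K -> clique K. Proof. by case/andP. Qed.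

Lemma kfamP j R M : reflect
  ((forall f, f \in M -> [/\ #|f| = j, clique f & f \subset R]) /\ trivIset M)
  (kfam j R M).
Proof.
apply: (iffP andP) => [[/forall_inP h t]|[h t]]; split=> //.
  by move=> f /h /and3P[/eqP].
by apply/forall_inP => f /h [-> -> ->]; rewrite eqxx.
Qed.

Lemma kfam0 j R : kfam j R set0.
Proof.
apply/kfamP; split=> [f|]; first by rewrite inE.
by apply/trivIsetP => A B; rewrite inE.
Qed.

Lemma kfam_cover j R M : kfam j R M -> cover M \subset R.
Proof. by case/kfamP=> h _; apply/bigcupsP => f /h []. Qed.

Lemma kfam_card j R M : kfam j R M -> #|cover M| = j * #|M|.
Proof.
case/kfamP=> h /eqP <-; rewrite mulnC -sum_nat_const.
by apply: eq_bigr => K /h [].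
Qed.

Lemma kfamS j R M M' : M' \subset M -> kfam j R M -> kfam j R M'.
Proof.
move=> s /kfamP[h t]; apply/kfamP; split; last exact: trivIsetS t.
by move=> K /(subsetP s)/h.
Qed.

Lemma kfam_in j R R' M : cover M \subset R' -> kfam j R M -> kfam j R' M.
Proof.
move=> s /kfamP[h t]; apply/kfamP; split=> // f fM.
have [-> ->] := h f fM; split=> //; apply: subset_trans s; exact: bigcup_sup.
Qed.

Lemma kfamU1 j R M f : 0 < j -> kfam j R M -> #|f| = j -> clique f ->
  f \subset R -> [disjoint f & cover M] ->
  kfam j R (f |: M) /\ #|f |: M| = #|M|.+1.
Proof.
move=> j0 fM cf qf sf dK; have [h /trivIsetP t] := kfamP _ _ _ fM.
have dB B : B \in M -> [disjoint f & B].
  move=> BP; apply: disjointWr dK; exact: bigcup_sup.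
have nf : f \notin M.
  apply/negP => /dB; rewrite -setI_eq0 setIid => /eqP f0.
  by move: cf; rewrite f0 cards0 => E; rewrite -E in j0.
split; last by rewrite cardsU1 nf.
apply/kfamP; split=> [B|].
  by rewrite !inE => /orP[/eqP->|/h].
apply/trivIsetP => A B; rewrite !inE => /orP[/eqP->|AP] /orP[/eqP->|BP] ne.
- by rewrite eqxx in ne.
- exact: dB.
- by rewrite disjoint_sym dB.
- exact: t.
Qed.

Lemma packingP U P : reflect
  ((forall K, K \in P -> k4 K /\ K \subset U) /\ trivIset P) (packing U P).
Proof.
apply: (iffP (kfamP _ _ _)) => -[h t]; split=> // K /h.
  by rewrite /k4 => -[-> -> ->].
by case=> kK sK; rewrite (k4_card kK) (k4_clique kK).
Qed.

Lemma packing_subU U U' P : U \subset U' -> packing U P -> packing U' P.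
Proof. by move=> s pP; apply: (kfam_in _ pP); apply: subset_trans (kfam_cover pP) s. Qed.

Lemma nu_ge U P : packing U P -> #|P| <= nu U.
Proof. by move=> h; rewrite /nu (bigD1 P) //= leq_maxl. Qed.

Lemma nu_packing U k : k <= nu U -> exists P, packing U P /\ #|P| = k.
Proof.
move=> le.
have [P pP eP] : {P | packing U P & nu U = #|P|}.
  by apply: eq_bigmax_cond; apply/card_gt0P; exists set0; exact: kfam0.
have [||P' [_ sP cP]] := @subset_between _ set0 P k.
- exact: sub0set.
- by rewrite cards0 -eP.
by exists P'; rewrite /packing (kfamS sP).
Qed.

Lemma packingU1 U P K : packing U P -> k4 K -> K \subset U ->
  [disjoint K & cover P] -> packing U (K |: P) /\ #|K |: P| = #|P|.+1.
Proof. by move=> pP kK; apply: kfamU1 pP (k4_card kK) (k4_clique kK). Qed.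

End Graph.

(** [lia] after abstracting cardinals, sums and pair counts to variables: the
    linear arithmetic preprocessing is very slow on the raw terms. *)
Ltac nlia :=
  repeat match goal with
  | H : is_true (leq _ _) |- _ => revert H
  | H : @eq nat _ _ |- _ => revert H
  end;
  unfold reverse_coercion; simpl Finite.sort;
  first [
  repeat change (nat_of_bool true) with 1;
  repeat change (nat_of_bool false) with 0;
  repeat match goal with
  | |- context [@card ?T ?m] => generalize (@card T m); intro
  | |- context [@bigop.body ?R ?I ?x ?r ?f] =>
      generalize (@bigop.body R I x r f); intro
  | |- context [@nonedges ?T ?g ?a ?b] => generalize (@nonedges T g a b); intro
  | |- context [@edges ?T ?g ?a ?b] => generalize (@edges T g a b); intro
  | |- context [@nu ?T ?g ?a] => generalize (@nu T g a); intro
  | |- context [nat_of_bool ?b] => generalize (leq_b1 b); generalize (nat_of_bool b); intro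
  end; clear; intros; lia | intros; lia ].

(** * Tilings and exchanges *)
Section Tiling.
Variables (T : finType) (g : rel T).
Hypotheses (gS : symmetric g) (gI : irreflexive g).
Implicit Types (A B C K Q R S : {set T}) (P : {set {set T}}) (u v w x y : T).
Local Notation nonedges := (nonedges g).
Local Notation clique := (clique g).
Local Notation k4 := (k4 g).
Local Notation packing := (packing g).
Local Notation nu := (nu g).
Local Notation common_nbrs := (common_nbrs g).

Definition rest U P := U :\: cover P.

Section Fixed.
Variables (U : {set T}) (P : {set {set T}}).
Hypothesis pP : packing U P.
Local Notation R := (rest U P).

Lemma rest_sub : R \subset U. Proof. exact: subsetDl. Qed.

Lemma rest_cover : [disjoint R & cover P].
Proof.
by rewrite -setI_eq0; apply/eqP/setP => x; rewrite !inE; case: (x \in cover P);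
   rewrite ?andbF.
Qed.

Lemma rest_tile Q : Q \in P -> [disjoint R & Q].
Proof. by move=> QP; apply: disjointWr rest_cover; apply: bigcup_sup. Qed.

Lemma tileU Q : Q \in P -> Q \subset U.
Proof. by move=> QP; case: (packingP _ _ _ pP) => /(_ Q QP)[]. Qed.

Lemma tile_k4 Q : Q \in P -> k4 Q.
Proof. by move=> QP; case: (packingP _ _ _ pP) => /(_ Q QP)[]. Qed.

Lemma card_rest : #|R| + 4 * #|P| = #|U|.
Proof.
rewrite -(kfam_card pP) addnC -(cardsID (cover P) U).
by rewrite (setIidPr (kfam_cover pP)).
Qed.

Lemma nonedges_split S : nonedges S U = \sum_(Q in P) nonedges S Q + nonedges S R.
Proof.
have [_ t] := packingP _ _ _ pP.
rewrite -nonedges_cover // -nonedgesUr 1?disjoint_sym ?rest_cover //; congr nonedges.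
by rewrite -{1}(setID U (cover P)) (setIidPr (kfam_cover pP)).
Qed.

(** Replacing a tile by a K4 made from it and the rest changes the rest in a
    controlled way; all exchange arguments go through this lemma. *)
Lemma swap_tile Q K : Q \in P -> k4 K -> K \subset Q :|: R ->
  let P' := K |: P :\ Q in
  [/\ packing U P', #|P'| = #|P| & rest U P' = (Q :|: R) :\: K].
Proof.
move=> QP kK sK P'; rewrite {}/P'.
have pD : packing U (P :\ Q) by apply: kfamS pP; apply: subsetDl.
have [_ tP] := packingP _ _ _ pP.
have cD := coverD1 tP QP.
have dK : [disjoint K & cover (P :\ Q)].
  rewrite cD -setI_eq0; apply/eqP/setP => x; rewrite !inE.
  apply/negP => /andP[/(subsetP sK)]; rewrite !inE.
  by case: (x \in Q) => //=; case: (x \in cover P).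
have sKU : K \subset U.
  apply: subset_trans sK _; rewrite subUset rest_sub andbT; exact: tileU.
have [pK cK] := packingU1 pD kK sKU dK.
split=> //; first by rewrite cK (cardsD1 Q P) QP.
apply/setP => x; rewrite !inE /cover big_setU1 /=; last first.
  apply/negP => KP; have sb : K \subset cover (P :\ Q) by apply: bigcup_sup.
  have /card_gt0P[y yK] : 0 < #|K| by rewrite (k4_card kK).
  by have := disjointFr dK yK; rewrite (subsetP sb).
rewrite -/(cover (P :\ Q)) cD !inE negb_or negb_and negbK.
case xK: (x \in K) => //=.
case xQ: (x \in Q) => //=; first by rewrite (subsetP (tileU QP)).
Qed.

Hypothesis mP : nu U <= #|P|.

Lemma no_k4_rest K : k4 K -> K \subset R -> False.
Proof.
move=> kK sK.
have [pK cK] : packing U (K |: P) /\ #|K |: P| = #|P|.+1.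
  apply: (packingU1 pP kK).
    exact: subset_trans sK rest_sub.
  exact: disjointWl rest_cover.
by have := nu_ge pK; rewrite cK; nlia.
Qed.

Lemma no_two_k4 Q K1 K2 : Q \in P -> k4 K1 -> k4 K2 -> [disjoint K1 & K2] ->
  K1 \subset Q :|: R -> K2 \subset Q :|: R -> False.
Proof.
move=> QP k1 k2 d s1 s2.
have [p1 c1 r1] := swap_tile QP k1 s1.
have s2' : K2 \subset rest U (K1 |: P :\ Q).
  by rewrite r1 subsetD s2 disjoint_sym.
have [pK cK] : packing U (K2 |: (K1 |: P :\ Q)) /\
    #|K2 |: (K1 |: P :\ Q)| = #|K1 |: P :\ Q|.+1.
  apply: (packingU1 p1 k2).
    apply: subset_trans s2' _; exact: subsetDl.
  rewrite disjoint_sym; move: s2'; rewrite /rest subsetD => /andP[_].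
  by rewrite disjoint_sym.
by have := nu_ge pK; rewrite cK c1; nlia.
Qed.

(** The basic augmentation.  Two disjoint cliques of the rest, completed to K4's
    by disjoint parts of one tile, would trade one tile for two. *)
Lemma no_gain Q S1 S2 A1 A2 : Q \in P ->
  clique S1 -> clique S2 -> S1 \subset R -> S2 \subset R -> [disjoint S1 & S2] ->
  A1 \subset common_nbrs S1 Q -> A2 \subset common_nbrs S2 Q -> [disjoint A1 & A2] ->
  #|S1| + #|A1| = 4 -> #|S2| + #|A2| = 4 -> False.
Proof.
move=> QP q1 q2 s1 s2 dS a1 a2 dA c1 c2.
have cQ := k4_clique (tile_k4 QP).
have sA S A : A \subset common_nbrs S Q -> A \subset Q.
  by move=> s; apply: subset_trans s (common_nbrs_sub _ _ _).
have mk S A : clique S -> A \subset common_nbrs S Q -> #|S| + #|A| = 4 -> k4 (S :|: A).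
  move=> cS s c; apply: k4U => //.
    by apply: cliqueS cQ; apply: sA s.
  by move=> x y xS /(subsetP s)/(common_nbrsP gS)[_]; apply.
have dRQ := rest_tile QP.
apply: (no_two_k4 QP (mk _ _ q1 a1 c1) (mk _ _ q2 a2 c2)).
- rewrite -setI_eq0 setIUl !setIUr.
  have h1 : S1 :&: A2 = set0.
    by apply/eqP; rewrite setI_eq0; apply: disjointW s1 (sA _ _ a2) dRQ.
  have h2 : A1 :&: S2 = set0.
    by apply/eqP; rewrite setIC setI_eq0; apply: disjointW s2 (sA _ _ a1) dRQ.
  move: dS dA; rewrite -!setI_eq0 => /eqP-> /eqP->.
  by rewrite h1 h2 !setU0.
- by rewrite subUset (subset_trans s1) ?subsetUr // (subset_trans (sA _ _ a1)) ?subsetUl.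
- by rewrite subUset (subset_trans s2) ?subsetUr // (subset_trans (sA _ _ a2)) ?subsetUl.
Qed.

(** If at most one pair between the tile and the two cliques is missing, the tile
    splits into parts joined to [S1] and to [S2] respectively: send the vertices
    that miss [S2] to [S1], and fill up to the right size. *)
Lemma split_bound Q S1 S2 : Q \in P ->
  clique S1 -> clique S2 -> S1 \subset R -> S2 \subset R -> [disjoint S1 & S2] ->
  #|S1| + #|S2| = 4 -> 0 < #|S1| -> 0 < #|S2| -> 2 <= nonedges S1 Q + nonedges S2 Q.
Proof.
move=> QP q1 q2 s1 s2 dS c l1 l2; rewrite leqNgt; apply/negP => lt.
have cQ := k4_card (tile_k4 QP).
have b1 := nonedges_common_nbrs gS S1 Q; have b2 := nonedges_common_nbrs gS S2 Q.
have e1 : #|Q :\: common_nbrs S1 Q| + #|common_nbrs S1 Q| = 4.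
  by rewrite -cQ -(cardsID (common_nbrs S1 Q) Q) addnC (setIidPr (common_nbrs_sub _ _ _)).
have sD : Q :\: common_nbrs S2 Q \subset common_nbrs S1 Q.
  case: (leqP #|Q :\: common_nbrs S1 Q| 0) => [|l].
    rewrite leqn0 cards_eq0 setD_eq0 => s; exact: subset_trans (subsetDl _ _) s.
  have : #|Q :\: common_nbrs S2 Q| == 0 by nlia.
  by rewrite cards_eq0 => /eqP->; apply: sub0set.
have [|A1 [sA1 A1s cA1]] := subset_between (p := #|S2|) sD; first by nlia.
apply: (no_gain (A1 := A1) (A2 := Q :\: A1) QP q1 q2) => //.
- by rewrite subDset setUC -subDset.
- by rewrite -setI_eq0 setIDA setD_eq0 subsetIl.
- by rewrite cA1.
- by rewrite cardsD cQ (setIidPr (subset_trans A1s (common_nbrs_sub _ _ _))); nlia.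
Qed.

Lemma nonedges_rest_clique S : clique S -> S \subset R -> #|S| = 3 -> #|R| <= nonedges S R.
Proof.
move=> cS sS c3; apply: leq_trans (nonedges_common_nbrs gS S R).
rewrite (_ : common_nbrs S R = set0) ?setD0 //; apply/eqP; rewrite -subset0.
apply/subsetP => y /(common_nbrsP gS)[yR h]; exfalso.
apply: (@no_k4_rest (S :|: [set y])).
  apply: k4U => //; first exact: clique1.
    by move=> a b aS /set1P->; apply: h.
  by rewrite c3 cards1.
by rewrite subUset sS sub1set.
Qed.

End Fixed.
End Tiling.

(** * Zykov symmetrization *)
Section Zykov.
Variables (T : finType) (g : rel T).
Hypotheses (gS : symmetric g) (gI : irreflexive g).
Implicit Types (A B C K Q R S U : {set T}) (P : {set {set T}}) (u v w x y : T).
Local Notation nbr := (nbr g).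
Local Notation edges := (edges g).
Local Notation clique := (clique g).

Definition supp (s : T -> nat) := [set v | 0 < s v].

(** The Lagrangian of the graph at [s]: twice the number of edges of the blow-up
    in which [v] is replaced by [s v] independent vertices. *)
Definition lagrangian (s : T -> nat) := \sum_u \sum_v s u * s v * g u v.

(** Symmetrization with vertex weights.  Let [c] maximize weight plus degree and
    let [I] consist of its non-neighbours.  Giving every vertex of [I] the
    neighbourhood and the weight of [c] does not decrease the total, and the
    neighbours of [c] are treated by induction.  The outcome is recorded as the
    class sizes [s] of a complete multipartite graph, indexed by a clique of
    representatives in the original graph. *)
Lemma zykov (f : T -> nat) U : exists s : T -> nat,
  [/\ clique (supp s), supp s \subset U, \sum_v s v = #|U| &
      2 * \sum_(v in U) f v + edges U U <= 2 * \sum_v s v * f v + lagrangian s].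
Proof.
have [n] := ubnP #|U|; elim: n U => // n IH U ltU.
have [->|/set0Pn[c0 c0U]] := eqVneq U set0.
  exists (fun _ => 0); split.
  - by apply/cliqueP => x y; rewrite inE.
  - by apply/subsetP => x; rewrite inE.
  - by rewrite big1 // cards0.
  - by rewrite big_set0 /edges big_set0.
pose h v := f v + edges [set v] U.
case: (@arg_maxnP _ c0 (fun v => v \in U) h c0U) => c cU cmax.
set J := U :&: nbr c; set I := U :\: nbr c.
have cI : c \in I by rewrite !inE gI cU.
have eU : U = J :|: I by rewrite setID.
have dJI : [disjoint J & I].
  by rewrite -setI_eq0; apply/eqP/setP => x; rewrite !inE; case: (g c x);
     rewrite ?andbF.
have cardU : #|U| = #|J| + #|I| by rewrite cardsID.
have I0 : 0 < #|I| by apply/card_gt0P; exists c.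
have [|s [sc sJ ss sb]] := IH J; first by nlia.
have sc0 : s c = 0.
  apply/eqP; rewrite -leqn0 leqNgt; apply/negP => lt.
  have : c \in J by apply: (subsetP sJ); rewrite inE.
  by rewrite !inE gI andbF.
pose t v := s v + #|I| * (v == c).
have suppt : supp t = c |: supp s.
  apply/setP => v; rewrite !inE /t.
  have [->|ne] := eqVneq v c; first by rewrite muln1 addn_gt0 I0 orbT.
  by rewrite muln0 addn0.
have sNc v : 0 < s v -> g c v.
  move=> lt; have : v \in J by apply: (subsetP sJ); rewrite inE.
  by rewrite !inE => /andP[].
have sumc (F : T -> nat) : \sum_v #|I| * (v == c) * F v = #|I| * F c.
  rewrite (bigD1 c) //= eqxx muln1 big1 ?addn0 // => v /negPf->.
  by rewrite muln0.
have sumc1 : \sum_v #|I| * (v == c) = #|I|.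
  by rewrite -[RHS]muln1 -(sumc (fun=> 1)); apply: eq_bigr => v _; rewrite muln1.
exists t; split.
- rewrite suppt; apply: cliqueU => //; first exact: clique1.
  by move=> a b /set1P->; rewrite inE => /sNc.
- rewrite suppt subUset sub1set cU; apply: subset_trans sJ _; exact: subsetIl.
- by rewrite big_split /= ss sumc1.
have -> : \sum_v t v * f v = \sum_v s v * f v + #|I| * f c.
  by rewrite -(sumc f) -big_split; apply: eq_bigr => v _; rewrite mulnDl.
have -> : lagrangian t = lagrangian s + 2 * (#|I| * #|J|).
  have cJ : \sum_v s v * g c v = #|J|.
    rewrite -ss; apply: eq_bigr => v _; case: (posnP (s v)) => [->//|/sNc->].
    by rewrite muln1.
  transitivity (\sum_u (s u * (\sum_v s v * g u v) + s u * (#|I| * g u c) +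
     #|I| * (u == c) * (\sum_v s v * g u v + #|I| * g u c))).
    apply: eq_bigr => u _; rewrite /t.
    rewrite (_ : \sum_v _ = (s u + #|I| * (u == c)) *
       (\sum_v s v * g u v + #|I| * g u c)); first by nlia.
    rewrite -(sumc (fun v => g u v : nat)) -big_split big_distrr; apply: eq_bigr => v _ /=; nlia.
  rewrite big_split big_split /= (sumc (fun u => \sum_v s v * g u v + #|I| * g u c)) cJ gI muln0 addn0.
  have -> : \sum_u s u * (#|I| * g u c) = #|I| * #|J|.
    rewrite -cJ big_distrr; apply: eq_bigr => v _ /=; rewrite gS; nlia.
  have -> : \sum_u s u * (\sum_v s v * g u v) = lagrangian s.
    by apply: eq_bigr => u _; rewrite big_distrr; apply: eq_bigr => v _ /=; nlia.
  nlia.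
have -> : \sum_(v in U) f v = \sum_(v in J) f v + \sum_(v in I) f v.
  by rewrite {1}eU -bigU //; apply: eq_bigl => v; rewrite !inE.
have hc : h c = f c + #|J| by rewrite /h edges1.
have hI : \sum_(v in I) h v <= #|I| * (f c + #|J|).
  rewrite -hc -sum_nat_const; apply: leq_sum => v vI; apply: cmax.
  by apply: (subsetP _ _ vI); apply: subsetDl.
have hI2 : \sum_(v in I) h v = \sum_(v in I) f v + (edges I J + edges I I).
  by rewrite /h big_split /= -edges_sum1 {1}eU edgesUr.
have eUU : edges U U = edges J J + 2 * edges I J + edges I I.
  rewrite {1 2}eU edgesUl // !edgesUr // (edges_sym gS J I); nlia.
move: sb hI; rewrite hI2 eUU; nlia.
Qed.

Lemma lagrangian_clique s : clique (supp s) ->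
  lagrangian s + \sum_v s v ^ 2 = (\sum_v s v) ^ 2.
Proof.
move=> /cliqueP cs; rewrite -mulnn big_distrl /= -big_split /=.
apply: eq_bigr => u _; rewrite big_distrr /=.
rewrite (bigD1 u) //= [RHS](bigD1 u) //= gI muln0 add0n addnC mulnn; congr (_ + _).
apply: eq_bigr => v ne.
have [->|u0] := posnP (s u); first by rewrite !mul0n.
have [->|v0] := posnP (s v); first by rewrite !muln0.
by rewrite cs ?muln1 // ?inE // eq_sym.
Qed.

End Zykov.

(** * Edge bounds by symmetrization *)
Section Bounds.
Variables (T : finType) (g : rel T).
Hypotheses (gS : symmetric g) (gI : irreflexive g).
Implicit Types (A B C K Q R S U : {set T}) (P : {set {set T}}) (u v w x y : T).
Local Notation edges := (edges g).
Local Notation clique := (clique g).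
Local Notation k4 := (k4 g).

(** Otherwise [B] and part of [D] form a K4. *)
Lemma joined_cliques_small B D : clique B -> clique D ->
  {in B & D, forall b d, g b d} -> #|B| < 4 ->
  (forall K, k4 K -> B \subset K -> K \subset B :|: D -> False) ->
  #|B| + #|D| <= 3.
Proof.
move=> cB cD j lB h; rewrite leqNgt; apply/negP => lt.
have [|D' sD cD'] := @subset_of_card _ D (4 - #|B|); first nlia.
apply: (h (B :|: D')).
- apply: k4U => //; first exact: cliqueS sD cD.
    by move=> b d bB /(subsetP sD); apply: j.
  by rewrite cD'; nlia.
- exact: subsetUl.
- exact: setUS.
Qed.

Lemma clique_le3 U C : (forall K, k4 K -> K \subset U -> False) ->
  clique C -> C \subset U -> #|C| <= 3.
Proof.
move=> h cC sC; have := @joined_cliques_small set0 C; rewrite cards0; apply=> //.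
- by apply/cliqueP => x y; rewrite inE.
- by move=> x y; rewrite inE.
- by move=> K kK _ s; apply: (h K kK); apply: subset_trans sC; rewrite set0U in s.
Qed.

Lemma sqr_sum_le (s : T -> nat) C :
  (\sum_(v in C) s v) ^ 2 <= #|C| * \sum_(v in C) s v ^ 2.
Proof.
have e : (\sum_(v in C) s v) ^ 2 = \sum_(u in C) \sum_(v in C) s u * s v.
  by rewrite -mulnn big_distrl; apply: eq_bigr => u _; rewrite big_distrr.
rewrite -(leq_pmul2l (isT : 0 < 2)) e big_distrr /=.
apply: (@leq_trans (\sum_(u in C) \sum_(v in C) (s u ^ 2 + s v ^ 2))).
  apply: leq_sum => u _; rewrite big_distrr; apply: leq_sum => v _ /=.
  exact: (nat_Cauchy (s u) (s v)).1.
rewrite (eq_bigr (fun u => #|C| * s u ^ 2 + \sum_(v in C) s v ^ 2)); last first.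
  by move=> u _; rewrite big_split /= sum_nat_const.
rewrite big_split /= sum_nat_const -big_distrr /=; nlia.
Qed.

Lemma sum_supp (s F : T -> nat) : (forall v, s v = 0 -> F v = 0) ->
  \sum_v F v = \sum_(v in supp s) F v.
Proof.
move=> h; rewrite (bigID (mem (supp s))) /= [X in _ + X]big1 ?addn0 // => v.
by rewrite inE -eqn0Ngt => /eqP/h.
Qed.

Lemma turan_k4_free U : (forall K, k4 K -> K \subset U -> False) ->
  3 * edges U U <= 2 * #|U| ^ 2.
Proof.
move=> h; have [s [cs sU ss sb]] := zykov gS gI (fun=> 0) U.
have q := lagrangian_clique gI cs; rewrite ss in q.
have c3 := clique_le3 h cs sU.
have := sqr_sum_le s (supp s).
rewrite -(sum_supp (s := s) (F := s)) // ss -(sum_supp (s := s)); last by move=> v ->.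
have e0 : \sum_v s v * 0 = 0 by rewrite big1 // => v; rewrite muln0.
rewrite big1 // e0 in sb; nia.
Qed.

(** Symmetrize [L] with weights the degrees into [W], obtaining a clique with
    class sizes [s]; then symmetrize [W] with weights [f u], the total size of the
    classes of [L] whose representative is adjacent to [u], obtaining class
    sizes [t].  Since no K4 meets [L], the clique supporting [t] has at most two
    vertices joined to a given representative in [L], and at most one joined to
    two of them.  So the sum of the [f u ^ 2] over that clique is at most
    [#|L| ^ 2 + sum s ^ 2], and [2 t f <= t ^ 2 + f ^ 2] finishes the count. *)
Lemma k4_avoiding_bound (L W : {set T}) : [disjoint L & W] ->
  (forall K, k4 K -> K \subset L :|: W -> [disjoint K & L]) ->
  edges (L :|: W) (L :|: W) <= #|W| ^ 2 + 2 * #|L| ^ 2.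
Proof.
move=> dLW hK.
have [s [cs sL ss sb]] := zykov gS gI (fun v => edges [set v] W) L.
pose f u := \sum_v s v * g v u.
have [t [ct tW tt tb]] := zykov gS gI f W.
have qs := lagrangian_clique gI cs; have qt := lagrangian_clique gI ct; rewrite ss in qs; rewrite tt in qt.
have ef : \sum_(u in W) f u = \sum_v s v * edges [set v] W.
  rewrite exchange_big; apply: eq_bigr => v _ /=.
  by rewrite /edges big_set1 big_distrr.
have eU : edges (L :|: W) (L :|: W) = edges L L + 2 * edges L W + edges W W.
  rewrite edgesUl // !edgesUr // (edges_sym gS W L); nlia.
have key : \sum_(u in supp t) f u ^ 2 <= #|L| ^ 2 + \sum_v s v ^ 2.
  have -> : #|L| ^ 2 + \sum_v s v ^ 2 =
      \sum_v \sum_v' s v * s v' * (1 + (v == v')).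
    rewrite -ss -mulnn big_distrl -big_split /=; apply: eq_bigr => v _.
    rewrite big_distrr (bigD1 v) //= [RHS](bigD1 v) //= eqxx.
    rewrite (eq_bigr (fun v' => s v * s v' * (1 + (v == v')))); first by lia.
    by move=> v' /negPf; rewrite eq_sym => ->; rewrite muln1.
  have -> : \sum_(u in supp t) f u ^ 2 =
      \sum_v \sum_v' s v * s v' * \sum_(u in supp t) g v u * g v' u.
    transitivity (\sum_(u in supp t) \sum_v \sum_v' s v * s v' * (g v u * g v' u)).
      apply: eq_bigr => u _; rewrite -mulnn big_distrl; apply: eq_bigr => v _ /=.
      rewrite big_distrr; apply: eq_bigr => v' _ /=; nlia.
    rewrite exchange_big; apply: eq_bigr => v _; rewrite exchange_big.
    by apply: eq_bigr => v' _; rewrite big_distrr.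
  apply: leq_sum => v _; apply: leq_sum => v' _.
  have [->|v0] := posnP (s v); first by [].
  have [->|v0'] := posnP (s v'); first by rewrite muln0.
  rewrite leq_mul2l; apply/orP; right.
  have vL : v \in L by apply: (subsetP sL); rewrite inE.
  have vL' : v' \in L by apply: (subsetP sL); rewrite inE.
  pose B := [set v; v'].
  pose D := [set u in supp t | g v u && g v' u].
  have -> : \sum_(u in supp t) g v u * g v' u = #|D|.
    rewrite -sum1_card big_mkcond [RHS]big_mkcond; apply: eq_bigr => u _.
    by rewrite !inE; case: (0 < t u); case: (g v u); case: (g v' u).
  have cB : clique B.
    by apply: (cliqueS _ cs); rewrite subUset !sub1set !inE v0.
  have sDW : D \subset W.
    by apply: subset_trans tW; apply/subsetP => u; rewrite !inE => /andP[].
  have cD : clique D.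
    by apply: (cliqueS _ ct); apply/subsetP => u; rewrite !inE => /andP[].
  have c2 : #|B| + (v == v') = 2 by rewrite cards2; case: (v == v').
  suff : #|B| + #|D| <= 3 by nlia.
  apply: (joined_cliques_small cB cD); last 2 first.
  - by nlia.
  - move=> K kK sB sK; have : [disjoint K & L].
      apply: hK kK _; apply: subset_trans sK _; apply: setUSS => //.
      by rewrite subUset !sub1set vL.
    have vK : v \in K by apply: (subsetP sB); apply: set21.
    by move/disjointFr/(_ vK); rewrite vL.
  - move=> b d; rewrite !inE => /orP[]/eqP-> /andP[_ /andP[]] //.
have tf : 2 * \sum_v t v * f v <= \sum_v t v ^ 2 + \sum_(u in supp t) f u ^ 2.
  rewrite (sum_supp (s := t) (F := fun v => t v * f v)); last by move=> v ->.
  rewrite (sum_supp (s := t) (F := fun v => t v ^ 2)); last by move=> v ->.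
  rewrite -big_split big_distrr; apply: leq_sum => v _ /=.
  exact: (nat_Cauchy (t v) (f v)).1.
have e2 : \sum_(v in L) edges [set v] W = edges L W by rewrite -edges_sum1.
rewrite e2 in sb; rewrite eU; nlia.
Qed.

End Bounds.

(** * Small rest *)
Section SmallRest.
Variables (T : finType) (g : rel T).
Hypotheses (gS : symmetric g) (gI : irreflexive g).
Implicit Types (A B C K Q R S U : {set T}) (P : {set {set T}}) (u v w x y : T).
Local Notation edges := (edges g).
Local Notation nonedges := (nonedges g).
Local Notation clique := (clique g).
Local Notation k4 := (k4 g).
Local Notation packing := (packing g).
Local Notation nu := (nu g).

Lemma nu_k4 U : 0 < nu U -> exists2 K, k4 K & K \subset U.
Proof.
move=> /nu_packing[P [pP c1]].
have /card_gt0P[K KP] : 0 < #|P| by rewrite c1.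
by exists K; [exact: tile_k4 pP _ KP|exact: tileU pP _ KP].
Qed.

Lemma tiling_avoiding U S k : nu U = k -> k <= nu (U :\: S) -> S \subset U ->
  exists P, [/\ packing U P, #|P| = k & S \subset rest U P].
Proof.
move=> nuk le sS; have [P [pP cP]] := nu_packing le.
exists P; split=> //; first exact: packing_subU (subsetDl _ _) pP.
rewrite /rest subsetD sS /=.
have := kfam_cover pP; rewrite subsetD => /andP[_].
by rewrite disjoint_sym.
Qed.

(** Let [w] have the most non-neighbours among the vertices of K4's, let [w + S]
    be a K4, and tile while avoiding the triangle [S].  Each tile misses at
    least two pairs with [S] and a further vertex [w'] of the rest, and every
    vertex of the rest misses a vertex of [S]; so [w'] has more non-neighbours
    than [w], hence lies in no K4.  It remains to apply [k4_avoiding_bound]. *)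
Lemma small_rest_bound U k m : 0 < k -> #|U| = 4 * k + m -> nu U = k ->
  (forall K, k4 K -> K \subset U -> nonedges K U <= 2 * k + m) ->
  (forall S, S \subset U -> #|S| = 3 -> k <= nu (U :\: S)) ->
  edges U U <= (4 * k + 3) ^ 2 + 2 * m ^ 2.
Proof.
move=> k0 cU nuk h1 h2.
pose inK w := [exists K : {set T}, [&& k4 K, K \subset U & w \in K]].
have [K0 kK0 sK0] : exists2 K, k4 K & K \subset U by apply: nu_k4; rewrite nuk.
have /card_gt0P[w0 w0K] : 0 < #|K0| by rewrite (k4_card kK0).
have w0in : inK w0 by apply/existsP; exists K0; rewrite kK0 sK0.
case: (@arg_maxnP _ w0 inK (fun w => nonedges [set w] U) w0in) => w.
move=> /existsP[K /and3P[kK sK wK]] wmax.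
pose S := K :\ w.
have cS : #|S| = 3 by have := cardsD1 w K; rewrite wK (k4_card kK) -/S; nlia.
have sS : S \subset U by apply: subset_trans sK; apply: subsetDl.
have qS : clique S by apply: cliqueS (k4_clique kK); apply: subsetDl.
have [P [pP cP sR]] := tiling_avoiding nuk (h2 S sS cS) sS.
have mP : nu U <= #|P| by rewrite nuk cP.
set R := rest U P in sR.
have cR : #|R| = m by have := card_rest pP; rewrite -/R; nlia.
have dwS : [disjoint [set w] & S] by rewrite disjoints1 !inE eqxx.
have xK : nonedges K U = nonedges [set w] U + nonedges S U by rewrite -nonedgesUl // setD1K.
clearbody S.
have free w' : w' \in R :\: S -> ~~ inK w'.
  rewrite inE => /andP[nS wR]; apply/negP => /wmax /= hle.
  have dS : [disjoint S & [set w']] by rewrite disjoint_sym disjoints1.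
  have xS := nonedges_split gS pP S; have xw := nonedges_split gS pP [set w'].
  have rS := nonedges_rest_clique gS gI pP mP qS sR cS; rewrite -/R in rS xS xw.
  have rw : 1 <= nonedges [set w'] R.
    by rewrite -(cards1 w'); apply: leq_trans (nonedges_self gI _) _; rewrite nonedgesSr // sub1set.
  have := @sum_ge_const _ P (fun Q => nonedges S Q + nonedges [set w'] Q) 2; rewrite cP big_split /= => H.
  have : 2 * k <= \sum_(i in P) nonedges S i + \sum_(i in P) nonedges [set w'] i.
    apply: H => Q QP; apply: (split_bound gS gI pP mP QP qS) => //.
    - exact: clique1.
    - by rewrite sub1set.
    - by rewrite cS cards1.
    - by rewrite cS.
    - by rewrite cards1.
  have := h1 K kK sK; nlia.
have eU : U = (R :\: S) :|: (S :|: cover P).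
  apply/setP => x; rewrite /R /rest !inE.
  case xS: (x \in S) => /=; first by rewrite (subsetP sS).
  case xC: (x \in cover P); rewrite /= ?orbF //.
  by rewrite (subsetP (kfam_cover pP)).
have cW : #|S :|: cover P| = 4 * k + 3.
  rewrite cardsU (kfam_card pP) cP cS.
  have : [disjoint S & cover P] by apply: disjointWl (rest_cover U P).
  rewrite -setI_eq0 => /eqP->; rewrite cards0; nlia.
have cL : #|R :\: S| <= m by rewrite -cR subset_leq_card // subsetDl.
rewrite {1 2}eU; apply: leq_trans (k4_avoiding_bound gS gI _ _) _.
- rewrite -setI_eq0; apply/eqP/setP => x; rewrite !inE.
  by case: (x \in S); case: (x \in cover P); rewrite ?andbF.
- move=> K1 kK1; rewrite -eU => sK1; rewrite disjoint_sym.
  rewrite -setI_eq0; apply/eqP/setP => x; rewrite in_setI in_set0.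
  apply/negP => /andP[/free /negP h xK1]; apply: h.
  by apply/existsP; exists K1; rewrite kK1 sK1.
by rewrite cW leq_add2l leq_mul2l leq_exp2r.
Qed.

End SmallRest.

(** * Large rest *)
Section LargeRest.
Variables (T : finType) (g : rel T).
Hypotheses (gS : symmetric g) (gI : irreflexive g).
Implicit Types (A B C D K Q R S U f : {set T}) (P M F : {set {set T}}) (u v w x y : T).
Local Notation edges := (edges g).
Local Notation nonedges := (nonedges g).
Local Notation clique := (clique g).
Local Notation k4 := (k4 g).
Local Notation packing := (packing g).
Local Notation kfam := (kfam g).
Local Notation nu := (nu g).
Local Notation common_nbrs := (common_nbrs g).

Section Fixed.
Variables (U : {set T}) (k m : nat).
Hypotheses (cU : #|U| = 4 * k + m) (nuU : nu U = k).
Hypothesis few_nonnbrs : forall v, v \in U -> 2 * nonedges [set v] U + 16 <= 2 * k + m.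
Hypothesis few_nonnbrs3 : forall v, v \in U -> 3 * nonedges [set v] U < 4 * k + m.
Hypothesis degK : forall K, k4 K -> K \subset U -> nonedges K U < 3 * k + m.
Hypotheses (kgt0 : 0 < k) (km : k <= m) (mge : 100 <= m).

Definition tiling P := packing U P && (#|P| == k).

Lemma tilingP P : reflect (packing U P /\ #|P| = k) (tiling P).
Proof. by apply: (iffP andP) => [[? /eqP]|[? /eqP]]. Qed.

Lemma tiling_rest P : tiling P -> #|rest U P| = m.
Proof. by case/tilingP=> pP cP; have := card_rest pP; nlia. Qed.

(** At least two vertices of the tile are joined to [T1].  A vertex joined to [T2],
    together with one of these, would give two disjoint K4's. *)
Lemma tile_two_triangles P Q (T1 T2 : {set T}) : tiling P -> Q \in P ->
  #|T1| = 3 -> #|T2| = 3 -> clique T1 -> clique T2 ->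
  T1 \subset rest U P -> T2 \subset rest U P -> [disjoint T1 & T2] ->
  nonedges T1 Q <= 2 -> 4 <= nonedges T2 Q.
Proof.
move=> /tilingP[pP cP] QP c1 c2 q1 q2 s1 s2 d12 l1; rewrite leqNgt; apply/negP => l2.
have cQ := k4_card (tile_k4 pP QP).
have h1 := card_common_nbrs gS T1 Q; have h2 := card_common_nbrs gS T2 Q.
have /card_gt0P[b bT2] : 0 < #|common_nbrs T2 Q| by nlia.
have /card_gt0P[a] : 0 < #|common_nbrs T1 Q :\ b|.
  by have := cardsD1 b (common_nbrs T1 Q); case: (b \in _) => /=; nlia.
rewrite !inE => /andP[nab aT1].
apply: (@no_gain _ _ gS gI U P pP _ Q T1 T2 [set a] [set b]) => //.
- by rewrite nuU cP.
- by rewrite sub1set inE.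
- by rewrite sub1set.
- by rewrite disjoints1 inE.
- by rewrite c1 cards1.
- by rewrite c2 cards1.
Qed.

(** A triangle of the rest lies in a K4, for otherwise it would miss a pair with
    every tile vertex.  Four disjoint triangles miss at least 12 pairs with
    every tile by [tile_two_triangles]; this contradicts the bound on the
    non-neighbours of a K4. *)
Lemma triangles_le3 P M : tiling P -> kfam 3 (rest U P) M -> #|M| <= 3.
Proof.
move=> tP; have [pP cP] := tilingP _ tP.
move=> fM0; rewrite leqNgt; apply/negP => lt.
have [M' sM' cM'] := subset_of_card lt.
have {fM0 M lt sM'} := kfamS sM' fM0; move: M' cM' => M cM fM.
have [h /trivIsetP t] := kfamP _ _ _ _ fM.
have cR := tiling_rest tP.
have mP : nu U <= #|P| by rewrite nuU cP.
have small S : S \in M -> \sum_(Q in P) nonedges S Q < 3 * k.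
  move=> SM; have [cS qS sS] := h S SM.
  have sSU : S \subset U by apply: subset_trans sS (rest_sub _ _).
  have xS := nonedges_split gS pP S.
  have rS := nonedges_rest_clique gS gI pP mP qS sS cS; rewrite cR in rS.
  have [e0|/set0Pn[y /(common_nbrsP gS)[yU hy]]] := eqVneq (common_nbrs S U) set0.
    have hQ Q : Q \in P -> 4 <= nonedges S Q.
      move=> QP; have cQ := k4_card (tile_k4 pP QP).
      have := card_common_nbrs gS S Q; rewrite (_ : common_nbrs S Q = set0) ?cards0 ?cQ //.
      apply/eqP; rewrite -subset0 -e0; apply/subsetP => q /(common_nbrsP gS)[qQ hq].
      by apply/(common_nbrsP gS); split=> //; apply: (subsetP (tileU pP QP)).
    have := sum_ge_const hQ; rewrite cP => H.
    have : 3 * nonedges S U < 3 * (4 * k + m).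
      rewrite nonedges_sum1 big_distrr /= -{2}cS -sum_nat_const.
      have [v vS] : exists v, v \in S by apply/card_gt0P; rewrite cS.
      rewrite (bigD1 v) //= [X in _ < X](bigD1 v) //= -addSn leq_add //.
        by apply: few_nonnbrs3; apply: (subsetP sSU).
      apply: leq_sum => i /andP[iS _]; apply/ltnW/few_nonnbrs3.
      exact: (subsetP sSU).
    nlia.
  have kK : k4 (S :|: [set y]).
    apply: k4U => //; first exact: clique1.
      by move=> a b aS /set1P->; apply: hy.
    by rewrite cS cards1.
  have sK : S :|: [set y] \subset U by rewrite subUset sSU sub1set.
  have := degK kK sK; have := nonedgesSl gS U (subsetUl S [set y]); nlia.
have up : \sum_(S in M) \sum_(Q in P) nonedges S Q < 12 * k.
  apply: (@leq_trans (\sum_(S in M) (3 * k))); last first.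
    by rewrite sum_nat_const cM; nlia.
  have [S0 S0M] : exists S, S \in M by apply/card_gt0P; rewrite cM.
  rewrite (bigD1 S0) //= [X in _ < X](bigD1 S0) //= -addSn leq_add ?small //.
  by apply: leq_sum => i /andP[iS _]; apply/ltnW/small.
have : 12 * k <= \sum_(S in M) \sum_(Q in P) nonedges S Q; last by nlia.
rewrite exchange_big -cP; apply: sum_ge_const => Q QP.
have [/exists_inP[S SM l2]|] := boolP [exists S in M, nonedges S Q <= 2].
  rewrite (big_setD1 S) //=; apply: leq_trans (leq_addl _ _).
  have -> : 12 = 4 * #|M :\ S| by have := cardsD1 S M; rewrite SM cM; nlia.
  apply: sum_ge_const => S' /setD1P[ne S'M].
  have [cS qS sS] := h S SM; have [cS' qS' sS'] := h S' S'M.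
  by apply: (tile_two_triangles tP QP cS) => //; apply: t => //; rewrite eq_sym.
rewrite negb_exists_in => /forall_inP H.
have -> : 12 = 3 * #|M| by rewrite cM.
by apply: sum_ge_const => S SM; rewrite ltnNge; exact: H.
Qed.

(** A tile [Q] is useful if some vertex [w] of an edge [h] is joined to all of
    [Q], and another edge [f] has two common neighbours in [Q]: these two and
    [f] form a new tile, and the other two vertices of [Q] form a triangle
    with [w].  A tile that is not useful misses on average at least two pairs
    with each edge. *)
Lemma find_production P Q F : tiling P -> Q \in P -> kfam 2 (rest U P) F ->
  3 <= #|F| -> \sum_(f in F) nonedges f Q < 2 * #|F| ->
  exists f h w, [/\ f \in F, h \in F, f != h, w \in h &
    nonedges [set w] Q = 0 /\ 2 <= #|common_nbrs f Q|].
Proof.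
move=> /tilingP[pP cP] QP /kfamP[hF tF] c3 lt.
have cQ := k4_card (tile_k4 pP QP).
have [h hh l1] := sum_lt_exists lt.
have [ch qh sh] := hF h hh.
have [w wh w0] : exists2 w, w \in h & nonedges [set w] Q < 1.
  by apply: sum_lt_exists; rewrite -nonedges_sum1 ch mul1n.
have [f /setD1P[nf ff] c2] : exists2 f, f \in F :\ h & nonedges f Q < 3.
  apply: sum_lt_exists; move: lt; rewrite (big_setD1 h) //=.
  by have := cardsD1 h F; rewrite hh; nlia.
have c2' : 2 <= #|common_nbrs f Q| by have := card_common_nbrs gS f Q; nlia.
have w0' : nonedges [set w] Q = 0 by nlia.
by exists f, h, w.
Qed.

(** The situation after [j] exchanges starting from the tiling [P0] and the
    matching [F0]: [j] disjoint triangles in the rest, and the matching edges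
    and original tiles not yet used up.  An exchange uses two edges and needs
    three to choose from, whence 9 = 3 + 3 * 2 edges for four exchanges. *)
Definition production_state (P0 F0 : {set {set T}}) j := exists P M F,
  [/\ tiling P, kfam 3 (rest U P) M, #|M| = j, kfam 2 (rest U P) F &
   [/\ F \subset F0, [disjoint cover F & cover M], 9 <= #|F| + 2 * j
     & k <= #|P0 :&: P| + j]].

Lemma production_step P0 F0 j : tiling P0 ->
  (forall f, f \in F0 -> \sum_(Q in P0) nonedges f Q + 7 <= 2 * k) ->
  j <= 3 -> production_state P0 F0 j -> production_state P0 F0 j.+1.
Proof.
move=> tP0 hF0 j3 [P [M [F [tP fM cM fF [sF dFM cF cP0]]]]].
have [pP cP] := tilingP _ tP.
have [hF tF] := kfamP _ _ _ _ fF.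
have c3 : 3 <= #|F| by nlia.
have [Q /setIP[QP0 QP] lQ] :
    exists2 Q, Q \in P0 :&: P & \sum_(f in F) nonedges f Q < 2 * #|F|.
  apply: sum_lt_exists; rewrite exchange_big /=.
  have : \sum_(f in F) (\sum_(Q in P0 :&: P) nonedges f Q + 7) <= \sum_(f in F) (2 * k).
    apply: leq_sum => f fF'; apply: leq_trans (hF0 f (subsetP sF _ fF')).
    rewrite leq_add2r [X in _ <= X](big_setID P) /=; exact: leq_addr.
  rewrite big_split /= !sum_nat_const.
  move: (\sum_(f in F) _) (#|F|) (#|P0 :&: P|) c3 cP0 => a b c; nia.
have [f [h [w [fF' hF' nfh wh [w0 c2]]]]] := find_production tP QP fF c3 lQ.
have [cf qf sf] := hF f fF'; have [ch qh sh] := hF h hF'.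
have cQ := k4_card (tile_k4 pP QP); have qQ := k4_clique (tile_k4 pP QP).
have [A sA cA] := subset_of_card c2.
have sAQ : A \subset Q by apply: subset_trans sA (common_nbrs_sub _ _ _).
set R := rest U P in fM fF sf sh hF.
have dRQ x : x \in R -> x \notin Q by apply: disjoint_notin; apply: rest_tile QP.
have dfh : [disjoint f & h] by move/trivIsetP: tF; apply.
have wR : w \in R by apply: (subsetP sh).
have wf : w \notin f by rewrite (disjointFl dfh).
have kK : k4 (f :|: A).
  apply: k4U => //; first exact: cliqueS sAQ qQ.
    by move=> x y xf /(subsetP sA)/(common_nbrsP gS)[_]; apply.
  by rewrite cf cA.
have sK : f :|: A \subset Q :|: R.
  by rewrite subUset (subset_trans sf) ?subsetUr // (subset_trans sAQ) ?subsetUl.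
have [pP'' cP'' rP''] := swap_tile pP QP kK sK.
set P'' := f :|: A |: P :\ Q in pP'' cP'' rP''.
pose S := (Q :\: A) :|: [set w].
rewrite -/R in rP''; clearbody R.
have cover2 x : x \in cover (F :\ f :\ h) -> [/\ x \in cover F, x \notin f & x \notin h].
  rewrite coverD1; last by rewrite !inE eq_sym nfh.
    rewrite coverD1 // !inE => /andP[-> /andP[-> ->]] //.
  by apply: trivIsetS tF; apply: subsetDl.
have FR := subsetP (kfam_cover fF); have MR := subsetP (kfam_cover fM).
have fcov x : x \in f -> x \in cover F by move=> xf; apply/bigcupP; exists f.
have wcov : w \in cover F by apply/bigcupP; exists h.
have qS : clique S.
  apply: cliqueU => //; [by apply: cliqueS qQ; apply: subsetDl|exact: clique1|].
  move=> a b; rewrite in_setD => /andP[_ aQ] /set1P->.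
  by move/eqP/(nonedges0P g): w0 => /(_ w a); rewrite gS; apply; rewrite ?inE.
have cS : #|S| = 3.
  rewrite /S setUC cardsU1 !inE (negPf (dRQ w wR)) andbF cardsD cQ.
  by rewrite (setIidPr sAQ) cA.
have sS : S \subset rest U P''.
  rewrite rP''; apply/subsetP => x; rewrite !inE negb_or.
  case/orP => [/andP[-> xQ]|/eqP->]; last first.
    by rewrite wf wR orbT andbT; apply: contra (dRQ w wR); apply: (subsetP sAQ).
  by rewrite xQ !andbT; apply: contraL xQ => /(subsetP sf)/dRQ.
have fM'' : kfam 3 (rest U P'') M.
  apply: kfam_in fM; rewrite rP''; apply/subsetP => x xM.
  rewrite !inE negb_or (MR x xM) orbT andbT; apply/andP; split.
    by apply/negP => /fcov/(disjoint_notin dFM); rewrite xM.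
  by apply: contra (dRQ x (MR x xM)); apply: (subsetP sAQ).
have dSM : [disjoint S & cover M].
  apply: disjointI => x; rewrite !inE => /orP[/andP[_ xQ]|/eqP->].
    by apply/negP => /MR/dRQ; rewrite xQ.
  exact: disjoint_notin dFM wcov.
have [fMS cMS] := kfamU1 (isT : 0 < 3) fM'' cS qS sS dSM.
exists P'', (S |: M), (F :\ f :\ h); split=> //; first by apply/tilingP; rewrite cP''.
- by rewrite cMS cM.
- apply: kfam_in; last first.
    by apply: kfamS fF; apply: subset_trans (subsetDl _ _) (subsetDl _ _).
  rewrite rP''; apply/subsetP => x /cover2[xF xf _].
  rewrite !inE negb_or xf (FR x xF) orbT andbT /=.
  by apply: contra (dRQ x (FR x xF)); apply: (subsetP sAQ).
split.
- by apply: subset_trans sF; apply: subset_trans (subsetDl _ _) (subsetDl _ _).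
- apply: disjointI => x /cover2[xF xf xh].
  have nSM : S \notin M.
    apply/negP => SM; have := disjoint_notin dFM wcov.
    by rewrite (_ : w \in cover M = true) //; apply/bigcupP; exists S; rewrite // !inE eqxx orbT.
  rewrite /cover big_setU1 //= -/(cover M) !inE !negb_or.
  rewrite (disjoint_notin dFM xF) andbT (negPf (dRQ x (FR x xF))) andbF /=.
  by apply: contra xh => /eqP->.
- have := cardsD1 h (F :\ f); have := cardsD1 f F.
  rewrite fF' !inE hF' eq_sym nfh /=; nlia.
- have : #|(P0 :&: P) :\ Q| <= #|P0 :&: P''|.
    apply: subset_leq_card; apply/subsetP => B; rewrite !inE.
    by move=> /andP[-> /andP[-> ->]]; rewrite orbT.
  have := cardsD1 Q (P0 :&: P); rewrite !inE QP0 QP; nlia.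
Qed.

(** Choose a tiling and a matching of its rest, as large as possible.  Two
    unmatched vertices [x], [y] cannot both be joined to a tile: exchanging [x]
    with a vertex [q] of the tile would make [q]-[y] an extra matching edge.
    Unmatched vertices are also pairwise nonadjacent.  If there were many of
    them, one would have too many non-neighbours.  The number 18 leaves 9 edges after
    those that meet three given triangles are discarded. *)
Lemma matching_exists : exists P M,
  [/\ tiling P, kfam 2 (rest U P) M & 18 <= #|M|].
Proof.
have [P0 [pP0 cP0]] : exists P, packing U P /\ #|P| = k by apply: nu_packing; rewrite nuU.
pose ok (p : {set {set T}} * {set {set T}}) := tiling p.1 && kfam 2 (rest U p.1) p.2.
have ok0 : ok (P0, set0) by apply/andP; split; [apply/tilingP|exact: kfam0].
(* tiling and matching are chosen together, since an exchange changes both *)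
case: (@arg_maxnP _ (P0, set0) ok (fun p => #|p.2|) ok0) => -[P M] /= /andP[/= tP fM] mx.
exists P, M; split=> //; rewrite leqNgt; apply/negP => l18.
have big P' M' : tiling P' -> kfam 2 (rest U P') M' -> #|M'| <= #|M|.
  by move=> tP' fM'; have := mx (P', M'); apply; apply/andP.
have [pP cP] := tilingP _ tP; have cR := tiling_rest tP.
set R := rest U P in fM cR; pose D := R :\: cover M.
have cM := kfam_card fM.
(* a matching of at most 17 edges covers at most 34 vertices *)
have cD : m <= #|D| + 34.
  have := cardsID (cover M) R; rewrite -/D => E.
  have := subset_leq_card (subsetIr R (cover M)); nlia.
have DR x : x \in D -> x \in R by rewrite in_setD => /andP[].
have DM x : x \in D -> x \notin cover M by rewrite in_setD => /andP[].
have edge_clique x y : g x y -> clique [set x; y].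
  move=> gxy; apply: cliqueU; [by []|exact: clique1|exact: clique1|].
  by move=> a b /set1P-> /set1P->.
have indep x y : x \in D -> y \in D -> ~~ g x y.
  move=> xD yD; apply/negP => gxy.
  have ne : x != y by apply: contraTneq gxy => ->; rewrite gI.
  have [|||fM' cM'] := kfamU1 (isT : 0 < 2) fM _ (edge_clique x y gxy).
  - by rewrite cards2 ne.
  - by rewrite subUset !sub1set !DR.
  - by apply: disjointI => z; rewrite !inE => /orP[]/eqP->; apply: DM.
  by have := big P _ tP fM'; rewrite cM'; nlia.
have ndDD : nonedges D D = #|D| ^ 2.
  have e0 : edges D D = 0.
    by apply: big1 => x xD; apply: big1 => y yD; rewrite (negPf (indep x y xD yD)).
  by have := edges_nonedges g D D; rewrite e0 mulnn.
have full1 Q x y : Q \in P -> x \in D -> y \in D -> x != y ->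
    nonedges [set x] Q = 0 -> nonedges [set y] Q = 0 -> False.
  move=> QP xD yD nxy /eqP/nonedges0P x0 /eqP/nonedges0P y0.
  have cQ := k4_card (tile_k4 pP QP); have qQ := k4_clique (tile_k4 pP QP).
  have /card_gt0P[q qQ'] : 0 < #|Q| by rewrite cQ.
  have nQ z : z \in R -> z \notin Q by apply: disjoint_notin; apply: rest_tile QP.
  have kK : k4 ([set x] :|: Q :\ q).
    apply: k4U => //; first exact: clique1.
    - by apply: cliqueS qQ; apply: subsetDl.
    - by move=> a b aS /setD1P[_ bQ]; apply: x0.
    - by rewrite cards1; have := cardsD1 q Q; rewrite qQ'; nlia.
  have sK : [set x] :|: Q :\ q \subset Q :|: R.
    rewrite subUset sub1set inE DR // orbT /=.
    by apply: subset_trans (subsetDl _ _) (subsetUl _ _).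
  have [pP' cP' rP'] := swap_tile pP QP kK sK.
  set P' := _ |: _ in pP' cP' rP'; rewrite -/R in rP'; clearbody P'.
  have tP' : tiling P' by apply/tilingP; rewrite cP'.
  have xR := DR x xD; have yR := DR y yD.
  have MR := subsetP (kfam_cover fM); clearbody R.
  have fM1 : kfam 2 (rest U P') M.
    apply: kfam_in fM; apply/subsetP => z zM; rewrite rP' !inE (MR z zM) orbT andbT.
    rewrite negb_or negb_and negbK (nQ z (MR z zM)) orbT andbT.
    by apply: contraTneq zM => ->; apply: DM.
  have gqy : g q y by rewrite gS; apply: y0; rewrite ?inE.
  have [|||fM' cM'] := kfamU1 (isT : 0 < 2) fM1 _ (edge_clique q y gqy).
  - by rewrite cards2; case: eqVneq qQ' => // ->; rewrite (negPf (nQ y yR)).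
  - rewrite subUset !sub1set rP' !inE eqxx qQ' yR (negPf (nQ y yR)) !andbF !orbF orbT andbT /=.
    rewrite [y == x]eq_sym nxy !andbT; apply: contraTneq qQ' => ->; exact: nQ.
  - apply: disjointI => z; rewrite !inE => /orP[]/eqP->; last exact: DM.
    by apply/negP => /MR/nQ; rewrite qQ'.
  by have := big P' _ tP' fM'; rewrite cM'; nlia.
have lowQ Q : Q \in P -> #|D|.-1 <= nonedges D Q.
  move=> QP; rewrite nonedges_sum1.
  have [/exists_inP[x xD x0]|] := boolP [exists x in D, nonedges [set x] Q == 0].
    rewrite (big_setD1 x) //=; apply: leq_trans (leq_addl _ _).
    have -> : #|D|.-1 = #|D :\ x| by have := cardsD1 x D; rewrite xD; nlia.
    rewrite -sum1_card; apply: leq_sum => y /setD1P[nyx yD].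
    rewrite lt0n; apply/negP => /eqP y0.
    by apply: (full1 Q y x QP) => //; apply/eqP.
  rewrite negb_exists_in => /forall_inP H; apply: leq_trans (leq_pred _) _.
  by rewrite -sum1_card; apply: leq_sum => y /H; rewrite lt0n.
have sDR : D \subset R by apply: subsetDl.
have up : 2 * nonedges D U + 16 * #|D| <= (2 * k + m) * #|D|.
  rewrite nonedges_sum1 big_distrr /= [16 * _]mulnC [X in _ <= X]mulnC -!sum_nat_const.
  rewrite -big_split /=; apply: leq_sum => v vD; apply: few_nonnbrs.
  by apply: (subsetP (subset_trans sDR (rest_sub _ _))).
have low := sum_ge_const lowQ; rewrite cP in low.
have := nonedges_split gS pP D; rewrite -/R => E.
have := nonedgesSr g D sDR; rewrite ndDD.
move: E up low cD => ->.
move: (\sum_(Q in P) nonedges D Q) (nonedges D R) (#|D|) => a b d.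
case: d => [|d] /=; first by nlia.
move=> h1 h2 h3 h4; move: kgt0 km mge; nia.
Qed.

(** Edges of the matching that avoid a maximal family of triangles have few
    common neighbours in the rest, hence many non-neighbours there and fewer
    than two per tile on average; four exchanges produce four triangles. *)
Lemma large_rest_absurd : False.
Proof.
have [P [M [tP fM c18]]] := matching_exists.
have [pP cP] := tilingP _ tP; have cR := tiling_rest tP.
case: (@arg_maxnP _ set0 (fun M => kfam 3 (rest U P) M) (fun M => #|M|) (kfam0 g _ _)).
move=> N /= fN mx.
have c3 := triangles_le3 tP fN.
set R := rest U P in fM fN mx cR.
pose H := cover N; have cH : #|H| <= 9 by rewrite (kfam_card fN); nlia.
pose F := [set f in M | [disjoint f & H]].
have sF : F \subset M by apply/subsetP => f; rewrite inE => /andP[].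
have [hM tM] := kfamP _ _ _ _ fM.
have c9 : 9 <= #|F|.
  suff : #|M :\: F| <= 9.
    have := cardsID F M; have := subset_leq_card (subsetIr M F); nlia.
  apply: leq_trans cH.
  apply: leq_trans (sum_meet_trivIset H (trivIsetS (subsetDl M F) tM)).
  rewrite -sum1_card; apply: leq_sum => f; rewrite !inE => /andP[nf ff].
  by move: nf; rewrite ff /= -setI_eq0 -card_gt0.
have dF f : f \in F -> \sum_(Q in P) nonedges f Q + 7 <= 2 * k.
  move=> fF; have [cf qf sf] := hM f (subsetP sF _ fF).
  have dfH : [disjoint f & H] by move: fF; rewrite inE => /andP[].
  have sfU : f \subset U by apply: subset_trans sf (rest_sub _ _).
  have xf : 2 * nonedges f U + 16 * 2 <= (2 * k + m) * 2.
    have : \sum_(v in f) (2 * nonedges [set v] U + 16) <= \sum_(v in f) (2 * k + m).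
      by apply: leq_sum => v vf; apply: few_nonnbrs; apply: (subsetP sfU).
    by rewrite big_split -big_distrr /= !sum_nat_const cf -nonedges_sum1; nlia.
  have rf : m <= nonedges f R + 9.
    rewrite -cR; apply: leq_trans (card_common_nbrs gS f R) _; rewrite addnC leq_add2l.
    apply: leq_trans cH; apply: subset_leq_card; apply/subsetP => x /(common_nbrsP gS)[xR hx].
    apply/negPn/negP => xH.
    have dxf : [disjoint [set x] & f].
      by rewrite disjoints1; apply/negP => /hx; rewrite gI.
    have [||||fN' cN'] := @kfamU1 T g 3 R N (f :|: [set x]) isT fN.
    - rewrite setUC cardsU1 cf; move: dxf; rewrite disjoints1 => ->; by [].
    - apply: cliqueU => //; first exact: clique1.
      by move=> a b aS /set1P->; apply: hx.
    - by rewrite subUset sf sub1set.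
    - apply: disjointI => z /setUP[|/set1P-> //]; exact: disjoint_notin dfH.
    by have := mx _ fN'; rewrite /= cN'; nlia.
  by have := nonedges_split gS pP f; rewrite -/R; nlia.
have st0 : production_state P F 0.
  exists P, set0, F; split=> //; first exact: kfam0; first by rewrite cards0.
    exact: kfamS sF fM.
  split=> //; last by rewrite setIid cP addn0.
    by rewrite /cover big_set0 -setI_eq0 setI0.
  by rewrite muln0 addn0.
have [P4 [M4 [F4 [tP4 fM4 cM4 _ _]]]] : production_state P F 4.
  by do 4 (apply: (production_step tP dF); first by []).
by have := triangles_le3 tP4 fM4; rewrite cM4.
Qed.

End Fixed.
End LargeRest.

(** * Middle range: the rest spans no useful edge *)
Section MiddleStructure.
Variables (T : finType) (g : rel T).
Hypotheses (gS : symmetric g) (gI : irreflexive g).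
Implicit Types (A B C D K Q R S f : {set T}) (P M F : {set {set T}}) (u v w x y z : T).
Local Notation nbr := (nbr g).
Local Notation edges := (edges g).
Local Notation nonedges := (nonedges g).
Local Notation clique := (clique g).
Local Notation k4 := (k4 g).
Local Notation nu := (nu g).
Local Notation common_nbrs := (common_nbrs g).
Local Notation tiling := (tiling g).
Local Notation tilingP := (tilingP g).

Section Fixed.
Variables (U : {set T}) (k m : nat).
Hypotheses (cU : #|U| = 4 * k + m) (nuU : nu U = k).
Hypothesis degK : forall K, k4 K -> K \subset U -> nonedges K U + 3 <= 2 * k + m.
Hypothesis degKr : forall K r, k4 K -> K \subset U -> r \in U -> r \notin K ->
  nonedges K U + nonedges [set r] U < 4 * k + m.
Local Notation tl := (tiling U k).

(** A vertex of the tile joined to [e] and [r] makes a K4 with them, and [f] takes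
    two other vertices of the tile. *)
Lemma triple_half P Q (e f : {set T}) r : tl P -> Q \in P ->
  #|e| = 2 -> #|f| = 2 -> clique e -> clique f ->
  e \subset rest U P -> f \subset rest U P -> [disjoint e & f] ->
  r \in rest U P -> {in e, forall a, g a r} -> {in f, forall a, g a r} ->
  nonedges e Q + nonedges [set r] Q <= 3 -> 3 <= #|common_nbrs f Q| -> False.
Proof.
move=> /tilingP[pP cP] QP ce cf qe qf se sf def rR re rf l3 l.
have cQ := k4_card (tile_k4 pP QP).
have hE := card_common_nbrs gS e Q; have hr := card_common_nbrs gS [set r] Q.
have hU : #|common_nbrs e Q :|: common_nbrs [set r] Q| <= 4.
  by rewrite -cQ subset_leq_card // subUset !common_nbrs_sub.
have hI := cardsUI (common_nbrs e Q) (common_nbrs [set r] Q).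
have /card_gt0P[q /setIP[qe' qr]] : 0 < #|common_nbrs e Q :&: common_nbrs [set r] Q| by nlia.
have [|A sA cA] := @subset_of_card _ (common_nbrs f Q :\ q) 2.
  by have := cardsD1 q (common_nbrs f Q); case: (q \in common_nbrs f Q); nlia.
have der : [disjoint e & [set r]].
  by rewrite disjoint_sym disjoints1; apply/negP => /re; rewrite gI.
apply: (@no_gain _ _ gS gI U P pP _ Q (e :|: [set r]) f [set q] A) => //.
- by rewrite nuU cP.
- by apply: cliqueU => //; [exact: clique1|move=> a b ae /set1P->; apply: re].
- by rewrite subUset se sub1set.
- rewrite -setI_eq0 setIUl setU_eq0 !setI_eq0 def disjoints1.
  by apply/negP => /rf; rewrite gI.
- rewrite sub1set; apply/(common_nbrsP gS).
  have [qQ h1] := common_nbrsP gS _ _ _ qe'; have [_ h2] := common_nbrsP gS _ _ _ qr.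
  by split=> // s /setUP[/h1|/h2].
- by apply: subset_trans sA (subsetDl _ _).
- rewrite disjoints1; apply/negP => /(subsetP sA); by rewrite !inE eqxx.
- by rewrite setUC cardsU1 cards1 ce; move: der; rewrite disjoint_sym disjoints1 => ->.
- by rewrite cf cA.
Qed.

Lemma triple_bound P Q (e f : {set T}) r : tl P -> Q \in P ->
  #|e| = 2 -> #|f| = 2 -> clique e -> clique f ->
  e \subset rest U P -> f \subset rest U P -> [disjoint e & f] ->
  r \in rest U P -> {in e, forall a, g a r} -> {in f, forall a, g a r} ->
  4 <= nonedges e Q + nonedges f Q + nonedges [set r] Q.
Proof.
move=> tP QP ce cf qe qf se sf def rR re rf; rewrite leqNgt; apply/negP => l.
have [pP cP] := tilingP _ _ _ tP.
have cQ := k4_card (tile_k4 pP QP).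
have hE := card_common_nbrs gS e Q; have hF := card_common_nbrs gS f Q.
have [l1|l1] := leqP (nonedges f Q) 1.
  by apply: (triple_half tP QP ce cf qe qf se sf def rR re rf); nlia.
rewrite disjoint_sym in def.
by apply: (triple_half tP QP cf ce qf qe sf se def rR rf re); nlia.
Qed.

Variable e : {set T}.
Hypotheses (ce : #|e| = 2) (qe : clique e).
Hypothesis emin : forall K f, k4 K -> K \subset U -> f \subset K -> #|f| = 2 ->
  nonedges e U <= nonedges f U.

(** Suppose that [f] lies in a K4 [K].  By minimality of [e], the non-neighbours
    of [e] and [f] number at most those of [K].  Each tile misses two pairs
    with [e] and [f], so both edges must have many common neighbours in the rest,
    and some vertex [r] of the rest outside [K] is joined to both.  Then
    each tile misses four pairs with [e], [f] and [r], while [r] is not adjacent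
    to any common neighbour of [e] or of [f] in the rest; this is too much for
    [K] and [r]. *)
Lemma rest_edges_free P (f K : {set T}) : tl P -> e \subset rest U P ->
  f \subset rest U P -> #|f| = 2 -> [disjoint e & f] -> k4 K -> K \subset U ->
  f \subset K -> False.
Proof.
move=> tP se sf cf def kK sK sfK.
have [pP cP] := tilingP _ _ _ tP; have mP : nu U <= #|P| by rewrite nuU cP.
have cR : #|rest U P| = m by have := card_rest pP; nlia.
have qf : clique f := cliqueS sfK (k4_clique kK).
have cKf : #|K :\: f| = 2 by rewrite cardsD (k4_card kK) (setIidPr sfK) cf.
have xK : nonedges K U = nonedges f U + nonedges (K :\: f) U.
  rewrite -nonedgesUl; last by apply: disjointI => x xf; rewrite inE xf.
  congr (nonedges _ _); apply/setP => x; rewrite !inE.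
  by case xf: (x \in f) => //=; rewrite (subsetP sfK).
have xe := emin kK sK (subsetDl K f) cKf.
have hK := degK kK sK.
have sp_e := nonedges_split gS pP e; have sp_f := nonedges_split gS pP f.
have pair : 2 * k <= \sum_(Q in P) nonedges e Q + \sum_(Q in P) nonedges f Q.
  rewrite -big_split -{1}cP; apply: (sum_ge_const (F := fun Q => nonedges e Q + nonedges f Q)) => Q QP.
  apply: (split_bound gS gI pP mP QP qe qf se sf def); rewrite ?ce ?cf //.
have te := card_common_nbrs gS e (rest U P); have tf := card_common_nbrs gS f (rest U P).
have cI := cardsUI (common_nbrs e (rest U P)) (common_nbrs f (rest U P)).
have cUn : #|common_nbrs e (rest U P) :|: common_nbrs f (rest U P)| <= m.
  by rewrite -cR subset_leq_card // subUset !common_nbrs_sub.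
have lte := subset_leq_card (common_nbrs_sub g e (rest U P)).
have ltf := subset_leq_card (common_nbrs_sub g f (rest U P)).
(* there are at least three candidates, and K has only two vertices outside f *)
have [r /setDP[/setIP[rE rF] nr]] :
    exists r, r \in common_nbrs e (rest U P) :&: common_nbrs f (rest U P) :\: (K :\: f).
  apply/card_gt0P; have := cardsID (K :\: f) (common_nbrs e (rest U P) :&: common_nbrs f (rest U P)).
  have := subset_leq_card (subsetIr (common_nbrs e (rest U P) :&: common_nbrs f (rest U P)) (K :\: f)).
  nlia.
have [rR re] := common_nbrsP gS _ _ _ rE; have [_ rf] := common_nbrsP gS _ _ _ rF.
have rK : r \notin K.
  apply/negP => rK; case/negP: nr; rewrite inE rK andbT.
  by apply/negP => /rf; rewrite gI.
have rU : r \in U by apply: (subsetP (rest_sub U P)).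
have hr := degKr kK sK rU rK.
have sp_r := nonedges_split gS pP [set r].
have trip : 4 * k <= \sum_(Q in P) nonedges e Q + \sum_(Q in P) nonedges f Q + \sum_(Q in P) nonedges [set r] Q.
  rewrite -!big_split -{1}cP.
  apply: (sum_ge_const (F := fun Q => nonedges e Q + nonedges f Q + nonedges [set r] Q)) => Q QP.
  exact: (triple_bound tP QP).
have big (h : {set T}) : #|h| = 2 -> clique h -> h \subset rest U P ->
    r \in common_nbrs h (rest U P) -> #|common_nbrs h (rest U P)| <= nonedges [set r] (rest U P).
  move=> ch qh sh /(common_nbrsP gS)[_ rh]; rewrite nonedges1; apply: subset_leq_card.
  apply/subsetP => y yh; have [yR hy] := common_nbrsP gS _ _ _ yh.
  rewrite in_setD yR andbT inE; apply/negP => gry; exfalso.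
  apply: (no_k4_rest pP mP (K := h :|: [set r; y])).
    apply: k4U => //.
    - by apply: cliqueU => //; [exact: clique1|exact: clique1|move=> a b /set1P-> /set1P->].
    - by move=> a b ah /set2P[]->; [apply: rh|apply: hy].
    - by rewrite ch cards2; case: eqVneq gry => // ->; rewrite gI.
  by rewrite !subUset sh !sub1set rR yR.
have := big e ce qe se rE; have := big f cf qf sf rF.
nlia.
Qed.

Lemma swap_vertex P Q z w : tl P -> Q \in P -> z \in Q -> w \in rest U P ->
  Q :\ z \subset nbr w -> exists P', [/\ tl P', P :\ Q \subset P' &
    rest U P' = z |: rest U P :\ w].
Proof.
move=> /tilingP[pP cP] QP zQ wR sw.
have cQ := k4_card (tile_k4 pP QP); have qQ := k4_clique (tile_k4 pP QP).
have wQ : w \notin Q by apply: disjoint_notin (rest_tile U QP) wR.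
have kK : k4 ([set w] :|: Q :\ z).
  apply: k4U => //; first exact: clique1.
  - by apply: cliqueS qQ; apply: subsetDl.
  - by move=> a b /set1P-> /(subsetP sw); rewrite inE.
  - by rewrite cards1; have := cardsD1 z Q; rewrite zQ; nlia.
have sK : [set w] :|: Q :\ z \subset Q :|: rest U P.
  rewrite subUset sub1set inE wR orbT /=.
  by apply: subset_trans (subsetDl _ _) (subsetUl _ _).
have [pP' cP' rP'] := swap_tile pP QP kK sK.
exists ([set w] :|: Q :\ z |: P :\ Q); split.
- by apply/tilingP; rewrite cP'.
- exact: subsetUr.
rewrite rP'; have nR x : x \in rest U P -> x \notin Q.
  by apply: disjoint_notin; apply: rest_tile.
move: (rest U P) nR => R nR; apply/setP => x; rewrite !inE.
have [->|nxz] /= := eqVneq x z.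
  by rewrite zQ !orbF andbT; apply: contraNneq wQ => <-.
case xQ: (x \in Q) => /=; last by rewrite orbF.
by rewrite orbT; apply/esym/negbTE; rewrite negb_and (contraL (nR x)) ?orbT // xQ.
Qed.

Section Totals.
Variable P : {set {set T}}.
Hypotheses (tP : tl P) (seR : e \subset rest U P).
Local Notation R := (rest U P).

(** The vertices of the rest that can replace [z] in the tile [Q]. *)
Definition swappers Q z := [set w in R :\: e | Q :\ z \subset nbr w].

(** Two candidates are required, so that one is left when the other vertex under
    consideration is itself a candidate. *)
Definition loose := [set Q in P | [exists z in Q, 2 <= #|swappers Q z|]].

Lemma pick_swappable : exists zf : {set T} -> T,
  forall Q, Q \in loose -> zf Q \in Q /\ 2 <= #|swappers Q (zf Q)|.
Proof.
have /card_gt0P[e0 _] : 0 < #|e| by rewrite ce.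
exists (fun Q => odflt e0 [pick z in Q | 2 <= #|swappers Q z|]) => Q.
rewrite inE => /andP[_ /exists_inP[z zQ hz]].
by case: pickP => [z' /andP[]//|/(_ z)]; rewrite zQ hz.
Qed.

Lemma looseP Q : Q \in loose -> Q \in P. Proof. by rewrite inE => /andP[]. Qed.

Lemma swappersP Q z w : w \in swappers Q z ->
  [/\ w \in R, w \notin e & Q :\ z \subset nbr w].
Proof. by rewrite inE in_setD => /andP[/andP[-> ->] ->]. Qed.

Lemma other_swapper Q z v : 2 <= #|swappers Q z| ->
  exists2 w, w \in swappers Q z & w != v.
Proof.
move=> l; have /card_gt0P[w /setD1P[wv ws]] : 0 < #|swappers Q z :\ v|.
  by have := cardsD1 v (swappers Q z); case: (v \in _); nlia.
by exists w.
Qed.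

Section Choice.
Variable zf : {set T} -> T.
Hypothesis zfP : forall Q, Q \in loose -> zf Q \in Q /\ 2 <= #|swappers Q (zf Q)|.

Definition swappable := [set zf Q | Q in loose].
Definition core := (R :\: e) :|: swappable.

Lemma expose1 Q v : Q \in loose -> v \in R -> exists P',
  [/\ tl P', e \subset rest U P', v \in rest U P' & zf Q \in rest U P'].
Proof.
move=> QL vR; have [zQ l2] := zfP QL.
have [w /swappersP[wR we sw] wv] := other_swapper v l2.
have [P' [tP' _ rP']] := swap_vertex tP (looseP QL) zQ wR sw.
exists P'; split=> //; rewrite rP' ?in_setU1 ?in_setD1 ?eqxx //.
  apply/subsetP => x xe; rewrite in_setU1 in_setD1 (subsetP seR) // andbT.
  by rewrite (_ : x != w) ?orbT //; apply: contraNneq we => <-.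
by rewrite vR [v == w]eq_sym wv orbT.
Qed.

Lemma expose2 Q Q' : Q \in loose -> Q' \in loose -> Q != Q' -> exists P',
  [/\ tl P', e \subset rest U P', zf Q \in rest U P' & zf Q' \in rest U P'].
Proof.
move=> QL QL' ne; have [zQ l2] := zfP QL; have [zQ' l2'] := zfP QL'.
have [w /swappersP[wR we sw] _] := other_swapper (zf Q) l2.
have [P1 [tP1 sP1 rP1]] := swap_vertex tP (looseP QL) zQ wR sw.
have [w' /swappersP[wR' we' sw'] ww'] := other_swapper w l2'.
have QP1 : Q' \in P1 by apply: (subsetP sP1); rewrite in_setD1 eq_sym ne looseP.
have w'1 : w' \in rest U P1 by rewrite rP1 in_setU1 in_setD1 ww' wR' orbT.
have [P2 [tP2 _ rP2]] := swap_vertex tP1 QP1 zQ' w'1 sw'.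
have nz : zf Q != w'.
  by apply: contraTneq wR' => <-; apply: disjoint_notin zQ; rewrite disjoint_sym rest_tile ?looseP.
exists P2; split=> //; rewrite rP2 rP1.
- apply/subsetP => x xe; rewrite !(in_setU1, in_setD1) (subsetP seR) // !andbT.
  have -> : x != w' by apply: contraNneq we' => <-.
  have -> : x != w by apply: contraNneq we => <-.
  by rewrite !orbT.
- by rewrite !(in_setU1, in_setD1) eqxx nz /= orbT.
- by rewrite in_setU1 eqxx.
Qed.

Lemma expose u v : u \in core -> v \in core -> u != v -> exists P',
  [/\ tl P', e \subset rest U P', u \in rest U P' & v \in rest U P'].
Proof.
move=> /setUP[/setDP[uR _]|/imsetP[Q QL ->]] /setUP[/setDP[vR _]|/imsetP[Q' QL' ->]] ne.
- by exists P.
- by have [P' [? ? ? ?]] := expose1 QL' uR; exists P'.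
- by have [P' [? ? ? ?]] := expose1 QL vR; exists P'.
- by apply: expose2 => //; apply: contraNneq ne => ->.
Qed.

(** After at most two exchanges both ends of the edge lie in the rest of a tiling
    that avoids [e], where [rest_edges_free] applies. *)
Lemma core_edges_free u v K : u \in core -> v \in core -> g u v -> k4 K ->
  K \subset U -> u \in K -> v \in K -> False.
Proof.
move=> uZ vZ guv kK sK uK vK.
have ne : u != v by apply: contraTneq guv => ->; rewrite gI.
have ecore x : x \in core -> x \notin e.
  move=> /setUP[/setDP[]//|/imsetP[Q QL ->]].
  have [zQ _] := zfP QL; apply: contraL zQ => /(subsetP seR).
  by apply: disjoint_notin; rewrite rest_tile // looseP.
have [P' [tP' se' uR vR]] := expose uZ vZ ne.
apply: (rest_edges_free (P := P') (f := [set u; v]) tP' se' _ _ _ kK sK).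
- by rewrite subUset !sub1set uR.
- by rewrite cards2 ne.
- by rewrite disjoint_sym; apply: disjointI => x /set2P[]->; apply: ecore.
- by rewrite subUset !sub1set uK.
Qed.

(** A vertex of the rest with three neighbours in [Q] is a candidate to replace
    some vertex of [Q]; in a tile that is not loose there are at most four such
    vertices. *)
Lemma tight_tile Q : Q \in P -> Q \notin loose ->
  edges Q (R :\: e) <= 2 * #|R :\: e| + 8.
Proof.
move=> QP; rewrite inE QP /= negb_exists_in => /forall_inP H.
have [pP cP] := tilingP _ _ _ tP.
have cQ := k4_card (tile_k4 pP QP).
have one w : w \in R :\: e ->
    edges [set w] Q <= 2 + 2 * \sum_(z in Q) (w \in swappers Q z).
  move=> wR; have e1 := edges_nonedges g [set w] Q; rewrite cards1 cQ nonedges1 in e1.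
  have [l|l] := leqP 2 #|Q :\: nbr w|; first by nlia.
  suff /exists_inP[z zQ hz] : [exists z in Q, w \in swappers Q z].
    by rewrite (big_setD1 z) //= hz; nlia.
  have [z zQ hz] : exists2 z, z \in Q & Q :\: nbr w \subset [set z].
    move: l; rewrite ltnS leq_eqVlt ltnS leqn0 cards_eq0 => /orP[/cards1P[z hz]|/eqP->].
      by exists z; rewrite ?hz //; have /setDP[] : z \in Q :\: nbr w by rewrite hz inE.
    have /card_gt0P[z zQ] : 0 < #|Q| by rewrite cQ.
    by exists z => //; apply: sub0set.
  apply/exists_inP; exists z => //; rewrite inE wR /=.
  by rewrite subDset setUC -subDset.
rewrite edges_sym // edges_sum1; 
apply: (@leq_trans (\sum_(w in R :\: e)
    (2 + 2 * \sum_(z in Q) (w \in swappers Q z)))); first exact: leq_sum.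
rewrite big_split /= sum_nat_const mulnC leq_add2l -big_distrr exchange_big /=.
rewrite -[8]/(2 * 4) leq_mul2l /= -cQ -sum1_card; apply: leq_sum => z /H.
rewrite -ltnNge ltnS; apply: leq_trans.
rewrite -sum1_card big_mkcond [X in _ <= X]big_mkcond /=; apply: leq_sum => w _.
by case: (w \in R :\: e); case: (w \in swappers Q z).
Qed.

End Choice.
End Totals.
End Fixed.
End MiddleStructure.

(** * Middle range: counting the edges *)
Section MiddleCount.
Variables (T : finType) (g : rel T).
Hypotheses (gS : symmetric g) (gI : irreflexive g).
Implicit Types (A B C D K Q R S Y f : {set T}) (P M F : {set {set T}}) (u v w x y z : T).
Local Notation nbr := (nbr g).
Local Notation edges := (edges g).
Local Notation nonedges := (nonedges g).
Local Notation clique := (clique g).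
Local Notation k4 := (k4 g).
Local Notation lagrangian := (lagrangian g).

(** The result of symmetrizing a K4-free part of the graph with weights the
    degrees into [Y]: classes of sizes [s1 >= s2 >= s3], with [N1], [N2], [N3]
    the neighbourhoods in [Y] of their representatives.  Missing classes have
    size 0 and an empty neighbourhood. *)
Record three_parts (s : T -> nat) Y (s1 s2 s3 : nat) (N1 N2 N3 : {set T}) := ThreeParts {
  tp_sort : s3 <= s2 <= s1;
  tp_sum : \sum_v s v = s1 + s2 + s3;
  tp_edges : \sum_v s v * edges [set v] Y = s1 * #|N1| + s2 * #|N2| + s3 * #|N3|;
  tp_sq : \sum_v s v ^ 2 = s1 ^ 2 + s2 ^ 2 + s3 ^ 2;
  tp_sub : [/\ N1 \subset Y, N2 \subset Y & N3 \subset Y];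
  tp_indep : [/\ edges (N1 :&: N2) (N1 :&: N2) = 0, edges (N1 :&: N3) (N1 :&: N3) = 0 &
                 edges (N2 :&: N3) (N2 :&: N3) = 0];
  tp_triple : N1 :&: N2 :&: N3 = set0 }.

Lemma edges00 : edges set0 set0 = 0. Proof. by rewrite /edges big_set0. Qed.

Lemma three_partsP s Y : clique (supp s) -> #|supp s| <= 3 ->
  (forall u v, u \in supp s -> v \in supp s -> g u v ->
     edges (Y :&: nbr u :&: (Y :&: nbr v)) (Y :&: nbr u :&: (Y :&: nbr v)) = 0) ->
  (forall u v w, u \in supp s -> v \in supp s -> w \in supp s ->
     g u v -> g u w -> g v w ->
     Y :&: nbr u :&: (Y :&: nbr v) :&: (Y :&: nbr w) = set0) ->
  exists s1 s2 s3 N1 N2 N3, three_parts s Y s1 s2 s3 N1 N2 N3.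
Proof.
move=> /cliqueP cs c3 I2 I3.
pose le u v := s v <= s u.
pose l := sort le (enum (supp s)).
have sl : sorted le l by apply: sort_sorted => u v; apply: leq_total.
have ul : uniq l by rewrite sort_uniq enum_uniq.
have ml v : (v \in l) = (v \in supp s) by rewrite mem_sort mem_enum.
have zl : size l <= 3 by rewrite size_sort -cardE.
have sumE (F : T -> nat) : (forall v, s v = 0 -> F v = 0) ->
    \sum_v F v = \sum_(v <- l) F v.
  move=> h; rewrite (sum_supp h) -big_enum /=; apply: perm_big.
  by rewrite perm_sym perm_sort.
have e1 := sumE s (fun v h => h).
have e2 : \sum_v s v * edges [set v] Y = \sum_(v <- l) s v * #|Y :&: nbr v|.
  by rewrite sumE => [|v ->//]; apply: eq_bigr => v _; rewrite edges1.
have e3 : \sum_v s v ^ 2 = \sum_(v <- l) s v ^ 2 by apply: sumE => v ->.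
have adj u v : u \in l -> v \in l -> u != v -> g u v by rewrite !ml; apply: cs.
have sY v : Y :&: nbr v \subset Y by apply: subsetIl.
move: sl ul ml zl e1 e2 e3 adj {sumE}.
case: l => [|c1 [|c2 [|c3' [|//]]]] /= sl ul ml _ e1 e2 e3 adj;
  rewrite !(big_cons, big_nil) ?addn0 in e1 e2 e3.
- exists 0, 0, 0, set0, set0, set0; split; rewrite ?e1 ?e2 ?e3 ?set0I ?edges00 ?cards0 //.
  by rewrite sub0set.
- exists (s c1), 0, 0, (Y :&: nbr c1), set0, set0.
  by split; rewrite ?e1 ?e2 ?e3 ?setI0 ?set0I ?edges00 ?cards0 ?sY ?sub0set ?addn0 ?muln0.
- have m1 : c1 \in supp s by rewrite -ml inE eqxx.
  have m2 : c2 \in supp s by rewrite -ml !inE eqxx orbT.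
  move: sl ul; rewrite inE !andbT /le => sl n12.
  have g12 : g c1 c2 by apply: adj; rewrite ?inE ?eqxx ?orbT.
  exists (s c1), (s c2), 0, (Y :&: nbr c1), (Y :&: nbr c2), set0.
  by split; rewrite ?e1 ?e2 ?e3 ?setI0 ?set0I ?edges00 ?cards0 ?sY ?sub0set ?addn0 ?muln0 ?sl ?I2.
- have m1 : c1 \in supp s by rewrite -ml inE eqxx.
  have m2 : c2 \in supp s by rewrite -ml !inE eqxx orbT.
  have m3 : c3' \in supp s by rewrite -ml !inE eqxx !orbT.
  move: sl ul; rewrite !inE !andbT /le negb_or => /andP[s21 s32] /andP[/andP[n12 n13] n23].
  have g12 : g c1 c2 by apply: adj; rewrite ?inE ?eqxx ?orbT.
  have g13 : g c1 c3' by apply: adj; rewrite ?inE ?eqxx ?orbT.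
  have g23 : g c2 c3' by apply: adj; rewrite ?inE ?eqxx ?orbT.
  exists (s c1), (s c2), (s c3'), (Y :&: nbr c1), (Y :&: nbr c2), (Y :&: nbr c3').
  by split; rewrite ?e1 ?e2 ?e3 ?addnA ?sY ?s21 ?s32 ?I2 ?I3.
Qed.

Lemma k4_four a b c d : g a b -> g c d -> g a c -> g a d -> g b c -> g b d ->
  k4 ([set a; b] :|: [set c; d]).
Proof.
have pair x y : g x y -> clique [set x; y].
  move=> gxy; apply: cliqueU => //; [exact: clique1|exact: clique1|].
  by move=> u v /set1P-> /set1P->.
have ne x y : g x y -> x != y by apply: contraTneq => ->; rewrite gI.
move=> gab gcd gac gad gbc gbd; apply: k4U => //; rewrite ?pair //.
  by move=> u v /set2P[]-> /set2P[]->.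
by rewrite !cards2 !ne.
Qed.

Lemma edges0_nonedges A : edges A A = 0 -> nonedges A A = #|A| ^ 2.
Proof. by move=> h; have := edges_nonedges g A A; rewrite h mulnn. Qed.

Lemma nonedges_disjoint2 A B : [disjoint A & B] -> nonedges A A + nonedges B B <= nonedges (A :|: B) (A :|: B).
Proof. by move=> d; rewrite nonedgesUl // !nonedgesUr // leq_add ?leq_addr ?leq_addl. Qed.

Lemma edges_le A B : edges A B <= #|A| * #|B|.
Proof. by rewrite -(edges_nonedges g) leq_addr. Qed.

Lemma setI0_disjoint A B : A :&: B = set0 -> [disjoint A & B].
Proof. by move=> h; rewrite -setI_eq0 h. Qed.

(** [R0 + X] spans no edge of a K4, so the clique obtained by symmetrizing it has at
    most three vertices, and its neighbourhoods in [Y3] pairwise meet in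
    independent sets (of sizes [a], [b], [c]), whose missing pairs compensate for
    the overlap. *)
Lemma core_bound (U e R0 X Y3 Y4 : {set T}) (M p x : nat) :
  U = e :|: ((R0 :|: X) :|: (Y3 :|: Y4)) ->
  [disjoint e & (R0 :|: X) :|: (Y3 :|: Y4)] ->
  [disjoint R0 :|: X & Y3 :|: Y4] -> [disjoint R0 & X] -> [disjoint Y3 & Y4] ->
  [/\ #|e| = 2, #|R0| = M, #|X| = p, #|Y3| = 3 * p & #|Y4| = 4 * x] ->
  edges R0 Y4 <= x * (2 * M + 8) ->
  (forall A, A \subset Y3 -> edges A A = 0 -> #|A| <= p) ->
  (forall u v K, u \in R0 :|: X -> v \in R0 :|: X -> g u v -> k4 K ->
     K \subset U -> u \in K -> v \in K -> False) ->
  exists s1 s2 s3 n1 n2 n3 a b c,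
  [/\ s3 <= s2 <= s1, s1 + s2 + s3 = M + p,
      [/\ a <= p, b <= p & c <= p],
      [/\ n1 + n2 + n3 <= 3 * p + a + b + c, a + c <= n2 & b + c <= n3] &
      edges U U + (a ^ 2 + b ^ 2 + c ^ 2) <= 4 * #|U| + (3 * p + 4 * x) ^ 2 +
        2 * (x * (2 * M + 8) + 4 * (x * p)) +
        2 * (s1 * n1 + s2 * n2 + s3 * n3) + 2 * (s1 * s2 + s1 * s3 + s2 * s3)].
Proof.
move=> eU de dZY dRX dY [ce cR cX cY3 cY4] eRY hA hcore.
set Z := R0 :|: X in eU de dZY hcore; set Y := Y3 :|: Y4 in eU de dZY.
have ZU : Z \subset U by rewrite eU setUCA subsetUl.
have Y3Y : Y3 \subset Y := subsetUl _ _.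
have YU : Y \subset U by rewrite eU setUA subsetUr.
have [s [sc sZ ss sb]] := zykov gS gI (fun v => edges [set v] Y3) Z.
have inZ v : v \in supp s -> v \in Z by apply: (subsetP sZ).
have inYU y : y \in Y3 -> y \in U by move=> yY; apply/(subsetP YU)/(subsetP Y3Y).
have inZU y : y \in Z -> y \in U by apply: (subsetP ZU).
have bad u v x1 x2 : u \in Z -> v \in Z -> x1 \in U -> x2 \in U -> g u v ->
    g x1 x2 -> g u x1 -> g u x2 -> g v x1 -> g v x2 -> False.
  move=> uZ vZ xU yU guv gxy h1 h2 h3 h4.
  apply: (hcore u v ([set u; v] :|: [set x1; x2]) uZ vZ guv); rewrite ?inE ?eqxx ?orbT //.
    exact: k4_four.
  by rewrite !subUset !sub1set xU yU !inZU.
have s3 : #|supp s| <= 3.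
  apply: (clique_le3 gS gI (U := Z)) sc sZ => K kK sK.
  have c4 := k4_card kK.
  have /card_gt0P[u uK] : 0 < #|K| by rewrite c4.
  have /card_gt0P[v /setD1P[vu vK]] : 0 < #|K :\ u|.
    by have := cardsD1 u K; rewrite uK c4; nlia.
  apply: (hcore u v K) => //; try exact: (subsetP sK).
    by apply: (cliqueP _ _ (k4_clique kK)) => //; rewrite eq_sym.
  exact: subset_trans sK ZU.
have [||s1 [s2 [s3' [N1 [N2 [N3 [h1 h2 h3 h4 [y1 y2 y3] [i1 i2 i3] h6]]]]]]] :=
  @three_partsP s Y3 sc s3.
- move=> u v us vs guv; apply: big1 => x1; rewrite !inE => /andP[/andP[xY ux] /andP[_ vx]].
  apply: big1 => x2; rewrite !inE => /andP[/andP[yY uy] /andP[_ vy]].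
  case: (boolP (g x1 x2)) => // gxy; exfalso.
  by apply: (bad u v x1 x2); rewrite ?inZ ?inYU.
- move=> u v w us vs ws guv guw gvw; apply/setP => y; rewrite in_set0.
  apply/negP; rewrite !inE => /andP[/andP[/andP[yY uy] /andP[_ vy]] /andP[_ wy]].
  have wU : w \in U by apply/inZU/inZ.
  have yU := inYU y yY.
  by apply: (bad u v w y) => //; apply: inZ.
have q := lagrangian_clique gI sc.
have d12 : [disjoint N1 :&: N2 & N1 :&: N3].
  by apply: setI0_disjoint; rewrite setIACA setIid setIA.
have d123 : [disjoint N1 :&: N2 :|: N1 :&: N3 & N2 :&: N3].
  apply: setI0_disjoint; rewrite setIUl -setIA [N2 :&: (N2 :&: N3)]setIA setIid.
  by rewrite setIA h6 set0U -setIA [N3 :&: _]setICA setIid setIA h6.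
have sI A B : A \subset Y3 -> A :&: B \subset Y3 by apply: subset_trans (subsetIl _ _).
exists s1, s2, s3', #|N1|, #|N2|, #|N3|, #|N1 :&: N2|, #|N1 :&: N3|, #|N2 :&: N3|.
split=> //.
- by rewrite -h2 ss cardsU cR cX; move: dRX; rewrite -setI_eq0 => /eqP->; rewrite cards0 subn0.
- by split; apply: hA => //; apply: sI.
- split.
  + have c12 := cardsUI N1 N2; have c123 := cardsUI (N1 :|: N2) N3.
    have : #|N1 :|: N2 :|: N3| <= 3 * p.
      by rewrite -cY3 subset_leq_card // !subUset y1 y2.
    have := cardsUI (N1 :&: N3) (N2 :&: N3).
    rewrite -setIUl (_ : N1 :&: N3 :&: (N2 :&: N3) = set0) ?cards0; last first.
      by rewrite setIACA setIid.
    nlia.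
  + have := cardsUI (N1 :&: N2) (N2 :&: N3).
    rewrite (_ : N1 :&: N2 :&: (N2 :&: N3) = set0) ?cards0; last first.
      by rewrite setIA -[N1 :&: N2 :&: N2]setIA setIid.
    suff : #|N1 :&: N2 :|: N2 :&: N3| <= #|N2| by nlia.
    by rewrite subset_leq_card // subUset subsetIr subsetIl.
  + have := cardsUI (N1 :&: N3) (N2 :&: N3).
    rewrite (_ : N1 :&: N3 :&: (N2 :&: N3) = set0) ?cards0; last first.
      by rewrite setIACA setIid.
    suff : #|N1 :&: N3 :|: N2 :&: N3| <= #|N3| by nlia.
    by rewrite subset_leq_card // subUset !subsetIr.
have nY : #|N1 :&: N2| ^ 2 + #|N1 :&: N3| ^ 2 + #|N2 :&: N3| ^ 2 <= nonedges Y Y.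
  rewrite -!edges0_nonedges //; apply: leq_trans (leq_add (nonedges_disjoint2 d12) (leqnn _)) _.
  apply: leq_trans (nonedges_disjoint2 d123) _.
  have s3Y : N1 :&: N2 :|: N1 :&: N3 :|: N2 :&: N3 \subset Y.
    by apply: subset_trans Y3Y; rewrite !subUset !sI.
  exact: leq_trans (nonedgesSl gS _ s3Y) (nonedgesSr g _ s3Y).
have cY : #|Y| = 3 * p + 4 * x.
  by rewrite cardsU cY3 cY4; move: dY; rewrite -setI_eq0 => /eqP->; rewrite cards0 subn0.
have eYY := edges_nonedges g Y Y; rewrite cY mulnn in eYY.
have eXY := edges_le X Y4; rewrite cX cY4 in eXY.
have eeU := edges_le e U; rewrite ce in eeU.
have e4 : edges Z Y = edges Z Y3 + edges R0 Y4 + edges X Y4.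
  by rewrite edgesUr // -addnA -edgesUl.
clearbody Z Y.
have e1 : edges U U = edges e U + edges (Z :|: Y) e + edges (Z :|: Y) (Z :|: Y).
  by rewrite {1}eU edgesUl // {2}eU edgesUr // addnA.
have e2 : edges (Z :|: Y) e <= edges e U.
  by rewrite edges_sym // eU [X in _ <= X]edgesUr // leq_addl.
have e3 : edges (Z :|: Y) (Z :|: Y) = edges Z Z + 2 * edges Z Y + edges Y Y.
  by rewrite edgesUl // !edgesUr // (edges_sym gS Y Z); nlia.
rewrite -edges_sum1 in sb.
have e5 : lagrangian s = 2 * (s1 * s2 + s1 * s3' + s2 * s3').
  move: q; rewrite h4 h2; move: (lagrangian s) => r; clear; lia.
rewrite e5 h3 in sb.
move: eXY; rewrite (_ : p * (4 * x) = 4 * (x * p)); last by clear; lia.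
move: (x * p) (x * (2 * M + 8)) eRY => xp xM eRY eXY.
move: ((3 * p + 4 * x) ^ 2) eYY => sq eYY.
move: (s1 * s2 + s1 * s3' + s2 * s3') sb => r1.
move: (s1 * #|N1| + s2 * #|N2| + s3' * #|N3|) => r2 sb.
move: (#|N1 :&: N2| ^ 2 + #|N1 :&: N3| ^ 2 + #|N2 :&: N3| ^ 2) nY => r3 nY.
rewrite e1 e3 e4; nlia.
Qed.

End MiddleCount.

Section MiddleTiling.
Variables (T : finType) (g : rel T).
Hypotheses (gS : symmetric g) (gI : irreflexive g).
Implicit Types (A B C D K Q R S Y f : {set T}) (P F L : {set {set T}}) (u v w y z : T).
Local Notation edges := (edges g).
Local Notation nonedges := (nonedges g).
Local Notation clique := (clique g).
Local Notation k4 := (k4 g).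
Local Notation packing := (packing g).
Local Notation nu := (nu g).
Local Notation tiling := (tiling g).
Local Notation tilingP := (tilingP g).

Lemma edges_cover A P : trivIset P -> edges A (cover P) = \sum_(Q in P) edges A Q.
Proof.
move=> tP; rewrite /edges.
rewrite (eq_bigr (fun a => \sum_(Q in P) \sum_(b in Q) (g a b : nat))).
  by rewrite exchange_big.
by move=> a _; rewrite big_trivIset.
Qed.

(** An independent set has at most one vertex in each tile. *)
Lemma indep_le_tiles U L A : packing U L -> A \subset cover L -> edges A A = 0 ->
  #|A| <= #|L|.
Proof.
move=> pL sA e0; have [hL tL] := packingP _ _ _ pL.
have inj : {in A &, injective (pblock L)}.
  move=> y z yA zA E; apply/eqP/negPn/negP => ne.
  have yc := subsetP sA y yA; have zc := subsetP sA z zA.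
  have [/k4_clique/cliqueP qQ _] := hL _ (pblock_mem yc).
  have gyz : g y z by apply: qQ => //; [rewrite mem_pblock|rewrite E mem_pblock].
  by move/eqP/(edges0P g): e0 => /(_ y z yA zA); rewrite gyz.
rewrite -(card_in_imset inj); apply: subset_leq_card.
by apply/subsetP => Q /imsetP[y yA ->]; apply: pblock_mem; apply: (subsetP sA).
Qed.

(** [p] counts the loose tiles and [x] the others; [X] consists of the exchangeable
    vertices of the loose tiles, [Y3] of their other vertices. *)
Lemma middle_rest_bound (U : {set T}) (k m : nat) : #|U| = 4 * k + m -> nu U = k -> 0 < k ->
  (forall K, k4 K -> K \subset U -> nonedges K U + 3 <= 2 * k + m) ->
  (forall K r, k4 K -> K \subset U -> r \in U -> r \notin K ->
     nonedges K U + nonedges [set r] U < 4 * k + m) ->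
  (forall S, S \subset U -> #|S| = 2 -> k <= nu (U :\: S)) ->
  exists x p M s1 s2 s3 n1 n2 n3 a b c : nat,
  [/\ k = x + p /\ m = M + 2,
      s3 <= s2 <= s1 /\ s1 + s2 + s3 = M + p,
      [/\ a <= p, b <= p & c <= p],
      [/\ n1 + n2 + n3 <= 3 * p + a + b + c, a + c <= n2 & b + c <= n3] &
      edges U U + (a ^ 2 + b ^ 2 + c ^ 2) <= 4 * #|U| + (3 * p + 4 * x) ^ 2 +
        2 * (x * (2 * M + 8) + 4 * (x * p)) +
        2 * (s1 * n1 + s2 * n2 + s3 * n3) + 2 * (s1 * s2 + s1 * s3 + s2 * s3)].
Proof.
move=> cU nuU k0 dK dKr h2.
have [K0 kK0 sK0] : exists2 K, k4 K & K \subset U by apply: nu_k4; rewrite nuU.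
pose inK f := (#|f| == 2) && [exists K : {set T}, [&& k4 K, K \subset U & f \subset K]].
have [|f0 sf0 cf0] := @subset_of_card _ K0 2; first by rewrite (k4_card kK0).
have f0in : inK f0 by rewrite /inK cf0 eqxx; apply/existsP; exists K0; rewrite kK0 sK0.
case: (@arg_minnP _ f0 inK (fun f => nonedges f U) f0in) => e.
move=> /andP[/eqP ce /existsP[K /and3P[kK sK eK]]] /= emin0.
have emin K1 f : k4 K1 -> K1 \subset U -> f \subset K1 -> #|f| = 2 -> nonedges e U <= nonedges f U.
  move=> kK1 sK1 fK1 cf; apply: emin0; rewrite /inK cf eqxx.
  by apply/existsP; exists K1; rewrite kK1 sK1.
have qe : clique e := cliqueS eK (k4_clique kK).
have seU : e \subset U := subset_trans eK sK.
have [P [pP cP seR]] := tiling_avoiding nuU (h2 e seU ce) seU.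
have tP : tiling U k P by apply/tilingP.
have cR := card_rest pP.
have [zf zfP] := pick_swappable g U ce P.
pose L := loose g U e P; pose X := swappable g U e P zf.
set R := rest U P in seR cR.
have sLP : L \subset P by apply/subsetP => Q; apply: looseP.
have pL : packing U L := kfamS sLP pP.
have pL' : packing U (P :\: L) := kfamS (subsetDl P L) pP.
have cP4 : cover P = cover L :|: cover (P :\: L).
  apply/setP => y; apply/bigcupP/setUP => [[Q QP yQ]|[]/bigcupP[Q QP yQ]].
  - have [QL|QL] := boolP (Q \in L); first by left; apply/bigcupP; exists Q.
    by right; apply/bigcupP; exists Q; rewrite // inE QL.
  - by exists Q => //; apply: (subsetP sLP).
  - by exists Q => //; case/setDP: QP.
have zfL Q : Q \in L -> zf Q \in cover L.
  by move=> QL; apply/bigcupP; exists Q => //; case: (zfP Q QL).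
have [_ /trivIsetP tL] := packingP _ _ _ pL.
have sXL : X \subset cover L by apply/subsetP => y /imsetP[Q QL ->]; apply: zfL.
have cX : #|X| = #|L|.
  apply: card_in_imset => Q Q' QL QL' E; apply/eqP/negPn/negP => ne.
  have := disjoint_notin (tL _ _ QL QL' ne) (zfP Q QL).1.
  by rewrite E (zfP Q' QL').1.
have dRc : [disjoint R & cover P] by apply: rest_cover.
have sLc : cover L \subset cover P by rewrite cP4 subsetUl.
have sLc' : cover (P :\: L) \subset cover P by rewrite cP4 subsetUr.
have dLL : [disjoint cover L & cover (P :\: L)].
  apply: disjointI => y /bigcupP[Q QL yQ]; apply/bigcupP => -[Q' /setDP[Q'P Q'L] yQ'].
  have [_ /trivIsetP t] := packingP _ _ _ pP.
  have ne : Q != Q' by apply: contraTneq QL => ->.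
  by have := disjoint_notin (t _ _ (subsetP sLP Q QL) Q'P ne) yQ; rewrite yQ'.
have eY : (cover L :\: X) :|: cover (P :\: L) = cover P :\: X.
  rewrite cP4 setDUl; congr (_ :|: _); apply/esym/setDidPl.
  by rewrite disjoint_sym; apply: disjointWl dLL.
have eU : U = e :|: ((R :\: e :|: X) :|: ((cover L :\: X) :|: cover (P :\: L))).
  rewrite eY -setUA setUA [e :|: _]setUC (_ : R :\: e :|: e = R); last first.
    by apply/setP => y; rewrite in_setU in_setD; case ye: (y \in e); rewrite ?orbT ?orbF //=;
       rewrite (subsetP seR).
  rewrite (_ : X :|: cover P :\: X = cover P); last first.
    by rewrite -{1}(setIidPr (subset_trans sXL sLc)) setID.
  by rewrite /R /rest setUC -{1}(setID U (cover P)) (setIidPr (kfam_cover pP)).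
have c4 : #|cover L| = 4 * #|L| := kfam_card pL.
have cY4 : #|cover (P :\: L)| = 4 * #|P :\: L| := kfam_card pL'.
have cPL : #|P :\: L| + #|L| = k.
  by have := cardsID L P; rewrite (setIidPr sLP) cP addnC.
have cRe : #|R :\: e| + 2 = m.
  have := cardsD R e; rewrite (setIidPr seR) ce.
  have := subset_leq_card seR; rewrite ce; nlia.
exists #|P :\: L|, #|L|, #|R :\: e|.
have [||||||||s1 [s2 [s3 [n1 [n2 [n3 [a [b [c [o1 o2 o3 o4 o5]]]]]]]]]] :=
  @core_bound T g gS gI U e (R :\: e) X (cover L :\: X) (cover (P :\: L))
   #|R :\: e| #|L| #|P :\: L| eU.
- rewrite eY; apply: disjointI => y ye.
  have yR := subsetP seR y ye; have yc := disjoint_notin dRc yR.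
  rewrite !in_setU !in_setD ye (negPf yc) /= andbF orbF.
  by apply: contra yc => /(subsetP sXL)/(subsetP sLc).
- rewrite eY; apply: disjointI => y /setUP[/setDP[yR _]|yX].
    by rewrite in_setD (negPf (disjoint_notin dRc yR)) andbF.
  by rewrite in_setD yX.
- apply: disjointI => y /setDP[yR _]; have := disjoint_notin dRc yR.
  by apply: contra => /(subsetP sXL)/(subsetP sLc).
- by apply: disjointWl dLL; apply: subsetDl.
- split=> //; rewrite cardsD c4 (setIidPr sXL) cX; nlia.
- have [_ t] := packingP _ _ _ pL'.
  rewrite edges_cover // -sum_nat_const; apply: leq_sum => Q /setDP[QP QL].
  rewrite edges_sym //; exact: (tight_tile gS cU nuU ce tP QP QL).
- move=> A sA; apply: indep_le_tiles pL _; apply: subset_trans sA (subsetDl _ _).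
- move=> u v K1 uZ vZ guv kK1 sK1 uK vK.
  exact: (core_edges_free gS gI cU nuU dK dKr ce qe emin tP seR zfP uZ vZ guv kK1 sK1 uK vK).
exists s1, s2, s3, n1, n2, n3, a, b, c; split=> //.
Qed.

End MiddleTiling.

(** * Edge sets and adjacency relations *)
Section EdgeSets.
Variable V : finType.
Implicit Types (E : {set {set V}}) (u v : V).

Definition rel_of E : rel V := fun u v => [set u; v] \in E.
Definition edges_of (g : rel V) : {set {set V}} :=
  [set [set p.1; p.2] | p in [set p : V * V | g p.1 p.2]].

Lemma rel_of_sym E : symmetric (rel_of E).
Proof. by move=> u v; rewrite /rel_of setUC. Qed.

Lemma simple_card E e : is_simple_graph E -> e \in E -> #|e| = 2.
Proof. by move/forall_inP=> h /h/eqP. Qed.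

Lemma rel_of_irr E : is_simple_graph E -> irreflexive (rel_of E).
Proof.
move=> sE u; apply/negP => /(simple_card sE).
by rewrite setUid cards1.
Qed.

Lemma nu_rel_of E : nu (rel_of E) [set: V] = nu_K4 E.
Proof.
apply: eq_bigl => P; rewrite /packing /is_K4_packing; congr (_ && _).
by apply: eq_forallb_in => K _; rewrite subsetT andbT.
Qed.

(** Count incidences of vertices and edges: the edges at [v] correspond to its
    neighbours. *)
Lemma handshake E : is_simple_graph E -> edges (rel_of E) [set: V] [set: V] = 2 * #|E|.
Proof.
move=> sE; transitivity (\sum_(v : V) \sum_(e in E) (v \in e)).
  rewrite edges_sum1 (eq_bigl xpredT) => [|v]; last by rewrite in_setT.
  apply: eq_bigr => v _.
  have -> : \sum_(e in E) (v \in e) = #|[set e in E | v \in e]|.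
    rewrite -sum1_card big_mkcond [RHS]big_mkcond; apply: eq_bigr => e _.
    by rewrite inE; case: (e \in E); case: (v \in e).
  rewrite edges1 setTI -(card_in_imset (f := fun u => [set v; u])).
    congr #|pred_of_set _|; apply/setP => e; rewrite inE.
    apply/imsetP/andP => [[u]|[eE ve]].
      by rewrite inE => h ->; split; [exact: h|exact: set21].
    have c2 := simple_card sE eE.
    have /cards1P[u eu] : #|e :\ v| == 1 by have := cardsD1 v e; rewrite ve c2; nlia.
    exists u; last by rewrite -eu setD1K.
    by rewrite inE /rel_of -eu setD1K.
  move=> u w; rewrite !inE => hu hw E'.
  have nv : u != v by apply: contraTneq hu => ->; rewrite rel_of_irr.
  have : u \in [set v; w] by rewrite -E' set22.
  by rewrite !inE (negPf nv) => /eqP.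
rewrite exchange_big /= mulnC -sum_nat_const; apply: eq_bigr => e eE.
rewrite -(simple_card sE eE) -sum1_card [RHS]big_mkcond; apply: eq_bigr => v _.
by case: (v \in e).
Qed.

Lemma edges_ofE (g : rel V) : symmetric g -> irreflexive g ->
  rel_of (edges_of g) =2 g.
Proof.
move=> gS gI u v; rewrite /rel_of; apply/imsetP/idP => [[[x y]]|h]; last first.
  by exists (u, v); rewrite ?inE.
rewrite inE /= => gxy E.
have ne : y != x by apply: contraTneq gxy => ->; rewrite gI.
have hx : x \in [set u; v] by rewrite E set21.
have hy : y \in [set u; v] by rewrite E set22.
move: gxy ne; case/set2P: hx => ->; case/set2P: hy => ->; rewrite ?eqxx //.
by rewrite gS.
Qed.

Lemma edges_of_simple (g : rel V) : irreflexive g -> is_simple_graph (edges_of g).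
Proof.
move=> gI; apply/forall_inP => e /imsetP[[x y]]; rewrite inE /= => gxy ->.
have ne : x != y by apply: contraTneq gxy => ->; rewrite gI.
by rewrite cards2 ne.
Qed.

End EdgeSets.

Lemma ex_upper (n m : nat) :
  exists E : {set {set 'I_n}}, [/\ is_simple_graph E, nu_K4 E < m.+1 & #|E| = ex_K4 n m.+1].
Proof.
have [E] : {E : {set {set 'I_n}} | is_simple_graph E && (nu_K4 E < m.+1) & ex_K4 n m.+1 = #|E|}.
  apply: eq_bigmax_cond; apply/card_gt0P; exists set0; apply/andP; split.
    by apply/forall_inP => e; rewrite inE.
  rewrite ltnS; apply/bigmax_leqP => P /andP[/forall_inP h _].
  suff -> : P = set0 by rewrite cards0.
  apply/eqP; rewrite -subset0; apply/subsetP => K KP.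
  have := h K KP; rewrite /is_K4 => /andP[/eqP c4 /forall_inP q].
  have /card_gt0P[x xK] : 0 < #|K| by rewrite c4.
  have /card_gt0P[y /setD1P[yx yK]] : 0 < #|K :\ x|.
    by have := cardsD1 x K; rewrite xK c4; nlia.
  by have /forall_inP/(_ y yK) := q x xK; rewrite eq_sym yx inE.
by case/andP=> sE lE eE; exists E.
Qed.

Lemma ex_lower n m (g : rel 'I_n) : symmetric g -> irreflexive g ->
  nu g [set: 'I_n] <= m -> edges g [set: 'I_n] [set: 'I_n] <= 2 * ex_K4 n m.+1.
Proof.
move=> gS gI lnu; have sE := edges_of_simple gI.
have eqg := edges_ofE gS gI.
have <- : edges (rel_of (edges_of g)) [set: 'I_n] [set: 'I_n] = edges g [set: 'I_n] [set: 'I_n].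
  by apply: eq_bigr => u _; apply: eq_bigr => v _; rewrite eqg.
rewrite handshake // leq_mul2l /=.
apply: (@leq_bigmax_cond _ _ (fun E : {set {set 'I_n}} => #|E|) (edges_of g)).
rewrite sE /= ltnS -nu_rel_of; apply: leq_trans lnu.
apply/bigmax_leqP => P pP; apply: nu_ge; apply/packingP.
have [h t] := packingP _ _ _ pP; split=> // K KP.
have [/andP[c q] s] := h K KP; split=> //; rewrite /k4 c /=.
by apply/cliqueP => x y xK yK ne; rewrite -eqg; apply: (cliqueP _ _ q).
Qed.

(** * Extremal graphs *)
Section Block.
Variables (T : finType) (b : bool) (l : T -> nat).
Hypothesis l4 : forall v, l v < 4.

(** Blow-up of K4 with a loop at 0, where the pair 0-3 may be missing: class 0 is
    a clique, classes 1, 2, 3 are independent, and distinct classes are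
    joined except that 0 and 3 are joined only if [b]. *)
Definition block_adj i j :=
  if i == j then i == 0 else b || ~~ ((i == 0) && (j == 3) || (i == 3) && (j == 0)).

Definition block : rel T := fun u v => (u != v) && block_adj (l u) (l v).

Definition part i := [set v | l v == i].

Lemma block_sym : symmetric block.
Proof.
move=> u v; rewrite /block eq_sym; congr (_ && _); rewrite /block_adj eq_sym.
case: eqVneq => [->//|_]; congr (_ || ~~ _); rewrite orbC; congr (_ || _); exact: andbC.
Qed.

Lemma block_irr : irreflexive block.
Proof. by move=> u; rewrite /block eqxx. Qed.

Lemma part_disjoint i j : i != j -> [disjoint part i & part j].
Proof.
by move=> ne; apply: disjointI => v; rewrite !inE => /eqP->.
Qed.

Lemma setT_parts : [set: T] = part 0 :|: (part 1 :|: (part 2 :|: part 3)).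
Proof.
apply/setP => v; rewrite !inE; have := l4 v.
by case: (l v) => [|[|[|[|]]]].
Qed.

Lemma card_parts (K : {set T}) :
  #|K| = #|K :&: part 0| + #|K :&: part 1| + #|K :&: part 2| + #|K :&: part 3|.
Proof.
have d i j : i != j -> [disjoint K :&: part i & K :&: part j].
  by move=> ne; apply: disjointW (part_disjoint ne); apply: subsetIr.
rewrite -{1}(setIT K) setT_parts !setIUr !cardsU.
have e i j : i != j -> K :&: part i :&: (K :&: part j) = set0.
  by move=> ne; apply/eqP; rewrite setI_eq0 d.
by rewrite !setIUr !e // !setU0 !cards0 !subn0 !addnA.
Qed.

Lemma indep_part K i : clique block K -> i != 0 -> #|K :&: part i| <= 1.
Proof.
move=> /cliqueP qK ni; rewrite leqNgt; apply/negP => lt.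
have /card_gt0P[x xKi] : 0 < #|K :&: part i| by nlia.
have /card_gt0P[y /setD1P[yx yKi]] : 0 < #|(K :&: part i) :\ x|.
  by have := cardsD1 x (K :&: part i); rewrite xKi; nlia.
move: xKi yKi; rewrite !inE => /andP[xK /eqP lx] /andP[yK /eqP ly].
by have := qK y x yK xK yx; rewrite /block /block_adj lx ly eqxx (negPf ni) andbF.
Qed.

(** Then a K4 with a vertex in class 3 would have to find its other vertices in
    the independent classes 1 and 2. *)
Lemma far_part K : b = false -> clique block K -> K :&: part 3 != set0 ->
  K :&: part 0 = set0.
Proof.
move=> bF /cliqueP qK /set0Pn[x]; rewrite !inE => /andP[xK /eqP lx].
apply/setP => y; rewrite !inE; apply/negP => /andP[yK /eqP ly].
have ne : x != y by apply: contra_eq_neq lx => ->; rewrite ly.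
by have := qK x y xK yK ne; rewrite /block /block_adj lx ly bF /= andbF.
Qed.

Lemma edges_parts i j : i != j -> block_adj i j ->
  edges block (part i) (part j) = #|part i| * #|part j|.
Proof.
move=> ne a; rewrite -(edges_nonedges block); apply/esym/eqP; rewrite -[X in _ == X]addn0 eqn_add2l.
apply/nonedges0P => u v; rewrite !inE => /eqP lu /eqP lv.
rewrite /block lu lv a andbT; apply: contraNneq ne => E.
by rewrite -lu -lv E.
Qed.

Lemma edges_part0 : edges block (part 0) (part 0) + #|part 0| = #|part 0| ^ 2.
Proof.
rewrite -mulnn -(edges_nonedges block); congr (_ + _); apply/esym.
rewrite nonedges_sum1 -sum1_card; apply: eq_bigr => v vX; rewrite nonedges1.
rewrite (_ : part 0 :\: nbr block v = [set v]) ?cards1 //.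
move: vX; rewrite inE => /eqP lv; apply/setP => u; rewrite !inE /block /block_adj lv.
have [_|nl] := eqVneq (l u) 0; first by rewrite !andbT negbK eq_sym.
by rewrite andbF; apply/esym/negbTE; apply: contraNneq nl => ->; rewrite lv.
Qed.

Lemma block_edges :
  #|part 0| ^ 2 + 2 * (#|part 0| * (#|part 1| + #|part 2| + b * #|part 3|))
  + 2 * (#|part 1| * #|part 2| + #|part 1| * #|part 3| + #|part 2| * #|part 3|)
  <= edges block [set: T] [set: T] + #|part 0|.
Proof.
have S := edges_sym block_sym; have L := edgesUl block; have M := edgesUr block_sym.
have d0 : [disjoint part 0 & part 1 :|: (part 2 :|: part 3)].
  by apply: disjointI => v; rewrite !inE => /eqP->.
have d1 : [disjoint part 1 & part 2 :|: part 3].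
  by apply: disjointI => v; rewrite !inE => /eqP->.
have d2 : [disjoint part 2 & part 3] by apply: part_disjoint.
have adj i j : i != j -> block_adj i j -> edges block (part i) (part j) = #|part i| * #|part j|.
  exact: edges_parts.
have e03 : b * (#|part 0| * #|part 3|) <= edges block (part 0) (part 3).
  by case bE: b => //; rewrite mul1n adj // /block_adj bE.
have c1 : #|part 0| * (#|part 1| + #|part 2| + b * #|part 3|) =
    #|part 0| * #|part 1| + #|part 0| * #|part 2| + b * (#|part 0| * #|part 3|).
  by rewrite !mulnDr mulnCA.
have e01 := adj 0 1 isT; have e02 := adj 0 2 isT; have e12 := adj 1 2 isT.
have e13 := adj 1 3 isT; have e23 := adj 2 3 isT.
rewrite /block_adj /= in e01 e02 e12 e13 e23.
rewrite c1 -e01 ?orbT // -e02 ?orbT // -e12 ?orbT // -e13 ?orbT // -e23 ?orbT //.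
have e0 := edges_part0.
rewrite setT_parts L // !M // !L // (S (part 1) (part 0)) (S (part 2) (part 0))
  (S (part 3) (part 0)) (S (part 2) (part 1)) (S (part 3) (part 1)) (S (part 3) (part 2)).
move: (b * _) e03 => x e03; rewrite -e0; nlia.
Qed.

End Block.

Lemma sized_labels (T : finType) a p1 p2 p3 : #|T| = a + p1 + p2 + p3 ->
  exists l : T -> nat, (forall v, l v < 4) /\
   [/\ #|part l 0| = a, #|part l 1| = p1, #|part l 2| = p2 & #|part l 3| = p3].
Proof.
move=> cT.
have [|X _ cX] := @subset_of_card T setT a; first by rewrite cardsT cT; nlia.
have [|A sA cA] := @subset_of_card T (~: X) p1; first by rewrite cardsCs setCK cX cT; nlia.
have dXA : [disjoint X & A] by rewrite disjoint_sym disjoints_subset.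
have cXA : #|X :|: A| = a + p1.
  by rewrite cardsU cX cA; move: dXA; rewrite -setI_eq0 => /eqP->; rewrite cards0 subn0.
have [|B sB cB] := @subset_of_card T (~: (X :|: A)) p2; first by rewrite cardsCs setCK cXA cT; nlia.
have dXB : [disjoint X :|: A & B] by rewrite disjoint_sym disjoints_subset.
have cXB : #|X :|: A :|: B| = a + p1 + p2.
  by rewrite cardsU cXA cB; move: dXB; rewrite -setI_eq0 => /eqP->; rewrite cards0 subn0.
exists (fun v => if v \in X then 0 else if v \in A then 1 else if v \in B then 2 else 3).
split=> [v|]; first by case: ifP => // _; case: ifP => // _; case: ifP.
have nA v : v \in A -> v \notin X by rewrite disjoint_sym in dXA; exact: disjoint_notin dXA.
have nB v : v \in B -> v \notin X :|: A.
  by rewrite disjoint_sym in dXB; exact: disjoint_notin dXB.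
split.
- rewrite -cX; congr #|pred_of_set _|; apply/setP => v; rewrite inE.
  by case: ifP => // _; case: ifP => // _; case: ifP.
- rewrite -cA; congr #|pred_of_set _|; apply/setP => v; rewrite inE.
  case: ifP => [vX|_]; first by apply/esym/negbTE/negP => /nA; rewrite vX.
  by case: ifP => // _; case: ifP.
- rewrite -cB; congr #|pred_of_set _|; apply/setP => v; rewrite inE.
  have nBv := nB v; rewrite inE negb_or in nBv.
  case: ifP => [vX|_]; first by apply/esym/negbTE/negP => /nBv; rewrite vX.
  case: ifP => [vA|_]; first by apply/esym/negbTE/negP => /nBv; rewrite vA andbF.
  by case: ifP.
- have -> : p3 = #|~: (X :|: A :|: B)| by rewrite cardsCs setCK cXB cT; nlia.
  congr #|pred_of_set _|; apply/setP => v; rewrite !inE.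
  by case: ifP => //= _; case: ifP => //= _; case: ifP.
Qed.

(** Disjoint K4's use disjoint parts of [S]. *)
Lemma nu_hitting (T : finType) (g : rel T) (S : {set T}) j k : 0 < j ->
  #|S| <= j * k -> (forall K, k4 g K -> j <= #|K :&: S|) -> nu g [set: T] <= k.
Proof.
move=> j0 cS hit; apply/bigmax_leqP => P /packingP[h t].
rewrite -(leq_pmul2l j0); apply: leq_trans cS.
apply: leq_trans (sum_meet_trivIset S t); apply: sum_ge_const => K /h[kK _]; exact: hit.
Qed.

Section Constructions.
Variables (n k : nat).
Local Notation ex := (ex_K4 n k.+1).

Lemma block_bound b j a p1 p2 p3 (S : ('I_n -> nat) -> {set 'I_n}) :
  n = a + p1 + p2 + p3 -> 0 < j ->
  (forall l : 'I_n -> nat, (forall v, l v < 4) ->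
     [/\ #|part l 0| = a, #|part l 1| = p1, #|part l 2| = p2 & #|part l 3| = p3] ->
     #|S l| <= j * k /\ forall K, k4 (block b l) K -> j <= #|K :&: S l|) ->
  a ^ 2 + 2 * (a * (p1 + p2 + b * p3)) + 2 * (p1 * p2 + p1 * p3 + p2 * p3)
    <= 2 * ex + a.
Proof.
move=> en j0 hS; have [|l [l4 cl]] := @sized_labels 'I_n a p1 p2 p3; first by rewrite card_ord.
have [cS hit] := hS l l4 cl.
have lnu := nu_hitting j0 cS hit.
have := ex_lower (@block_sym _ b l) (@block_irr _ b l) lnu.
have := block_edges b l4; case: cl => -> -> -> ->; nlia.
Qed.

(** Every K4 has a vertex in class 0, as the other classes are three independent
    sets. *)
Lemma ex_joined_tripartite p1 p2 p3 : n = k + p1 + p2 + p3 ->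
  k ^ 2 + 2 * (k * (p1 + p2 + p3)) + 2 * (p1 * p2 + p1 * p3 + p2 * p3) <= 2 * ex + k.
Proof.
move=> en; have := @block_bound true 1 k p1 p2 p3 (fun l => part l 0) en isT.
change (nat_of_bool true) with 1; rewrite !mul1n => H; apply: H.
move=> l l4 [c0 c1 c2 c3]; rewrite c0; split=> // K kK.
have q := k4_clique kK; have c := card_parts l4 K; rewrite (k4_card kK) in c.
have := indep_part (i := 1) q isT; have := indep_part (i := 2) q isT.
have := indep_part (i := 3) q isT; nlia.
Qed.

(** A K4 has at most one vertex in the independent set. *)
Lemma ex_joined_indep p : n = 3 * k + p ->
  (3 * k) ^ 2 + 2 * (3 * k * p) <= 2 * ex + 3 * k.
Proof.
move=> en; have := @block_bound true 3 (3 * k) p 0 0 (fun l => part l 0) _ isT.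
rewrite !addn0 !muln0 !addn0 => H; apply: H => //.
move=> l l4 [c0 c1 c2 c3]; rewrite c0; split=> // K kK.
have q := k4_clique kK; have c := card_parts l4 K; rewrite (k4_card kK) in c.
have := indep_part (i := 1) q isT.
have := subset_leq_card (subsetIr K (part l 2)); have := subset_leq_card (subsetIr K (part l 3)).
nlia.
Qed.

Lemma near_part l (K : {set 'I_n}) : (forall v, l v < 4) -> k4 (block false l) K ->
  #|K :&: part l 3| = 0.
Proof.
move=> l4 kK; have q := k4_clique kK.
have c := card_parts l4 K; rewrite (k4_card kK) in c.
have := indep_part (i := 1) q isT; have := indep_part (i := 2) q isT.
have := indep_part (i := 3) q isT; have F := far_part erefl q.
have [->|/F h] := eqVneq (K :&: part l 3) set0; first by rewrite cards0.
move: c; rewrite h cards0; nlia.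
Qed.

(** A K4 avoids class 3 ([near_part]) and has at most one vertex in each of the
    classes 1 and 2. *)
Lemma ex_two_thirds p1 p2 p3 : n = 2 * k + p1 + p2 + p3 ->
  (2 * k) ^ 2 + 2 * (2 * k * (p1 + p2)) + 2 * (p1 * p2 + p1 * p3 + p2 * p3)
    <= 2 * ex + 2 * k.
Proof.
move=> en; have := @block_bound false 2 (2 * k) p1 p2 p3 (fun l => part l 0) en isT.
change (nat_of_bool false) with 0; rewrite mul0n addn0 => H; apply: H.
move=> l l4 [c0 c1 c2 c3]; rewrite c0; split=> // K kK.
have c := card_parts l4 K; rewrite (k4_card kK) (near_part l4 kK) in c.
have q := k4_clique kK.
have := indep_part (i := 1) q isT; have := indep_part (i := 2) q isT; nlia.
Qed.

(** A K4 avoids class 3, so it lies within the [4k] vertices of the other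
    classes. *)
Lemma ex_dense a p : a + 2 * p = 4 * k -> n = 4 * k + p ->
  a ^ 2 + 2 * (a * (2 * p)) + 6 * p ^ 2 <= 2 * ex + a.
Proof.
move=> ea en.
have := @block_bound false 4 a p p p (fun l => part l 0 :|: part l 1 :|: part l 2) _ isT.
change (nat_of_bool false) with 0; rewrite mul0n addn0 (_ : p * p + p * p + p * p = 3 * p ^ 2); last by rewrite -mulnn; nlia.
rewrite (_ : p + p = 2 * p); last by nlia.
rewrite (mulnA 2 3) => H; apply: H; first by nlia.
move=> l l4 [c0 c1 c2 c3]; split=> [|K kK].
  have := (leq_card_setU (part l 0 :|: part l 1) (part l 2)).1.
  by have := (leq_card_setU (part l 0) (part l 1)).1; rewrite c0 c1 c2; nlia.
have h3 := near_part l4 kK.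
have /setIidPl -> : K \subset part l 0 :|: part l 1 :|: part l 2; last by rewrite (k4_card kK).
apply/subsetP => v vK; have := in_setT v; rewrite (setT_parts l4) !setUA in_setU.
case/orP=> // v3; move/eqP: h3; rewrite cards_eq0 => /eqP/setP/(_ v).
by rewrite inE vK v3 inE.
Qed.

End Constructions.

Local Open Scope ring_scope.

(** * The formula in the coordinates (k, m) *)
Section XiFacts.
Variable R : realType.
Implicit Types k m n : R.

(** The five branches of [Xi (4k + m) k], expanded. *)
Definition Xi1 k m := 13 / 2 * k ^+ 2 + 3 * (k * m) + m ^+ 2 / 3.
Definition Xi2 k m := 22 / 3 * k ^+ 2 + 8 / 3 * (k * m) + m ^+ 2 / 3.
Definition Xi3 k m := 7 * k ^+ 2 + 3 * (k * m) + m ^+ 2 / 4.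
Definition Xi4 k m := 15 / 2 * k ^+ 2 + 3 * (k * m).
Definition Xi5 k m := 8 * k ^+ 2 + m ^+ 2.
Definition xi k m := Xi (4 * k + m) k.

Let sqrt2 : [/\ Num.sqrt 2 ^+ 2 = 2 :> R, 24 / 17 < Num.sqrt 2 :> R & Num.sqrt 2 < 10 / 7 :> R].
Proof.
have s2 : Num.sqrt 2 ^+ 2 = 2 :> R by rewrite sqr_sqrtr ?ler0n.
have s0 : 0 <= Num.sqrt 2 :> R by apply: sqrtr_ge0.
by split=> //; nra.
Qed.

Let sqrt7 : [/\ Num.sqrt 7 ^+ 2 = 7 :> R, 37 / 14 < Num.sqrt 7 :> R & Num.sqrt 7 < 8 / 3 :> R].
Proof.
have s2 : Num.sqrt 7 ^+ 2 = 7 :> R by rewrite sqr_sqrtr ?ler0n.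
have s0 : 0 <= Num.sqrt 7 :> R by apply: sqrtr_ge0.
by split=> //; nra.
Qed.

Lemma xi1 k m : 0 <= k -> 5 * k <= 2 * m -> xi k m = Xi1 k m.
Proof.
move=> k0 h; have [H _ _ _ _] := XiE (n := 4 * k + m) k ltac:(lra).
rewrite /xi H; first by rewrite /Xi1; field.
lra.
Qed.

Lemma xi2 k m : 0 <= k -> 2 * k <= m -> 2 * m <= 5 * k -> xi k m = Xi2 k m.
Proof.
move=> k0 h h'; have [_ H _ _ _] := XiE (n := 4 * k + m) k ltac:(lra).
rewrite /xi H; first by rewrite /Xi2; field.
by apply/andP; split; lra.
Qed.

Lemma xi3 k m : 0 <= k -> Num.sqrt 2 * k <= m -> m <= 2 * k -> xi k m = Xi3 k m.
Proof.
move=> k0 h h'; have [s2 s2l s2u] := sqrt2.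
have m0 : 0 <= m by nra.
have [_ _ H _ _] := XiE (n := 4 * k + m) k ltac:(lra).
rewrite /xi H; first by rewrite /Xi3; field.
have : 0 <= (4 - Num.sqrt 2) * (m - Num.sqrt 2 * k) by apply: mulr_ge0; lra.
by move: (Num.sqrt 2) s2 => s s2 H'; apply/andP; split; nra.
Qed.

Lemma xi4 k m : 0 <= k -> (3 - Num.sqrt 7) / 2 * k <= m -> m <= Num.sqrt 2 * k ->
  xi k m = Xi4 k m.
Proof.
move=> k0 h h'; have [s2 s2l s2u] := sqrt2; have [t2 tl tu] := sqrt7.
have m0 : 0 <= m by nra.
have [_ _ _ H _] := XiE (n := 4 * k + m) k ltac:(lra).
rewrite /xi H; first by rewrite /Xi4; field.
have h1 : 0 <= (4 - Num.sqrt 2) * (Num.sqrt 2 * k - m) by apply: mulr_ge0; lra.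
have h2 : 0 <= (11 + Num.sqrt 7) * (m - (3 - Num.sqrt 7) / 2 * k) by apply: mulr_ge0; lra.
move: (Num.sqrt 2) (Num.sqrt 7) s2 t2 h1 h2 => s t s2 t2 h1 h2; apply/andP; split; nra.
Qed.

Lemma xi5 k m : 0 <= k -> 0 <= m -> m <= (3 - Num.sqrt 7) / 2 * k -> xi k m = Xi5 k m.
Proof.
move=> k0 m0 h; have [t2 tl tu] := sqrt7.
have [_ _ _ _ H] := XiE (n := 4 * k + m) k ltac:(lra).
rewrite /xi H; first by rewrite /Xi5; field.
have h2 : 0 <= (11 + Num.sqrt 7) * ((3 - Num.sqrt 7) / 2 * k - m) by apply: mulr_ge0; lra.
move: (Num.sqrt 7) t2 h2 => t t2 h2; nra.
Qed.

(** The next three lemmas say, in a neighbourhood of each of the three ranges, which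
    forms may equal [xi] and which ones bound it below.  The differences are
    [Xi5 - Xi4 = m^2 - 3km + k^2/2], [Xi3 - Xi4 = (m^2 - 2k^2)/4],
    [Xi2 - Xi3 = (m - 2k)^2/12] and [Xi1 - Xi2 = k(2m - 5k)/6].  The rational
    bounds 24/17 and 10/7 enclose [sqrt 2]. *)
Lemma xi_small k m : 0 <= k -> 0 <= m -> 17 * m <= 24 * k ->
  [/\ Xi4 k m <= xi k m, Xi5 k m <= xi k m &
   xi k m = Xi4 k m \/ xi k m = Xi5 k m /\ 5 * m <= k].
Proof.
move=> k0 m0 h; have [s2 s2l s2u] := sqrt2; have [t2 tl tu] := sqrt7.
have hs : m <= Num.sqrt 2 * k by nra.
have [l|l] := lerP m ((3 - Num.sqrt 7) / 2 * k).
  have h5 : 5 * m <= k by nra.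
  rewrite xi5 //; split=> //; last by right.
  have : 0 <= ((3 - Num.sqrt 7) / 2 * k - m) * ((3 + Num.sqrt 7) / 2 * k - m).
    by apply: mulr_ge0; nra.
  rewrite /Xi4 /Xi5; move: (Num.sqrt 7) t2 => t t2; nra.
rewrite xi4 //; last exact: ltW; split=> //; last by left.
have : 0 <= (m - (3 - Num.sqrt 7) / 2 * k) * ((3 + Num.sqrt 7) / 2 * k - m).
  by apply: mulr_ge0; nra.
rewrite /Xi4 /Xi5; move: (Num.sqrt 7) t2 => t t2; nra.
Qed.

Lemma xi_middle k m : 0 <= k -> k <= m -> m <= 2 * k ->
  [/\ Xi3 k m <= xi k m, Xi4 k m <= xi k m & xi k m = Xi3 k m \/ xi k m = Xi4 k m].
Proof.
move=> k0 m0 h; have [s2 s2l s2u] := sqrt2; have [t2 tl tu] := sqrt7.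
have [l|l] := lerP m (Num.sqrt 2 * k).
  have h4 : (3 - Num.sqrt 7) / 2 * k <= m by nra.
  rewrite xi4 //; split=> //; last by right.
  have : 0 <= (Num.sqrt 2 * k - m) * (Num.sqrt 2 * k + m) by apply: mulr_ge0; nra.
  rewrite /Xi4 /Xi3; move: (Num.sqrt 2) s2 => t t2'; nra.
rewrite xi3 //; last exact: ltW; split=> //; last by left.
have : 0 <= (m - Num.sqrt 2 * k) * (Num.sqrt 2 * k + m) by apply: mulr_ge0; nra.
rewrite /Xi4 /Xi3; move: (Num.sqrt 2) s2 => t t2'; nra.
Qed.

Lemma xi_large k m : 0 <= k -> 10 * k <= 7 * m ->
  Xi3 k m <= xi k m /\ (2 * k <= m -> Xi1 k m <= xi k m /\ Xi2 k m <= xi k m) /\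
  [\/ xi k m = Xi3 k m /\ m <= 2 * k,
      xi k m = Xi2 k m /\ (2 * k <= m /\ 2 * m <= 5 * k)
    | xi k m = Xi1 k m /\ 5 * k <= 2 * m].
Proof.
move=> k0 h; have [s2 s2l s2u] := sqrt2.
have [l|l] := lerP m (2 * k).
  rewrite xi3 //; last by nra.
  split=> //; split; last by apply: Or31.
  move=> l'; have -> : m = 2 * k by lra.
  by rewrite /Xi1 /Xi2 /Xi3; split; nra.
have [l2|l2] := lerP (2 * m) (5 * k).
  rewrite xi2 //; last exact: ltW.
  by split; [rewrite /Xi2 /Xi3; nra|split; [rewrite /Xi1 /Xi2; nra|apply: Or32; split=> //; lra]].
rewrite xi1 //; last exact: ltW.
by split; [rewrite /Xi1 /Xi3; nra|split; [rewrite /Xi1 /Xi2; nra|apply: Or33; split=> //; lra]].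
Qed.

Lemma xi_ge0 k m : 0 <= k -> 0 <= m -> 0 <= xi k m.
Proof.
move=> k0 m0; have [l|l] := lerP (17 * m) (24 * k).
  by have [h _ _] := xi_small k0 m0 l; apply: le_trans h; rewrite /Xi4; nra.
have [l2|l2] := lerP m (2 * k).
  by have [h _ _] := xi_middle k0 (ltac:(lra) : k <= m) l2; apply: le_trans h; rewrite /Xi3; nra.
have [h _] := xi_large k0 (ltac:(lra) : 10 * k <= 7 * m).
by apply: le_trans h; rewrite /Xi3; nra.
Qed.

Let glue (f : R -> R) (a b c : R) : b <= c ->
  (forall x y, a <= x -> x <= y -> y <= b -> f x <= f y) ->
  (forall x y, b <= x -> x <= y -> y <= c -> f x <= f y) ->
  forall x y, a <= x -> x <= y -> y <= c -> f x <= f y.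
Proof.
move=> bc h1 h2 x y ax xy yc.
have [yb|yb] := lerP y b; first exact: h1.
have [xb|xb] := lerP x b; last by apply: h2 => //; exact: ltW.
by apply: le_trans (h1 x b _ _ _) (h2 b y _ _ _) => //; exact: ltW.
Qed.

Lemma Xi_mono n k k' : 0 <= k -> k <= k' -> 4 * k' <= n -> Xi n k <= Xi n k'.
Proof.
move=> k0 kk' kn; have n0 : 0 <= n by lra.
have [s2 s2l s2u] := sqrt2; have [t2 tl tu] := sqrt7.
pose t1 := 2 * n / 13; pose t2' := n / 6.
pose t3 := (4 - Num.sqrt 2) * n / 14; pose t4 := (11 + Num.sqrt 7) * n / 57.
have l12 : t1 <= t2' by rewrite /t1 /t2'; lra.
have l23 : t2' <= t3 by rewrite /t3 /t2'; nra.
have l34 : t3 <= t4 by rewrite /t3 /t4; nra.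
have l45 : t4 <= n / 4 by rewrite /t4; nra.
have b3 : t3 <= n / 3 by rewrite /t3; nra.
have b4 : t4 <= n / 3 by lra.
have E k1 := XiE k1 n0.
suff : forall x y, 0 <= x -> x <= y -> y <= n / 4 -> Xi n x <= Xi n y by apply=> //; lra.
apply: (@glue _ 0 t4) => //.
  apply: (@glue _ 0 t3) => //.
    apply: (@glue _ 0 t2') => //.
      apply: (@glue _ 0 t1) => //.
        move=> x y x0 xy yt; have [H _ _ _ _] := E x; have [H' _ _ _ _] := E y.
        rewrite H ?(le_trans xy yt) // H' //; move: yt; rewrite /t1 => yt; nra.
      move=> x y x0 xy yt.
      have [_ H _ _ _] := E x; have [_ H' _ _ _] := E y.
      rewrite H ?x0 ?(le_trans xy yt) // H' ?yt ?(le_trans x0 xy) //.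
      have x1 : 0 <= x by move: x0; rewrite /t1; lra.
      nra.
    move=> x y x0 xy yt.
    have [_ _ H _ _] := E x; have [_ _ H' _ _] := E y.
    rewrite H ?x0 ?(le_trans xy yt) // H' ?yt ?(le_trans x0 xy) //.
    have x1 : 0 <= x by move: x0; rewrite /t2'; lra.
    have y1 : y <= n / 3 by apply: le_trans yt b3.
    nra.
  move=> x y x0 xy yt.
  have [_ _ _ H _] := E x; have [_ _ _ H' _] := E y.
  rewrite H ?x0 ?(le_trans xy yt) // H' ?yt ?(le_trans x0 xy) //.
  have y1 : y <= n / 3 by apply: le_trans yt b4.
  nra.
move=> x y x0 xy yt.
have [_ _ _ _ H] := E x; have [_ _ _ _ H'] := E y.
rewrite H // H' ?(le_trans x0 xy) //.
have x1 : n / 6 <= x by apply: le_trans x0; rewrite -/t2'; lra.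
nra.
Qed.

End XiFacts.

(** * The quadratic inequality of the middle range *)
Section Numeric.
Variable R : realFieldType.
Implicit Types (a b c d k m p s t x y z : R).

Lemma sq_half a y : 2 * (a * y) - a ^+ 2 <= y ^+ 2.
Proof. have := sqr_ge0 (a - y); nra. Qed.

(** The left-hand side is twice the excess over [Xi4] of the bound for [x] tight and
    [p] loose tiles.  It vanishes when [x], [s2], [s3], [a], [b], [c] do.  When at
    most 3/4 of the tiles are tight, completing the squares in [a], [b], [c]
    is enough; otherwise [p] is small and the bounds [a, b, c <= p] are better. *)
Lemma loose_excess k x p m s2 s3 t a b c :
  0 <= x -> 0 <= p -> k = x + p -> 25 * k <= 18 * m -> 9 * m <= 13 * k ->
  0 <= s3 -> s3 <= s2 -> s2 <= m + p - t -> t = s2 + s3 ->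
  0 <= a -> a <= p -> 0 <= b -> b <= p -> 0 <= c -> c <= p ->
  2 * (x * (k - m)) - x ^+ 2 + 2 * (t * (m - 2 * k + 2 * x)) - 2 * t ^+ 2
    + 2 * (s2 * s3) + (2 * (a * s2) - a ^+ 2) + (2 * (b * s3) - b ^+ 2)
    + (2 * (c * (2 * t - m - p)) - c ^+ 2) <= 0.
Proof.
move=> x0 p0 ek m1 m2 s30 s32 s21 et a0 ap b0 bp c0 cp.
have t0 : 0 <= t by lra.
have t23 : 3 * t <= 2 * (m + p) by lra.
(* any cut between about 0.7 and 0.77 would do *)
have [xs|xl] := lerP (4 * x) (3 * k).
- have h1 := sq_half a s2; have h2 := sq_half b s3.
  have h3 : 2 * (s2 * s3) + s2 ^+ 2 + s3 ^+ 2 = t ^+ 2 by rewrite et; ring.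
  have [d0|d0] := lerP (2 * t - m - p) 0.
    have h4 : 2 * (c * (2 * t - m - p)) - c ^+ 2 <= 0.
      have := mulr_ge0_le0 c0 d0; have := sqr_ge0 c; lra.
    suff : 2 * (x * (k - m)) - x ^+ 2 + 2 * (t * (m - 2 * k + 2 * x)) - t ^+ 2 <= 0 by lra.
    have [e0|e0] := lerP (m - 2 * k + 2 * x) 0; first by nra.
    have h5 := sq_half t (m - 2 * k + 2 * x).
    suff : 2 * (x * (k - m)) - x ^+ 2 + (m - 2 * k + 2 * x) ^+ 2 <= 0 by lra.
    nra.
  have h4 := sq_half c (2 * t - m - p).
  suff : 2 * (x * (k - m)) - x ^+ 2 + 2 * (t * (m - 2 * k + 2 * x)) - t ^+ 2
     + (2 * t - m - p) ^+ 2 <= 0 by lra.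
  nra.
have h1 : 2 * (a * s2) - a ^+ 2 <= 2 * (p * s2) by nra.
have h2 : 2 * (b * s3) - b ^+ 2 <= 2 * (p * s3) by nra.
have h3 : 2 * (s2 * s3) <= t ^+ 2 / 2.
  by rewrite et; have := sqr_ge0 (s2 - s3); nra.
have h12 : 2 * (p * s2) + 2 * (p * s3) = 2 * (p * t) by rewrite et; ring.
have [d0|d0] := lerP (2 * t - m - p) 0.
  have h4 : 2 * (c * (2 * t - m - p)) - c ^+ 2 <= 0.
    have := mulr_ge0_le0 c0 d0; have := sqr_ge0 c; lra.
  suff : 2 * (x * (k - m)) - x ^+ 2 + 2 * (t * (m - 2 * k + 2 * x + p)) - 3 / 2 * t ^+ 2 <= 0 by lra.
  have h5 : 2 * (t * (m - 2 * k + 2 * x + p)) - 3 / 2 * t ^+ 2 <= 2 / 3 * (m - 2 * k + 2 * x + p) ^+ 2.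
    have := sqr_ge0 (3 * t - 2 * (m - 2 * k + 2 * x + p)); nra.
  nra.
have h4 : 2 * (c * (2 * t - m - p)) - c ^+ 2 <= 2 * (p * (2 * t - m - p)) by nra.
(* maximum over t, attained at t = 2 (m - 2k + 2x + 3p) / 3 *)
have h5 : 2 * (t * (m - 2 * k + 2 * x + 3 * p)) - 3 / 2 * t ^+ 2 <= 2 / 3 * (m - 2 * k + 2 * x + 3 * p) ^+ 2.
  have := sqr_ge0 (3 * t - 2 * (m - 2 * k + 2 * x + 3 * p)); nra.
suff : 2 * (x * (k - m)) - x ^+ 2 + 2 / 3 * (m - 2 * k + 2 * x + 3 * p) ^+ 2
   - 2 * (p * (m + p)) <= 0 by lra.
nra.
Qed.

(** Eliminates the neighbourhood sizes [n1], [n2], [n3]: since [s1] is the largest,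
    [s1 n1 + s2 n2 + s3 n3] is maximal when [n2] and [n3] are as small as their
    pairwise overlaps permit. *)
Lemma middle_numeric k x p m s1 s2 s3 n1 n2 n3 a b c :
  0 <= x -> 0 <= p -> k = x + p -> 25 * k <= 18 * m -> 9 * m <= 13 * k ->
  0 <= s3 -> s3 <= s2 -> s2 <= s1 -> s1 + s2 + s3 = m + p ->
  0 <= a -> a <= p -> 0 <= b -> b <= p -> 0 <= c -> c <= p ->
  n1 + n2 + n3 <= 3 * p + a + b + c -> a + c <= n2 -> b + c <= n3 ->
  (3 * p + 4 * x) ^+ 2 + 2 * (2 * (x * m) + 4 * (x * p))
  + 2 * (s1 * n1 + s2 * n2 + s3 * n3) + 2 * (s1 * s2 + s1 * s3 + s2 * s3)
  - (a ^+ 2 + b ^+ 2 + c ^+ 2) <= 15 * k ^+ 2 + 6 * (k * m).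
Proof.
move=> x0 p0 ek m1 m2 s30 s32 s21 es a0 ap b0 bp c0 cp h1 h2 h3.
have s10 : 0 <= s1 by lra.
have q1 : 0 <= s1 * (3 * p + a + b + c - (n1 + n2 + n3)) by apply: mulr_ge0; lra.
have q2 : 0 <= (s1 - s2) * (n2 - (a + c)) by apply: mulr_ge0; lra.
have q3 : 0 <= (s1 - s3) * (n3 - (b + c)) by apply: mulr_ge0; lra.
have q4 : s2 <= m + p - (s2 + s3) by lra.
have := loose_excess x0 p0 ek m1 m2 s30 s32 q4 erefl a0 ap b0 bp c0 cp.
have es1 : s1 = m + p - s2 - s3 by lra.
move: q1 q2 q3; rewrite es1 ek; lra.
Qed.

End Numeric.

(** * Slopes of the formula *)
Section Deltas.
Variable R : realType.
Implicit Types k m : R.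

(** The lemmas of this part bound below the decrease of the formula when a K4
    (from [(k, m)] to [(k - 1, m)]), a vertex, or [s] vertices meeting all
    maximum tilings (to [(k - 1, m + 4 - s)]) are removed.  It suffices to
    evaluate at both points the form active at the smaller one, as this form is a
    lower bound for [xi] at the larger one, up to O(1). *)
Lemma xi_drop_k4_small k m : 300 <= k -> 0 <= m -> 5 * m <= 7 * k ->
  14 * k + 3 * m - 20 <= xi k m - xi (k - 1) m.
Proof.
move=> k0 m0 h.
have [|||h4 h5 _] := @xi_small R k m; [lra|lra|lra|].
have [|||_ _ [->|[-> h']]] := @xi_small R (k - 1) m; [lra|lra|lra| |].
  by apply: le_trans (lerB h4 (lexx _)); rewrite /Xi4; lra.
by apply: le_trans (lerB h5 (lexx _)); rewrite /Xi5; lra.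
Qed.

Lemma xi_drop_triple_small k m : 300 <= k -> 0 <= m -> 5 * m <= 7 * k ->
  12 * k + 3 * m - 20 <= xi k m - xi (k - 1) (m + 1).
Proof.
move=> k0 m0 h.
have [|||h4 h5 _] := @xi_small R k m; [lra|lra|lra|].
have [|||_ _ [->|[-> h']]] := @xi_small R (k - 1) (m + 1); [lra|lra|lra| |].
  by apply: le_trans (lerB h4 (lexx _)); rewrite /Xi4; lra.
by apply: le_trans (lerB h5 (lexx _)); rewrite /Xi5; lra.
Qed.

Lemma xi_drop_middle k m d s : 300 <= k -> 7 * k <= 5 * m -> 9 * m <= 13 * k ->
  -1 <= d -> d <= 2 ->
  s <= Xi3 k m - Xi3 (k - 1) (m + d) -> s <= Xi4 k m - Xi4 (k - 1) (m + d) ->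
  s <= xi k m - xi (k - 1) (m + d).
Proof.
move=> k0 h1 h2 d1 d2 s3 s4.
have [|||h3 h4 _] := @xi_middle R k m; [lra|lra|lra|].
have [|||_ _ [->|->]] := @xi_middle R (k - 1) (m + d); [lra|lra|lra| |].
  by apply: le_trans (lerB h3 (lexx _)).
by apply: le_trans (lerB h4 (lexx _)).
Qed.

Lemma xi_drop_vertex_large k m : 300 <= k -> 13 * k <= 9 * m ->
  3 * k + m / 2 - 20 <= xi k m - xi k (m - 1) /\
  8 * k + 2 * m - 20 <= 3 * (xi k m - xi k (m - 1)).
Proof.
move=> k0 h.
have [||h3 [h12 _]] := @xi_large R k m; [lra|lra|].
have [||_ [_ [[-> h']|[-> [h' h'']]|[-> h']]]] := @xi_large R k (m - 1); [lra|lra| | |].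
- by move: h3; rewrite /Xi3; lra.
- have [|_ h2] := h12; first lra.
  by move: h2; rewrite /Xi2; lra.
have [|h1 _] := h12; first lra.
by move: h1; rewrite /Xi1; lra.
Qed.

Lemma xi_drop_k4_large k m : 300 <= k -> 13 * k <= 9 * m ->
  13 * k + 3 * m - 20 <= xi k m - xi (k - 1) m.
Proof.
move=> k0 h.
have [||h3 [h12 _]] := @xi_large R k m; [lra|lra|].
have [||_ [_ [[-> h']|[-> [h' h'']]|[-> h']]]] := @xi_large R (k - 1) m; [lra|lra| | |].
- by move: h3; rewrite /Xi3; lra.
- have [l|l] := lerP (2 * k) m.
    by have [_ h2] := h12 l; move: h2; rewrite /Xi2; lra.
  have q : 0 <= (2 * k - m) * (m - 2 * k + 2) by apply: mulr_ge0; lra.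
  by move: h3 q; rewrite /Xi3 /Xi2; lra.
have [|h1 _] := h12; first lra.
by move: h1; rewrite /Xi1; lra.
Qed.

End Deltas.

(** * Upper bound *)
Section Upper.
Variables (R : realType) (T : finType) (g : rel T).
Hypotheses (gS : symmetric g) (gI : irreflexive g).
Implicit Types (A K S U : {set T}).
Local Notation edges := (edges g).
Local Notation nonedges := (nonedges g).
Local Notation k4 := (k4 g).
Local Notation nu := (nu g).

Lemma nuS A U : A \subset U -> (nu A <= nu U)%N.
Proof.
move=> s; have [P [pP <-]] := nu_packing (leqnn (nu A)).
by apply: nu_ge; apply: packing_subU pP.
Qed.

Lemma nu_card U : (4 * nu U <= #|U|)%N.
Proof.
have [P [pP <-]] := nu_packing (leqnn (nu U)).
by rewrite -(kfam_card pP) subset_leq_card // (kfam_cover pP).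
Qed.

Lemma nu_remove_k4 U K : k4 K -> K \subset U -> (nu (U :\: K) < nu U)%N.
Proof.
move=> kK sK; have [P [pP <-]] := nu_packing (leqnn (nu (U :\: K))).
have pU := packing_subU (subsetDl U K) pP.
have [|pK cK] := packingU1 pU kK sK.
  have := kfam_cover pP; rewrite subsetD => /andP[_].
  by rewrite disjoint_sym.
by rewrite -cK; apply: nu_ge.
Qed.

(** Absorbs both the case of at most 300 tiles and the linear error terms of the
    other cases. *)
Definition slack : R := 100 * 100.

Definition bounded U :=
  (edges U U)%:R <= 2 * Xi #|U|%:R (nu U)%:R + slack * #|U|%:R :> R.

(** The tiles meet O(n) edges, and Turan's bound [m^2/3] holds in the rest. *)
Lemma bounded_few_tiles U : (nu U <= 300)%N -> bounded U.
Proof.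
move=> lk; have [P [pP cP]] := nu_packing (leqnn (nu U)).
have cR := card_rest pP; rewrite cP in cR.
have mP : (nu U <= #|P|)%N by rewrite cP.
have eU : U = rest U P :|: cover P.
  by rewrite /rest setUC -{1}(setID U (cover P)) (setIidPr (kfam_cover pP)).
have tur := turan_k4_free gS gI (U := rest U P) (fun K kK sK => no_k4_rest pP mP kK sK).
have e1 : (edges U U <= edges (rest U P) (rest U P) + 2 * (#|cover P| * #|U|))%N.
  have d := rest_cover U P.
  have h1 := edges_le g (cover P) U.
  have -> : edges U U = (edges (rest U P) (rest U P) + edges (rest U P) (cover P) + edges (cover P) U)%N.
    by rewrite {1 2}eU edgesUl // edgesUr // -eU.
  have h2 : (edges (rest U P) (cover P) <= edges (cover P) U)%N.
    by rewrite edges_sym // [X in (_ <= edges _ X)%N]eU edgesUr // leq_addr.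
  nlia.
rewrite (kfam_card pP) cP in e1.
rewrite /bounded.
move: (edges U U) (edges _ _) tur e1 => a b tur e1.
have n0 : (0 : R) <= #|U|%:R by [].
have k0 : (0 : R) <= (nu U)%:R by [].
have k1 : (nu U)%:R <= 300 :> R by rewrite (ler_nat _ _ 300).
have hm : #|rest U P|%:R + 4 * (nu U)%:R = #|U|%:R :> R by rewrite -cR natrD natrM.
have m0 : (0 : R) <= #|rest U P|%:R by [].
have tur' : 3 * b%:R <= 2 * #|rest U P|%:R ^+ 2 :> R.
  by rewrite -natrX -!natrM ler_nat.
have e1' : a%:R <= b%:R + 2 * (4 * (nu U)%:R * #|U|%:R) :> R.
  by rewrite -!natrM -natrD ler_nat.
rewrite -hm in e1' *.
have -> : #|rest U P|%:R + 4 * (nu U)%:R = 4 * (nu U)%:R + #|rest U P|%:R :> R by lra.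
rewrite -/(xi _ _) /slack.
move: (#|rest U P|%:R : R) ((nu U)%:R : R) (a%:R : R) (b%:R : R) m0 k0 k1 tur' e1'.
move=> m k A B m0 k0 k1 tur' e1'.
have x0 := xi_ge0 k0 m0.
have p0 : 0 <= (300 - k) * (m + 4 * k) by apply: mulr_ge0; lra.
have p1 : 0 <= (300 - k) * m by apply: mulr_ge0; lra.
have p2 : 0 <= (300 - k) * k by apply: mulr_ge0; lra.
have [l|l] := lerP (2 * k) m.
  have [|h _] := xi_large k0 (_ : 10 * k <= 7 * m); first lra.
  have [|_ [h12 _]] := xi_large k0 (_ : 10 * k <= 7 * m); first lra.
  have [_ h2] := h12 l; move: h2; rewrite /Xi2 => h2.
  have km : 0 <= k * m by apply: mulr_ge0.
  have kk : 0 <= k ^+ 2 by apply: sqr_ge0.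
  lra.
have q : 0 <= (2 * k - m) * (m + 2 * k) by apply: mulr_ge0; lra.
lra.
Qed.

(** The induction hypothesis for [U :\: S] and the failure of the bound for [U]
    show that [S] meets many edges, hence has few non-neighbours. *)
Lemma removal U S k' (m' : R) : ~ bounded U -> bounded (U :\: S) -> S \subset U ->
  (nu (U :\: S) <= k')%N ->
  4 * k'%:R + m' = #|U|%:R - #|S|%:R -> 0 <= m' ->
  2 * (nonedges S U)%:R + 2 * (Xi #|U|%:R (nu U)%:R - xi k'%:R m') + slack * #|S|%:R
    < 2 * (#|S|%:R * #|U|%:R).
Proof.
move=> /negP; rewrite -ltNge => nb b sS lk em m0.
have cD : #|U :\: S|%:R = #|U|%:R - #|S|%:R :> R.
  by rewrite cardsD (setIidPr sS) natrB // subset_leq_card.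
have mono := @Xi_mono R #|U :\: S|%:R (nu (U :\: S))%:R k'%:R (ler0n _ _).
have {}mono : Xi #|U :\: S|%:R (nu (U :\: S))%:R <= xi k'%:R m'.
  by rewrite /xi em -cD; apply: mono; rewrite ?ler_nat // cD -em; lra.
have eS := edges_nonedges g S U.
have e1 : (edges U U <= edges (U :\: S) (U :\: S) + 2 * edges S U)%N.
  have eU : U = S :|: (U :\: S) by rewrite -{1}(setIidPr sS) setID.
  have d : [disjoint S & U :\: S] by apply: disjointI => x xS; rewrite inE xS.
  have -> : edges U U = (edges S U + edges (U :\: S) S + edges (U :\: S) (U :\: S))%N.
    by rewrite {1}eU edgesUl // {3}eU edgesUr // addnA.
  have h2 : (edges (U :\: S) S <= edges S U)%N.
    by rewrite edges_sym // [X in (_ <= edges _ X)%N]eU edgesUr // leq_addl.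
  nlia.
have e1' : (edges U U)%:R <= (edges (U :\: S) (U :\: S))%:R + 2 * (edges S U)%:R :> R.
  by rewrite -natrM -natrD ler_nat.
have eS' : (edges S U)%:R + (nonedges S U)%:R = #|S|%:R * #|U|%:R :> R.
  by rewrite -natrD eS natrM.
move: b; rewrite /bounded cD => b; rewrite cD in mono; lra.
Qed.

End Upper.

Section UpperInduction.
Variables (R : realType) (T : finType) (g : rel T).
Hypotheses (gS : symmetric g) (gI : irreflexive g).
Implicit Types (A K S U : {set T}).
Local Notation edges := (edges g).
Local Notation nonedges := (nonedges g).
Local Notation k4 := (k4 g).
Local Notation nu := (nu g).

Local Notation slack := (slack R).
Local Notation bounded := (bounded R g).

Section Counterexample.
Variables (U : {set T}) (k m : nat).
Hypotheses (cU : #|U| = (4 * k + m)%N) (nuU : nu U = k) (bigk : (300 < k)%N).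
Hypothesis nb : ~ bounded U.
Hypothesis IH : forall A, (#|A| < #|U|)%N -> bounded A.
Let rk : R := k%:R.
Let rm : R := m%:R.

Let rk_ge : 300 <= rk. Proof. by rewrite /rk (ler_nat _ 300) ltnW. Qed.
Let rm0 : 0 <= rm. Proof. exact: ler0n. Qed.

Let cUr : #|U|%:R = 4 * rk + rm :> R. Proof. by rewrite cU natrD natrM. Qed.

Lemma smaller S : S \subset U -> (0 < #|S|)%N -> bounded (U :\: S).
Proof.
move=> sS S0; apply: IH; have := cardsD U S; rewrite (setIidPr sS) => ->.
by have := subset_leq_card sS; nlia.
Qed.

Lemma removal_same_tiles S s : S \subset U -> #|S| = s -> (0 < s <= m)%N ->
  2 * (nonedges S U)%:R + 2 * (xi rk rm - xi rk (rm - s%:R)) + slack * s%:R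
    < 2 * (s%:R * (4 * rk + rm)).
Proof.
move=> sS cS /andP[s0 sm].
have := @removal R T g gS U S k (rm - s%:R) nb (smaller sS _) sS.
rewrite cS cUr nuU /xi; apply => //.
- by rewrite -nuU nuS // subsetDl.
- by rewrite -/rk; lra.
- by rewrite subr_ge0 ler_nat.
Qed.

Lemma removal_fewer_tiles S s : S \subset U -> #|S| = s -> (0 < s <= m + 4)%N ->
  (nu (U :\: S) < k)%N ->
  2 * (nonedges S U)%:R + 2 * (xi rk rm - xi (rk - 1) (rm + (4 - s%:R))) + slack * s%:R
    < 2 * (s%:R * (4 * rk + rm)).
Proof.
move=> sS cS /andP[s0 sm] lk.
have ek : k.-1%:R = rk - 1 :> R by rewrite -subn1 natrB //; nlia.
have := @removal R T g gS U S k.-1 (rm + (4 - s%:R)) nb (smaller sS _) sS.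
rewrite cS cUr nuU ek /xi; apply => //.
- by nlia.
- by lra.
- have : s%:R <= rm + 4 by rewrite -natrD ler_nat.
  by lra.
Qed.

Lemma removal_k4 K : k4 K -> K \subset U ->
  2 * (nonedges K U)%:R + 2 * (xi rk rm - xi (rk - 1) rm) + slack * 4
    < 2 * (4 * (4 * rk + rm)).
Proof.
move=> kK sK; have lk : (nu (U :\: K) < k)%N by rewrite -nuU nu_remove_k4.
by have := removal_fewer_tiles sK (k4_card kK) ltac:(nlia) lk; rewrite subrr addr0.
Qed.

Lemma no_counterexample_small : (5 * m <= 7 * k)%N -> False.
Proof.
move=> lm.
have lm' : 5 * rm <= 7 * rk by rewrite /rm /rk -!natrM ler_nat.
apply: nb; have low : (edges U U <= (4 * k + 3) ^ 2 + 2 * m ^ 2)%N.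
  apply: (small_rest_bound gS gI (k := k) (m := m)) => //; first by nlia.
    move=> K kK sK; have h := removal_k4 kK sK; have d := xi_drop_k4_small rk_ge rm0 lm'.
    rewrite -(ler_nat R) natrD natrM -/rk -/rm; move: h d; rewrite /slack; lra.
  move=> S sS cS; rewrite leqNgt; apply/negP => lk.
  have h := removal_fewer_tiles sS cS ltac:(nlia) lk; have d := xi_drop_triple_small rk_ge rm0 lm'.
  have n0 : 0 <= (nonedges S U)%:R :> R by [].
  have e1 : 4 - 3 = 1 :> R by lra.
  by move: h; rewrite e1 /slack; lra.
have := low; rewrite -(ler_nat R) !(natrM, natrX, natrD) -/rk -/rm => {}low.
have rk0' : 0 <= rk by apply: le_trans rk_ge; lra.
have lm2 : 17 * rm <= 24 * rk by lra.
have [_ h5 _] := xi_small rk0' rm0 lm2.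
rewrite /bounded nuU cUr -/(xi _ _) /slack.
move: h5 low rk_ge rm0; rewrite /Xi5.
by move: (xi rk rm) rk rm ((edges U U)%:R : R) => X K M e h5 low K0 M0; lra.
Qed.

Lemma no_counterexample_large : (13 * k <= 9 * m)%N -> False.
Proof.
move=> lm.
have lm' : 13 * rk <= 9 * rm by rewrite /rm /rk -!natrM ler_nat.
have [d1 d2] := xi_drop_vertex_large rk_ge lm'; have dK := xi_drop_k4_large rk_ge lm'.
have V v : v \in U -> 2 * (nonedges [set v] U)%:R + 2 * (xi rk rm - xi rk (rm - 1)) + slack
    < 2 * (4 * rk + rm) :> R.
  move=> vU; have := @removal_same_tiles [set v] 1 _ (cards1 v); rewrite sub1set vU mulr1 mul1r.
  by apply => //; nlia.
apply: (@large_rest_absurd T g gS gI U k m cU nuU); last 3 first.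
- by nlia.
- by nlia.
- by nlia.
- move=> v vU; have := V v vU; rewrite -(ler_nat R) !(natrM, natrD) -/rk -/rm /slack.
  move: d1; move: ((nonedges _ _)%:R : R) (xi _ _ - _) => y X; lra.
- move=> v vU; have := V v vU; rewrite -(ltr_nat R) !(natrM, natrD) -/rk -/rm /slack.
  move: d2; move: ((nonedges _ _)%:R : R) (xi _ _ - _) => y X; lra.
move=> K kK sK; have := removal_k4 kK sK; rewrite -(ltr_nat R) !(natrM, natrD) -/rk -/rm /slack.
move: dK; move: ((nonedges _ _)%:R : R) (xi _ _ - _) => y X; lra.
Qed.

Lemma no_counterexample_middle : (7 * k <= 5 * m)%N -> (9 * m <= 13 * k)%N -> False.
Proof.
move=> lm um.
have lm' : 7 * rk <= 5 * rm by rewrite /rm /rk -!natrM ler_nat.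
have um' : 9 * rm <= 13 * rk by rewrite /rm /rk -!natrM ler_nat.
have d0 := @xi_drop_middle R rk rm 0 (14 * rk + 3 * rm - 20) rk_ge lm' um'.
have d2 := @xi_drop_middle R rk rm 2 (8 * rk + 2 * rm - 20) rk_ge lm' um'.
have d1 := @xi_drop_middle R rk rm (-1) (16 * rk + 4 * rm - 20) rk_ge lm' um'.
have {}d0 : 14 * rk + 3 * rm - 20 <= xi rk rm - xi (rk - 1) rm.
  by rewrite -[rm in X in _ <= X]addr0 ?addr0; move: d0; rewrite addr0; apply; rewrite /Xi3 /Xi4; lra.
have {}d2 : 8 * rk + 2 * rm - 20 <= xi rk rm - xi (rk - 1) (rm + 2).
  by apply: d2; rewrite /Xi3 /Xi4; lra.
have {}d1 : 16 * rk + 4 * rm - 20 <= xi rk rm - xi (rk - 1) (rm + -1).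
  by apply: d1; rewrite /Xi3 /Xi4; lra.
have [] := @middle_rest_bound T g gS gI U k m cU nuU.
- by nlia.
- move=> K kK sK; have := removal_k4 kK sK.
  rewrite -(ler_nat R) !(natrM, natrD) -/rk -/rm /slack; lra.
- move=> K r kK sK rU rK.
  have dr : [disjoint K & [set r]] by rewrite disjoint_sym disjoints1.
  have cS : #|K :|: [set r]| = 5 by rewrite setUC cardsU1 rK (k4_card kK).
  have sS : K :|: [set r] \subset U by rewrite subUset sK sub1set.
  have lk : (nu (U :\: (K :|: [set r])) < k)%N.
    rewrite -nuU; apply: leq_ltn_trans (nu_remove_k4 kK sK).
    by apply: nuS; apply: setDS; apply: subsetUl.
  have h := removal_fewer_tiles sS cS ltac:(nlia) lk.
  have e1 : 4 - 5 = -1 :> R by lra.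
  move: h; rewrite e1 nonedgesUl // -(ltr_nat R) !(natrM, natrD) -/rk -/rm /slack; lra.
- move=> S sS cS; rewrite leqNgt; apply/negP => lk.
  have h := removal_fewer_tiles sS cS ltac:(nlia) lk.
  have n0 : 0 <= (nonedges S U)%:R :> R by [].
  have e1 : 4 - 2 = 2 :> R by lra.
  by move: h; rewrite e1 /slack; lra.
move=> x [p [M [s1 [s2 [s3 [n1 [n2 [n3 [a [b [c]]]]]]]]]]].
case=> [[ek em] [/andP[s32 s21] es] [ap bp cp] [h1 h2 h3] he].
have ekr : rk = x%:R + p%:R by rewrite -natrD -ek.
have emr : rm = M%:R + 2 by rewrite -natrD -em.
have := @middle_numeric R rk x%:R p%:R M%:R s1%:R s2%:R s3%:R n1%:R n2%:R n3%:R a%:R b%:R c%:R.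
move=> /(_ (ler0n _ _) (ler0n _ _) ekr) num.
have M1 : 25 * rk <= 18 * M%:R by move: emr lm' rk_ge; move: rk rm (M%:R : R) => K N L; lra.
have M2 : 9 * M%:R <= 13 * rk by move: emr um' rk_ge; move: rk rm (M%:R : R) => K N L; lra.
have {}num := num M1 M2 (ler0n _ _).
have {}num := num ltac:(by rewrite ler_nat) ltac:(by rewrite ler_nat) ltac:(by rewrite -!natrD es).
have {}num := num (ler0n _ _) ltac:(by rewrite ler_nat) (ler0n _ _) ltac:(by rewrite ler_nat)
  (ler0n _ _) ltac:(by rewrite ler_nat).
have {}num := num ltac:(by rewrite -!natrM -!natrD ler_nat) ltac:(by rewrite -!natrD ler_nat)
  ltac:(by rewrite -!natrD ler_nat).
apply: nb; have rk0' : 0 <= rk by apply: le_trans rk_ge; lra.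
have rkm : rk <= rm by move: lm' rk_ge; move: rk rm => K N; lra.
have rm2 : rm <= 2 * rk by move: um' rk_ge; move: rk rm => K N; lra.
have [_ h4 _] := xi_middle rk0' rkm rm2.
rewrite /bounded nuU cUr -/(xi _ _) /slack.
move: he; rewrite -(ler_nat R) !(natrM, natrX, natrD) cUr.
move: h4; rewrite /Xi4 emr => h4 he.
have xk : x%:R <= rk by rewrite ler_nat; nlia.
have kM0 : 0 <= M%:R :> R by [].
move: h4 he num; rewrite -/rk; lra.
Qed.

End Counterexample.

(** The cut points 7/5 and 13/9 enclose [sqrt 2], so that [xi] is the maximum of
    [Xi4] and [Xi5] below them, of [Xi3] and [Xi4] between them, and one of [Xi1],
    [Xi2], [Xi3] above them. *)
Lemma all_bounded U : bounded U.
Proof.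
have [n] := ubnP #|U|; elim: n U => // n IHn U ltU.
apply/negPn/negP => /negP nb.
have [lk|lk] := leqP (nu U) 300; first by apply: nb; exact: bounded_few_tiles.
have := nu_card g U; set k := nu U => kn; pose m := (#|U| - 4 * k)%N.
have cU : #|U| = (4 * k + m)%N by rewrite /m; nlia.
have IH A : (#|A| < #|U|)%N -> bounded A by move=> lA; apply: IHn; nlia.
have [l|l] := leqP (5 * m) (7 * k).
  exact: (no_counterexample_small cU erefl lk nb IH l).
have [h|h] := leqP (13 * k) (9 * m).
  exact: (no_counterexample_large cU erefl lk nb IH h).
exact: (no_counterexample_middle cU erefl lk nb IH (ltnW l) (ltnW h)).
Qed.

End UpperInduction.

(** * Lower bound and conclusion *)
Section Lower.
Variable R : realType.

Section Pieces.
Variables k m : nat.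
Let n := (4 * k + m)%N.
Let ex : R := (ex_K4 n k.+1)%:R.
Let rk : R := k%:R.
Let rm : R := m%:R.

(** The independent classes have [k + m/3] vertices each, up to rounding; the
    remainder of the division goes to the last class. *)
Lemma ex_Xi1 : Xi1 rk rm <= ex + (4 * rk + rm).
Proof.
pose q := (m %/ 3)%N; pose r := (m %% 3)%N.
have em : m = (3 * q + r)%N by rewrite /q /r; lia.
have r2 : (r <= 2)%N by rewrite /r; lia.
have := @ex_joined_tripartite n k (k + q) (k + q) (k + q + r) ltac:(rewrite /n; lia).
rewrite -(ler_nat R) !(natrM, natrX, natrD) -/rk -/ex => H.
have e : rm = 3 * q%:R + r%:R by rewrite /rm em natrD natrM.
have r2' : r%:R <= 2 :> R by rewrite (ler_nat R r 2).
move: H; rewrite e /Xi1; move: (ler0n R k) (ler0n R q) (ler0n R r) r2'.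
rewrite -/rk; move: ex rk (q%:R : R) (r%:R : R) => X K Q S k0 q0 r0 r2' H.
have rr : 0 <= S * (2 - S) by apply: mulr_ge0; lra.
lra.
Qed.

Lemma ex_Xi2 : (2 * k <= m)%N -> Xi2 rk rm <= ex + (4 * rk + rm).
Proof.
move=> lm; pose q := (n %/ 3)%N; pose r := (n %% 3)%N.
have en : n = (3 * q + r)%N by rewrite /q /r; lia.
have r2 : (r <= 2)%N by rewrite /r; lia.
have lp : (2 * k <= q + r)%N by move: en; rewrite /n; lia.
have := @ex_two_thirds n k q q (q + r - 2 * k) ltac:(lia).
rewrite -(ler_nat R) !(natrM, natrX, natrD) natrB // !(natrM, natrD) -/rk -/ex => H.
have e : rm = 3 * q%:R + r%:R - 4 * rk.
  by have : n%:R = 3 * q%:R + r%:R :> R; [rewrite en natrD natrM|rewrite natrD natrM -/rk -/rm; lra].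
have r2' : r%:R <= 2 :> R by rewrite (ler_nat R r 2).
have m0 : 0 <= rm by [].
move: m0 H; rewrite e /Xi2; move: (ler0n R k) (ler0n R q) (ler0n R r) r2'.
rewrite -/rk; move: ex rk (q%:R : R) (r%:R : R) => X K Q S k0 q0 r0 r2' m0 H.
have rr : 0 <= S * (2 - S) by apply: mulr_ge0; lra.
lra.
Qed.

Lemma ex_Xi3 : Xi3 rk rm <= ex + (4 * rk + rm).
Proof.
pose q := (m %/ 2)%N; pose r := (m %% 2)%N.
have em : m = (2 * q + r)%N by rewrite /q /r; lia.
have r2 : (r <= 1)%N by rewrite /r; lia.
have := @ex_two_thirds n k (k + q) (k + q + r) 0 ltac:(rewrite /n; lia).
rewrite -(ler_nat R) !(natrM, natrX, natrD) -/rk -/ex => H.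
have e : rm = 2 * q%:R + r%:R by rewrite /rm em natrD natrM.
have r2' : r%:R <= 1 :> R by rewrite (ler_nat R r 1).
move: H; rewrite e /Xi3; move: (ler0n R k) (ler0n R q) (ler0n R r) r2'.
rewrite -/rk; move: ex rk (q%:R : R) (r%:R : R) => X K Q S k0 q0 r0 r2' H.
have rr : 0 <= S * (1 - S) by apply: mulr_ge0; lra.
lra.
Qed.

Lemma ex_Xi4 : Xi4 rk rm <= ex + (4 * rk + rm).
Proof.
have := @ex_joined_indep n k (k + m) ltac:(rewrite /n; lia).
rewrite -(ler_nat R) !(natrM, natrX, natrD) -/rk -/rm -/ex => H.
move: H (ler0n R k) (ler0n R m); rewrite /Xi4 -/rk -/rm.
move: ex rk rm => X K M H k0 m0; lra.
Qed.

Lemma ex_Xi5 : (2 * m <= 4 * k)%N -> Xi5 rk rm <= ex + (4 * rk + rm).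
Proof.
move=> lm; have := @ex_dense n k (4 * k - 2 * m) m ltac:(lia) erefl.
rewrite -(ler_nat R) !(natrM, natrX, natrD) natrB // !natrM -/rk -/rm -/ex => H.
move: H (ler0n R k) (ler0n R m); rewrite /Xi5 -/rk -/rm.
move: ex rk rm => X K M H k0 m0; lra.
Qed.

Lemma xi_le_ex : xi rk rm <= ex + (4 * rk + rm).
Proof.
have k0 : 0 <= rk by []. have m0 : 0 <= rm by [].
have [l|l] := lerP (17 * rm) (24 * rk).
  have [_ _ [->|[-> h]]] := xi_small k0 m0 l; first exact: ex_Xi4.
  apply: ex_Xi5; move: h; rewrite -natrM ler_nat; lia.
have [l2|l2] := lerP rm (2 * rk).
  have km : rk <= rm by move: l k0; move: rk rm => K M; lra.
  have [_ _ [->|->]] := xi_middle k0 km l2; [exact: ex_Xi3|exact: ex_Xi4].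
have km : 10 * rk <= 7 * rm by move: l2 k0; move: rk rm => K M; lra.
have [_ [_ [[-> _]|[-> _]|[-> _]]]] := xi_large k0 km; [exact: ex_Xi3| |exact: ex_Xi1].
apply: ex_Xi2; move: (ltW l2); rewrite -natrM ler_nat; lia.
Qed.

End Pieces.
End Lower.

Theorem theorem1p3 (R : realType) :
  exists C : R, forall n k : nat, (4 * k <= n)%N ->
    `| (ex_K4 n k.+1)%:R - Xi n%:R k%:R | <= C * n%:R.
Proof.
exists (100 * 100) => n k kn; pose m := (n - 4 * k)%N.
have en : n = (4 * k + m)%N by rewrite /m; lia.
have enr : n%:R = 4 * k%:R + m%:R :> R by rewrite en natrD natrM.
rewrite ler_norml; apply/andP; split.
  have := xi_le_ex R k m; rewrite -en /xi -enr.
  have : (0 : R) <= n%:R by [].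
  by lra.
have [E [sE lE eE]] := ex_upper n k.
have b := all_bounded R (@rel_of_sym _ E) (rel_of_irr sE) [set: 'I_n].
move: b; rewrite /bounded handshake // nu_rel_of cardsT card_ord natrM eE /slack => b.
have mono : Xi n%:R (nu_K4 E)%:R <= Xi n%:R k%:R :> R.
  by apply: Xi_mono => //; rewrite ?ler_nat // -natrM ler_nat.
have : (0 : R) <= n%:R by [].
lra.
Qed.
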